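(* Let $d_1\in\{0,1,\ldots,5\}$ be a constant and let $D_2(n)$ be a monotonically non-decreasing integer-valued function which for all large $n$ satisfies $D_2(n)\ge\max\{d_1,3\}$ and $(d_1,D_2(n))\notin\{(3,3),(5,5)\}$. Then there exists a finite constant $\gamma_{d_1,D_2}>0$ such that $$\left(\frac{|\mathcal{P}(n,d_1,5,0,D_2)|}{n!}\right)^{1/n}\to\gamma_{d_1,D_2}\quad\text{as } n\to\infty.$$
   Context: $\mathcal{P}(n,d_1,d_2,D_1,D_2)$ denotes the set of simple labelled planar graphs on vertex set $\{1,\ldots,n\}$ with minimum degree in $[d_1,d_2]$ and maximum degree in $[D_1,D_2]$; here $D_2$ may depend on $n$, so $\mathcal{P}(n,d_1,5,0,D_2)$ is the set of planar graphs on $\{1,\ldots,n\}$ with all degrees between $d_1$ and $D_2(n)$. *)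

(* Defs.v *)
From HB Require Import structures.
From mathcomp Require Import all_boot all_order all_algebra.
From mathcomp Require Import all_classical all_reals all_analysis.

Set Implicit Arguments.
Unset Strict Implicit.
Unset Printing Implicit Defensive.

Import Order.TTheory GRing.Theory Num.Theory.
Import numFieldNormedType.Exports.

Local Open Scope classical_set_scope.
Local Open Scope ring_scope.

(* A simple graph on the vertex set T is identified with its set E of edges,
   an edge being an unordered pair of distinct vertices. *)
Definition simple_graph (T : finType) (E : {set {set T}}) : bool :=
  [forall e in E, #|e| == 2%N].

Definition degree (T : finType) (E : {set {set T}}) (v : T) : nat :=
  #|[set e in E | v \in e]%SET|.

(* The default value #|T| is harmless when T is nonempty: in a simple graph
   every degree is smaller than #|T|. *)
Definition min_degree (T : finType) (E : {set {set T}}) : nat :=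
  \big[minn/#|T|]_(v : T) degree E v.

Definition max_degree (T : finType) (E : {set {set T}}) : nat :=
  \max_(v : T) degree E v.

(* Simple arcs in the plane, parametrized by [0, 1]; the values of g outside
   of [0, 1] are irrelevant. *)
Definition plane_arc (R : realType) (g : R -> R * R) : Prop :=
  {within `[0, 1], continuous g} /\ {in `[0, 1] &, injective g}.

(* Drawings in the plane without crossings: the vertex v is the point pos v and
   the edge e is the arc g e. *)
Definition plane_drawing (R : realType) (T : finType) (E : {set {set T}})
    (pos : T -> R * R) (g : {set T} -> R -> R * R) : Prop :=
  [/\ injective pos,
      forall e, e \in E -> plane_arc (g e),
      forall e, e \in E -> exists u v : T,
        [/\ e = [set u; v]%SET, g e 0 = pos u & g e 1 = pos v],
      forall e (w : T) (t : R), e \in E -> t \in `]0, 1[ -> g e t <> pos w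
    & forall e e' (s t : R), e \in E -> e' \in E -> e != e' ->
        s \in `]0, 1[ -> t \in `]0, 1[ -> g e s <> g e' t].

Definition planar (R : realType) (T : finType) (E : {set {set T}}) : Prop :=
  exists (pos : T -> R * R) (g : {set T} -> R -> R * R), plane_drawing E pos g.

(* The labels are 0, ..., n - 1 instead of 1, ..., n. The bounds are integers,
   so that a negative upper bound makes the set empty. *)
Definition planar_graphs (R : realType) (n : nat) (d1 d2 D1 D2 : int) :
    {set {set {set 'I_n}}} :=
  [set E : {set {set 'I_n}} |
    [&& simple_graph E, `[< planar R E >],
        d1 <= (min_degree E)%:Z <= d2 & D1 <= (max_degree E)%:Z <= D2]]%SET.

(* Main.v *)
(* Upper bound. Projecting a drawing along vertical rays yields a combinatorial
   system of parities in which any two disjoint edges cross evenly; such systems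
   pass to minors and do not exist for K5. By Mader's theorem the graphs carrying
   one have linearly many edges in every minor, and the double counting of Norin,
   Seymour, Thomas and Wollan then bounds their number by C^n n!.

   Existence of the limit. Two connected planar graphs with degrees in [d1, D2]
   are glued by subdividing an edge of each and attaching the two new vertices to
   a fixed linking graph, chosen according to d1 so that the degree bounds are
   kept and some vertex has degree at most 5: an edge if d1 <= 2, a single vertex if
   d1 is 3 or 4, and an icosahedron with a subdivided edge if d1 = 5. Up to a
   polynomial factor this makes the normalized numbers of connected graphs
   supermultiplicative; splitting evenly at each step keeps the total loss under
   control, so they have an exponential growth rate. Arbitrary graphs have the
   same rate, by the decomposition into the component of a vertex and the rest. *)

(* The class counted asks for a minimum degree at most 5. The upper count forgets this condition,
   and in the lower count the linking graph supplies a vertex of degree at most 5, so both have the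
   same rate. Subdividing makes gluing planar and degree-preserving: the old ends keep their
   degrees, and a vertex in the middle of an edge can be moved to the boundary of a half-plane,
   where two drawings meet in that vertex only. The excluded pairs (3, 3) and (5, 5) are those for
   which the linking graph would break the upper bound: a vertex of degree 4 arises when d1 is 3 or
   4, one of degree 6 when d1 = 5. As D2 moves with n, the rate is taken over all degrees that are
   ever allowed. A rate below the limit is witnessed at a single size, where only finitely many
   degrees occur; by monotonicity these are legal from some n on, and gluing spreads the witness to
   every large n. Reaching every residue needs two base graphs whose sizes, increased by that of the
   linking graph, are coprime. *)
Require Import Defs.
From HB Require Import structures.
From mathcomp Require Import all_boot all_order all_algebra.
From mathcomp Require Import boolp zify.

Set Implicit Arguments.
Unset Strict Implicit.
Unset Printing Implicit Defensive.

(** * Minors of graphs without dense minors *)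

Section Minors.
Variable T : finType.
Implicit Types (A B H I Q : {set T}) (u v w x y z : T).

(** Minors stay on the same type [T], the vertex set being carried separately. Under [graph_on] the
    neighbourhoods outside of it are empty, so that equal graphs are equal functions and can be
    counted. *)
Definition nbhds := {ffun T -> {set T}}.
Implicit Type G : nbhds.

Definition graph_on A G : Prop :=
  [/\ forall x y, (x \in G y) = (y \in G x), forall x, x \notin G x
    & forall x y, y \in G x -> x \in A].

(** The edge uv is contracted into [v], and [u] is left without neighbours. *)
Definition contract u v G : nbhds :=
  [ffun x => [set y | [&& x != u, y != u, x != y &
     [|| y \in G x, (x == v) && (y \in G u) | (y == v) && (x \in G u)]]]].

Definition restrict A G : nbhds :=
  [ffun x => if x \in A then G x :&: A else set0].

Definition complete_graph A : nbhds :=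
  [ffun x => if x \in A then A :\ x else set0].

Definition cone v A G : nbhds :=
  [ffun x => if x == v then A else if x \in A then v |: G x else set0].

Definition minor_closed (cls : {set T} -> nbhds -> Prop) : Prop :=
  [/\ forall A G, cls A G -> graph_on A G,
      forall A B G G', cls A G -> graph_on B G' -> B \subset A ->
        (forall x, G' x \subset G x) -> cls B G'
    & forall A G u v, cls A G -> v \in G u -> cls (A :\ u) (contract u v G)].

Lemma graph_on_mem A G x y : graph_on A G -> y \in G x -> (x \in A) && (y \in A).
Proof. by case=> s _ h yx; rewrite (h _ _ yx) (h y x) // s. Qed.

Lemma graph_on_sub A G x : graph_on A G -> G x \subset A.
Proof. by move=> g; apply/subsetP => y /(graph_on_mem g)/andP[]. Qed.

Lemma graph_on_neq A G x y : graph_on A G -> y \in G x -> x != y.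
Proof. by case=> _ irr _ yx; apply: contraL yx => /eqP->. Qed.

Lemma graph_on_restrict A B G : graph_on A G -> graph_on B (restrict B G).
Proof.
case=> s irr h; split=> [x y|x|x y]; rewrite !ffunE.
- case: ifP => yB; case: ifP => xB; rewrite ?inE ?xB ?yB ?andbT //= ?andbF //.
- by case: ifP => _; rewrite inE // (negPf (irr x)).
- by case: ifP => //; rewrite inE.
Qed.

Lemma restrict_sub B G x : restrict B G x \subset G x.
Proof. by rewrite ffunE; case: ifP; rewrite ?subsetIl ?sub0set. Qed.

Lemma minor_closed_restrict cls A B G : minor_closed cls ->
  cls A G -> B \subset A -> cls B (restrict B G).
Proof.
move=> [g d _] cG BA; apply: (d _ _ _ _ cG) => //.
  exact: graph_on_restrict (g _ _ cG).
exact: restrict_sub.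
Qed.

Lemma graph_on_cone v A G : v \notin A -> graph_on A G ->
  graph_on (v |: A) (cone v A G).
Proof.
move=> vA g; have [s irr h] := g.
split=> [x y|x|x y]; rewrite !ffunE.
- have [->|xv] := eqVneq x v; have [->|yv] := eqVneq y v => //.
  + by case: ifP => _; rewrite !inE ?eqxx.
  + by case: ifP => _; rewrite !inE ?eqxx.
  + case: ifP => yA; case: ifP => xA; rewrite ?inE ?(negPf xv) ?(negPf yv) //=.
    * by apply/negbTE/negP; rewrite s => /h; rewrite xA.
    * by apply/esym/negbTE/negP; rewrite s => /h; rewrite yA.
- have [->//|xv] := eqVneq x v.
  by case: ifP => _; rewrite !inE // negb_or xv irr.
- rewrite !inE; have [//|xv] := eqVneq x v.
  by case: ifP; rewrite // inE.
Qed.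

Lemma graph_on_contract A G u v : graph_on A G -> v \in G u ->
  graph_on (A :\ u) (contract u v G).
Proof.
move=> g vu; have [s irr h] := g; have /andP[_ vA] := graph_on_mem g vu.
split=> [x y|x|x y]; rewrite !ffunE !inE.
- rewrite (eq_sym y x) s !andbA [(y != u) && _]andbC -!andbA; congr [&& _, _, _ & _].
  by rewrite orbA orbAC -orbA.
- by rewrite eqxx !andbF.
- move=> /and4P[-> _ _ /or3P[/h//|/andP[/eqP-> _]//|/andP[_]]].
  by move=> /(graph_on_mem g)/andP[].
Qed.

(** This is the class of possible links of [v]. Contracting an edge of the base inside the cone
    yields a supergraph of the cone over the contracted base, so closure under subgraphs
    concludes. *)
Lemma minor_closed_cone cls v : minor_closed cls ->
  minor_closed (fun B G => [/\ v \notin B, graph_on B G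
                             & cls (v |: B) (cone v B G)]).
Proof.
move=> [g d c]; split=> [A G []//|A B G G' [vA gG cG] gG' BA GG'|A G u w [vA gG cG] wu].
- have vB : v \notin B by apply: contra vA; apply: (subsetP BA).
  split=> //; apply: (d _ _ _ _ cG); first exact: graph_on_cone.
    by rewrite setUS.
  move=> x; rewrite !ffunE; case: ifP => // _; case: ifP => xB; last by rewrite sub0set.
  by rewrite (subsetP BA _ xB) setUS.
- have /andP[uA wA] := graph_on_mem gG wu.
  have gc := graph_on_contract gG wu.
  have vAu : v \notin A :\ u by rewrite !inE negb_and vA orbT.
  split=> //.
  have vu : v != u by apply: contraNneq vA => ->.
  have wu' : w \in cone v A G u by rewrite ffunE eq_sym (negPf vu) uA !inE wu orbT.
  have -> : v |: A :\ u = (v |: A) :\ u.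
    by apply/setP => x; rewrite !inE; have [->|] := eqVneq x v; rewrite ?vu.
  apply: (d _ _ _ _ (c _ _ _ _ cG wu')) => //.
    have -> : (v |: A) :\ u = v |: A :\ u.
      by apply/setP => x; rewrite !inE; have [->|] := eqVneq x v; rewrite ?vu.
    exact: graph_on_cone.
  move=> x; rewrite !ffunE; apply/subsetP => y; rewrite !inE.
  have [->|xv] := eqVneq x v.
    rewrite inE in_set1 vu /= => /andP[-> yA]; rewrite yA /= andbT.
    by apply: contraNneq vA => ->.
  case: ifP => [/andP[xu xA]|_]; last by rewrite inE.
  rewrite xA xu /= (eq_sym u v) (negPf vu) uA !inE => /orP[/eqP->|/and3P[yu xy yo]].
    by rewrite vu xv eqxx.
  rewrite yu xy /=.
  by case/or3P: yo => [->|/andP[-> ->]|/andP[-> ->]]; rewrite ?orbT.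
Qed.

(** Contraction loses the edge uv and merges the two edges to each common neighbour; every lost edge
    counts twice in a degree sum. *)
Lemma sum_contract A G u v : graph_on A G -> v \in G u ->
  (\sum_(x in A) #|G x| =
   \sum_(x in A :\ u) #|contract u v G x| + (#|G u :&: G v| + #|G u :&: G v|) + 2)%N.
Proof.
move=> g vu; have [s irr h] := g.
have /andP[uA vA] := graph_on_mem g vu; have uv := graph_on_neq g vu.
have vAu : v \in A :\ u by rewrite !inE eq_sym uv.
rewrite (big_setD1 u) //= !(big_setD1 v vAu) /=.
have -> : (\sum_(x in A :\ u :\ v) #|G x| =
   \sum_(x in A :\ u :\ v) #|contract u v G x| + #|G u :&: G v|)%N.
  have -> : (#|G u :&: G v| = \sum_(x in A :\ u :\ v) ((u \in G x) && (v \in G x)))%N.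
    rewrite -sum1_card -big_mkcondr /=; apply: eq_bigl => x.
    rewrite !inE (s x u) (s x v); apply/idP/idP => [/andP[ux vx]|/andP[_ //]].
    by rewrite ux vx (graph_on_neq g vx) (graph_on_neq g ux) (h _ _ ux).
  rewrite -big_split; apply: eq_bigr => x; rewrite !inE => /and3P[xv xu xA] /=.
  rewrite (cardsD1 u (G x)) ffunE xu (negPf xv) /=.
  have -> : [set y | [&& y != u, x != y & (y \in G x) || (y == v) && (x \in G u)]]
     = (if u \in G x then [set v] else set0) :|: (G x :\ u).
    apply/setP => y; rewrite !inE (s x u).
    have [->|yu] := eqVneq y u => /=.
      by case: ifP; rewrite inE ?(negPf uv).
    have [->|yv] := eqVneq y v => /=.
      by rewrite xv /= orbC; case: ifP; rewrite !inE ?eqxx.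
    have [<-|xy] := eqVneq x y => /=; first by case: ifP; rewrite !inE ?(negPf xv) ?(negPf (irr _)).
    by rewrite orbF; case: ifP; rewrite !inE ?(negPf yv).
  case: ifP => ux /=; last by rewrite set0U addn0.
  rewrite cardsU1 !inE eq_sym uv /=; case: (v \in G x) => /=; lia.
have -> : contract u v G v = (G v :\ u) :|: (G u :\ v).
  apply/setP => y; rewrite ffunE !inE eqxx /= (eq_sym v u) uv /= (eq_sym v y).
  have [->|yu] := eqVneq y u => /=; first by rewrite (negPf (irr u)) andbF.
  by have [->|yv] := eqVneq y v => //=; rewrite ?(negPf (irr v)) ?orbF.
rewrite cardsU.
have -> : (G v :\ u) :&: (G u :\ v) = G u :&: G v.
  apply/setP => y; rewrite !inE.
  have [->|yu] := eqVneq y u => /=; first by rewrite (negPf (irr u)).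
  have [->|yv] := eqVneq y v => /=; first by rewrite (negPf (irr v)) !andbF.
  exact: andbC.
have := cardsD1 u (G v); have := cardsD1 v (G u); rewrite vu -s vu /=.
have : #|G u :&: G v| <= #|G v :\ u|.
  apply/subset_leq_card/subsetP => y; rewrite !inE => /andP[yu ->]; rewrite andbT.
  by rewrite eq_sym (graph_on_neq g yu).
lia.
Qed.

(** The class is quantified inside the induction on [t] because the step passes to the class of
    links of a vertex. An inner induction on [#|A|] contracts edges that lie in few triangles. *)
Lemma mader t : forall cls A G, minor_closed cls -> cls A G -> A != set0 ->
  2 ^ t.+1 * #|A| <= \sum_(x in A) #|G x| ->
  exists B, #|B| = t.+2 /\ cls B (complete_graph B).
Proof.
elim: t => [|t IHt] cls A G mc cG A0 le.
  have [cg cd _] := mc; have g := cg _ _ cG.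
  have : 0 < \sum_(x in A) #|G x|.
    by apply: leq_trans le; rewrite muln_gt0 /= card_gt0.
  rewrite lt0n sum_nat_eq0 negb_forall => /existsP[x]; rewrite negb_imply => /andP[xA].
  rewrite cards_eq0 => /set0Pn[y yx]; exists [set x; y].
  have xy := graph_on_neq g yx; have /andP[_ yA] := graph_on_mem g yx.
  split; first by rewrite cards2 xy.
  apply: (cd _ _ _ _ cG).
  - split=> [a b|a|a b]; rewrite !ffunE !inE.
    + case: ifP => ha; case: ifP => hb; rewrite !inE ?ha ?hb ?andbT ?andbF //=.
      by rewrite eq_sym.
    + by case: ifP; rewrite !inE ?eqxx.
    + by case: ifP => //; rewrite inE.
  - by apply/subsetP => a; rewrite !inE => /orP[/eqP->|/eqP->].
  - have [s _ _] := g.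
    move=> a; apply/subsetP => b; rewrite ffunE !inE.
    case: ifP => [|_]; last by rewrite inE.
    move=> /orP[/eqP->|/eqP->]; rewrite !inE => /andP[/negPf ne].
      by rewrite ne => /eqP->.
    by rewrite ne orbF => /eqP->; rewrite s.
have [n le_n] := ubnP #|A|; elim: n => // n IHn in A G cG A0 le le_n *.
have [cg cd cc] := mc; have g := cg _ _ cG; have [s irr h] := g.
case: (boolP [exists u in A, exists v in G u, #|G u :&: G v| < 2 ^ t.+1]).
  (* With at most 2 ^ t.+1 - 1 common neighbours the degree sum drops by at most 2 ^ t.+2, which is
     the share of the vertex that disappears. *)
  move=> /existsP[u /andP[uA /existsP[v /andP[vu lt]]]].
  have /andP[_ vA] := graph_on_mem g vu; have uv := graph_on_neq g vu.
  have cA := cardsD1 u A; rewrite uA /= in cA.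
  apply: (IHn (A :\ u) (contract u v G)); first exact: cc.
  - by apply/set0Pn; exists v; rewrite !inE eq_sym uv.
  - have := sum_contract g vu; rewrite cA expnS in le *; nia.
  - by rewrite cA in le_n.
rewrite negb_exists => /forallP noe.
have {}noe u v : v \in G u -> 2 ^ t.+1 <= #|G u :&: G v|.
  move=> vu; have := noe u; rewrite (h _ _ vu) /= negb_exists => /forallP/(_ v).
  by rewrite vu /= -leqNgt.
have : 0 < \sum_(x in A) #|G x|.
  by apply: leq_trans le; rewrite muln_gt0 expn_gt0 /= card_gt0.
rewrite lt0n sum_nat_eq0 negb_forall => /existsP[v]; rewrite negb_imply => /andP[vA].
rewrite cards_eq0 => Gv0.
have gr := graph_on_restrict (G v) g.
have sG : G v \subset A := graph_on_sub v g.
have mcv := minor_closed_cone v mc.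
have cone_sub x : cone v (G v) (restrict (G v) G) x \subset G x.
  rewrite !ffunE; case: eqP => [->//|_]; case: ifP => xv; last by rewrite sub0set.
  by rewrite xv subUset subsetIl sub1set s xv.
have vGv : v |: G v \subset A by rewrite subUset sub1set vA.
(* Now every edge lies in at least 2 ^ t.+1 triangles, so the graph induced on [G v] has that
   minimum degree; [v] enlarges the complete minor found there. *)
have [||B [cB [vB _ kB]]] := IHt _ (G v) (restrict (G v) G) mcv _ Gv0.
- split=> //; apply: (cd _ _ _ _ cG) => //; exact: graph_on_cone.
- rewrite mulnC -sum_nat_const; apply: leq_sum => x xv.
  by rewrite ffunE xv setIC noe // s.
exists (v |: B); split; first by rewrite cardsU1 vB cB.
suff -> : complete_graph (v |: B) = cone v B (complete_graph B) by [].
apply/ffunP => x; rewrite !ffunE; apply/setP => y.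
have [->|xv] := eqVneq x v.
  by rewrite !inE eqxx /= !inE; have [->|] := eqVneq y v; rewrite ?(negPf vB).
rewrite !inE (negPf xv) /=; case: ifP; rewrite !inE // => xB.
by have [->|] := eqVneq y v; rewrite // eq_sym xv.
Qed.

(** * Counting the graphs of a sparse minor-closed class *)

Definition clique G Q : bool :=
  [forall x in Q, forall y in Q, (x != y) ==> (y \in G x)].

Section SparseClass.
Variables (cls : {set T} -> nbhds -> Prop) (c : nat).
Hypothesis cls_minor : minor_closed cls.
Hypothesis cls_sparse : forall A G, cls A G -> \sum_(x in A) #|G x| <= c * #|A|.

Lemma cls_graph A G : cls A G -> graph_on A G.
Proof. by case: cls_minor => h _ _ /h. Qed.

(** Sparsity gives a vertex of degree at most [c]. The cliques through it correspond to subsets of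
    its neighbourhood, at most 2 ^ c of them; the others survive its deletion. *)
Lemma card_cliques A G : cls A G ->
  #|[set Q : {set T} | [&& Q != set0, Q \subset A & clique G Q]]| <= 2 ^ c * #|A|.
Proof.
have [n] := ubnP #|A|; elim: n => // n IHn in A G * => le_n cG.
have [A0|A0] := eqVneq A set0.
  rewrite A0 cards0 muln0 leqn0 cards_eq0; apply/eqP/setP => Q.
  by rewrite !inE subset0; case: eqP.
have [v vA vc] : exists2 v, v \in A & #|G v| <= c.
  apply/exists_inP; apply: contraT; rewrite negb_exists_in => /forall_inP h.
  have := cls_sparse cG; rewrite leqNgt => /negP[].
  have : \sum_(i in A) (c + 1) <= \sum_(x in A) #|G x|.
    by apply: leq_sum => i iA; have := h i iA; rewrite -ltnNge addn1.
  rewrite !sum_nat_const; have : 0 < #|A| by rewrite card_gt0. lia.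
have cA := cardsD1 v A; rewrite vA /= in cA.
have cG' := minor_closed_restrict cls_minor cG (subD1set A v).
have := IHn _ _ _ cG'; rewrite -ltnS -[X in X < _]add1n -cA => /(_ le_n) IH.
set S := [set Q | _]; rewrite -(cardsID [set Q : {set T} | v \in Q] S).
have -> : (2 ^ c * #|A| = 2 ^ c + 2 ^ c * #|A :\ v|)%N by rewrite cA mulnDr muln1.
apply: leq_add.
  have inj : {in S :&: [set Q : {set T} | v \in Q] &, injective (fun Q => Q :\ v)}.
    move=> P Q; rewrite !inE => /andP[_ vP] /andP[_ vQ] PQ.
    by rewrite -(setD1K vP) PQ setD1K.
  rewrite -(card_in_imset inj); apply: leq_trans (leq_pexp2l _ vc) => //.
  rewrite -card_powerset; apply/subset_leq_card/subsetP => Q' /imsetP[Q].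
  rewrite !inE => /andP[/and3P[_ _ /forall_inP cl] vQ] ->.
  apply/subsetP => x; rewrite !inE => /andP[xv xQ].
  by have /forall_inP/(_ x xQ) := cl v vQ; rewrite eq_sym xv.
apply: leq_trans IH; apply/subset_leq_card/subsetP => Q; rewrite !inE.
move=> /andP[vQ /and3P[-> QA /forall_inP cl]] /=.
have QAv : Q \subset A :\ v by rewrite subsetD1 QA.
rewrite QAv; apply/forall_inP => x xQ; apply/forall_inP => y yQ; apply/implyP => xy.
rewrite ffunE (subsetP QAv _ xQ) !inE.
have /forall_inP/(_ y yQ) := cl x xQ; rewrite xy /= => ->.
by have := subsetP QAv _ yQ; rewrite !inE.
Qed.

(** The left side is a potential. If the neighbourhood of some [u] in [I] misses an edge yz,
    contracting [u] into [y] loses at most one neighbourhood and creates the edge yz inside [H], so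
    the potential does not drop. Once all neighbourhoods are cliques, [card_cliques] bounds them. *)
Lemma card_nbhds H I G : cls (H :|: I) G -> [disjoint H & I] ->
  (forall u, u \in I -> G u \subset H) ->
  #|(G @: I) :\ set0| + \sum_(x in H) #|G x :&: H| <= (2 ^ c + c) * #|H|.
Proof.
have [n] := ubnP #|I|; elim: n => // n IHn in I G * => le_n cG dHI GH.
have g := cls_graph cG; have [s irr h] := g.
have sumH G' I' : cls (H :|: I') G' -> \sum_(x in H) #|G' x :&: H| <= c * #|H|.
  move=> cG'; have := cls_sparse (minor_closed_restrict cls_minor cG' (subsetUl H I')).
  by apply: leq_trans; apply: eq_leq; apply: eq_bigr => x xH; rewrite ffunE xH.
case: (boolP [forall u in I, clique G (G u)]) => [/forall_inP allc|].
  rewrite mulnDl; apply: leq_add; last exact: sumH cG.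
  have cGH := minor_closed_restrict cls_minor cG (subsetUl H I).
  apply: leq_trans (card_cliques cGH); apply/subset_leq_card/subsetP => Q.
  rewrite !inE => /andP[-> /imsetP[u uI ->]] /=; rewrite GH //=.
  have /forall_inP cl := allc u uI.
  apply/forall_inP => x xu; apply/forall_inP => y yu; apply/implyP => xy.
  have /forall_inP/(_ y yu) := cl x xu; rewrite xy /= => yx.
  by rewrite ffunE (subsetP (GH u uI) x xu) inE yx (subsetP (GH u uI)).
rewrite negb_forall_in => /exists_inP[u uI].
rewrite negb_forall_in => /exists_inP[y yu].
rewrite negb_forall_in => /exists_inP[z zu].
rewrite negb_imply => /andP[yz zy].
have yH := subsetP (GH u uI) _ yu; have zH := subsetP (GH u uI) _ zu.
have HI x : x \in H -> x \notin I by move=> xH; rewrite (disjointFr dHI xH).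
have uH : u \notin H by apply/negP => /HI; rewrite uI.
have eqA : (H :|: I) :\ u = H :|: (I :\ u).
  by apply/setP => x; rewrite !inE; have [->|] := eqVneq x u; rewrite ?(negPf uH).
have cG' : cls (H :|: (I :\ u)) (contract u y G).
  by rewrite -eqA; case: cls_minor => _ _; apply.
have GI x : x \in I -> x != u -> contract u y G x = G x.
  move=> xI xu; apply/setP => w; rewrite ffunE !inE xu /=.
  have xy : (x == y) = false by apply: contraTF xI => /eqP->; apply: HI.
  have xnu : (x \in G u) = false.
    by apply/negP => /(subsetP (GH u uI))/HI; rewrite xI.
  rewrite xy xnu andbF !orbF; case wx: (w \in G x); rewrite ?andbF // andbT.
  rewrite (graph_on_neq g wx) andbT; apply: contraTneq wx => ->.
  by rewrite s xnu.
have cI := cardsD1 u I; rewrite uI /= in cI.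
have eqim : contract u y G @: (I :\ u) = G @: (I :\ u).
  by apply: eq_in_imset => x; rewrite !inE => /andP[xu xI]; rewrite GI.
have le1 : #|G @: I :\ set0| <= #|contract u y G @: (I :\ u) :\ set0| + 1.
  have : G @: I :\ set0 \subset G u |: (G @: (I :\ u) :\ set0).
    apply/subsetP => Q; rewrite !inE => /andP[Q0 /imsetP[x xI Qx]].
    have [xu|xu] := eqVneq x u; first by rewrite Qx xu eqxx.
    by rewrite Q0 Qx imset_f ?orbT // !inE xu.
  move=> /subset_leq_card/leq_trans; apply.
  by rewrite cardsU1 eqim addnC leq_add2l; case: (_ \notin _).
have subG x : x \in H -> G x :&: H \subset contract u y G x :&: H.
  move=> xH; apply/subsetP => w; rewrite ffunE !inE => /andP[wx wH].
  rewrite wx wH /= !andbT (graph_on_neq g wx) andbT.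
  by apply/andP; split; apply: contraNneq uH => <-.
(* The gain of one is seen at [y], whose neighbourhood now contains [z]. *)
have le2 : (\sum_(x in H) #|G x :&: H| + 1 <= \sum_(x in H) #|contract u y G x :&: H|)%N.
  rewrite (bigD1 y yH) [X in _ <= X](bigD1 y yH) /= addnAC; apply: leq_add.
    rewrite addn1; apply: proper_card; rewrite properE subG //=.
    apply/subsetPn; exists z; rewrite !inE zH ?andbT // !ffunE !inE eqxx /= zu yz.
    by rewrite (eq_sym y u) (graph_on_neq g yu) orbT andbT eq_sym (graph_on_neq g zu).
  by apply: leq_sum => x /andP[xH _]; apply/subset_leq_card/subG.
have := IHn (I :\ u) (contract u y G).
rewrite cI ltnS in le_n.
have dHu : [disjoint H & I :\ u] by rewrite (disjointWr _ dHI) // subD1set.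
have GHu x : x \in I :\ u -> contract u y G x \subset H.
  by rewrite !inE => /andP[xu xI]; rewrite GI // GH.
by move=> /(_ le_n cG' dHu GHu); move: le1 le2 cI; clear; lia.
Qed.


Definition nbhds_bound := 2 ^ c + c.
(** The threshold is such that, by sparsity, the vertices of larger degree, taken [nbhds_bound + 1]
    times, make up at most half of all vertices. *)
Definition low_degree := 2 * (nbhds_bound + 1) * c.

(** Three situations in which [u] can be removed with bounded loss of information: [u] is isolated
    (encoded by u = v), uv is an edge with ends of low degree, or [u] and [v] are twins. *)
Definition reducible G u v : bool :=
  [|| (u == v) && (G u == set0),
      [&& v \in G u, #|G u| <= low_degree & #|G v| <= low_degree]
    | (u != v) && (G u == G v)].

(** Let [H] be the vertices of high degree. A vertex of low degree that is not reducible has all its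
    neighbours in [H], at least one of them, and no twin; so [card_nbhds] bounds the number of such
    vertices by [nbhds_bound * #|H|], and [H] is small. *)
Lemma card_reducible A G : cls A G ->
  #|A| <= 2 * #|[set u in A | [exists v in A, reducible G u v]]|.
Proof.
move=> cG; have g := cls_graph cG; have [s irr h] := g.
set S := [set u in A | _]; set H := [set x in A | low_degree < #|G x|].
have HA : H \subset A by apply/subsetP => x; rewrite inE => /andP[].
have leH : low_degree.+1 * #|H| <= c * #|A|.
  apply: leq_trans (cls_sparse cG).
  rewrite mulnC -sum_nat_const [X in _ <= X](big_setID H) /= (setIidPr HA).
  apply: leq_trans (leq_addr _ _); apply: leq_sum => x.
  by rewrite inE => /andP[].
set I := A :\: S :\: H.
have lowI u : u \in I -> [/\ u \in A, #|G u| <= low_degree & forall v, v \in A -> ~~ reducible G u v].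
  rewrite !inE => /and3P[uH uS uA]; split=> //.
    by move: uH; rewrite uA /= -leqNgt.
  move: uS; rewrite uA /= negb_exists => /forallP uS v vA.
  by have := uS v; rewrite vA.
have GIH u : u \in I -> G u \subset H.
  move=> /lowI[uA ul nr]; apply/subsetP => v vu.
  have /andP[_ vA] := graph_on_mem g vu; rewrite inE vA /= ltnNge.
  by apply: contra (nr v vA) => vl; rewrite /reducible vu ul vl orbT.
have HIA : H :|: I \subset A.
  by rewrite subUset HA /I; apply: subset_trans (subsetDl _ _) (subsetDl _ _).
have resI u : u \in I -> restrict (H :|: I) G u = G u.
  move=> uI; rewrite ffunE inE uI orbT; apply/setIidPl.
  exact: subset_trans (GIH u uI) (subsetUl _ _).
have dHI : [disjoint H & I] by rewrite disjoint_sym /I disjoints_subset setDE subsetIr.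
have := card_nbhds (minor_closed_restrict cls_minor cG HIA) dHI.
rewrite (eq_in_imset resI) => /(_ _)/wrap[|le].
  by move=> u uI; rewrite resI ?GIH.
have injI : {in I &, injective G}.
  move=> u v /lowI[uA _ nr] /lowI[vA _ _] uv; apply/eqP/negP => /negP ne.
  by have := nr v vA; rewrite /reducible uv eqxx ne !orbT.
have cI : #|G @: I :\ set0| = #|I|.
  rewrite -(card_in_imset injI); congr #|pred_of_set _|.
  apply/setP => Q; rewrite !inE andb_idl // => /imsetP[u /lowI[uA _ nr] ->].
  by apply: contra (nr u uA) => /eqP u0; rewrite /reducible eqxx u0 eqxx.
have leR : #|A| <= #|S| + (#|H| + #|I|).
  have : A \subset S :|: (H :|: I).
    by apply/subsetP => x xA; rewrite 2!in_setU 2!in_setD xA andbT; case: (x \in S); case: (x \in H).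
  move=> /subset_leq_card/leq_trans; apply.
  rewrite cardsU; apply: leq_trans (leq_subr _ _) _; rewrite leq_add2l.
  by rewrite cardsU leq_subr.
rewrite cI in le.
have {}le : #|I| <= nbhds_bound * #|H| by apply: leq_trans le; rewrite leq_addr.
have : 2 * (nbhds_bound + 1) * #|H| <= #|A|.
  have [c0|c0] := posnP c.
    have : low_degree = 0 by rewrite /low_degree c0 muln0.
    by move=> l0; move: leH; rewrite l0 c0 mul1n leqn0 => /eqP->; rewrite muln0.
  rewrite -(leq_pmul2l c0); apply: leq_trans leH.
  by rewrite mulnA leq_mul2r /low_degree mulnC leqnSn orbT.
rewrite -mulnA; nia.
Qed.

Variable clsb : {set T} -> pred nbhds.
Hypothesis clsP : forall A G, reflect (cls A G) (clsb A G).

(** One graph each for an isolated vertex and for a twin, and a pair of subsets of a set of size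
    [2 * low_degree + 2] for a contracted edge. *)
Definition fiber_bound := 2 + (2 ^ (2 * low_degree + 2)) ^ 2.

Lemma card_reducible_fiber A u v : u \in A -> v \in A ->
  #|[set G | clsb A G && reducible G u v]|
    <= fiber_bound * #|[set G | clsb (A :\ u) G]|.
Proof.
move=> uA vA; set q := [set G | clsb (A :\ u) G].
set S1 := [set G | clsb A G && ((u == v) && (G u == set0))].
set S2 := [set G : nbhds | clsb A G && [&& v \in G u, #|G u| <= low_degree & #|G v| <= low_degree]].
set S3 := [set G : nbhds | clsb A G && ((u != v) && (G u == G v))].
have : [set G | clsb A G && reducible G u v] \subset (S1 :|: S3) :|: S2.
  apply/subsetP => G; rewrite /reducible !inE.
  by case: (clsb A G) => //=; do 3!case: (X in X || _) => //=; rewrite ?orbT.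
move=> /subset_leq_card/leq_trans; apply.
rewrite cardsU; apply: leq_trans (leq_subr _ _) _; rewrite mulnDl; apply: leq_add.
  rewrite cardsU; apply: leq_trans (leq_subr _ _) _; rewrite mul2n -addnn.
  apply: leq_add.
    apply/subset_leq_card/subsetP => G; rewrite !inE => /andP[/clsP cG /andP[_ /eqP u0]].
    apply/clsP; have := minor_closed_restrict cls_minor cG (subD1set A u).
    suff -> : restrict (A :\ u) G = G by [].
    have g := cls_graph cG; have [s irr h] := g.
    apply/ffunP => x; rewrite ffunE; apply/setP => y; rewrite !inE.
    have [->|xu] := eqVneq x u; first by rewrite u0 !inE.
    have [xA|xA] := boolP (x \in A); rewrite !inE.
      case yx : (y \in G x) => //=; have /andP[_ ->] := graph_on_mem g yx.
      by rewrite andbT; apply: contraTneq yx => ->; rewrite s u0 inE.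
    by apply/esym/negP => /h; rewrite (negPf xA).
  have inj : {in S3 &, injective (restrict (A :\ u))}.
    move=> G G'; rewrite !inE => /and3P[/clsP cG uv /eqP Guv] /and3P[/clsP cG' _ /eqP Guv'] eq.
    have g := cls_graph cG; have [s irr h] := g.
    have g' := cls_graph cG'; have [s' irr' h'] := g'.
    have vAu : v \in A :\ u by rewrite !inE eq_sym uv.
    have resv G0 : cls A G0 -> G0 u = G0 v -> restrict (A :\ u) G0 v = G0 v.
      move=> cG0 e; have g0 := cls_graph cG0; have [_ irr0 _] := g0.
      rewrite ffunE vAu; apply/setIidPl/subsetP => y yv; rewrite !inE.
      have /andP[_ ->] := graph_on_mem g0 yv; rewrite andbT.
      by apply: contraTneq yv => ->; rewrite -e.
    have eqv : G v = G' v by rewrite -(resv _ cG Guv) eq resv.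
    have equ : G u = G' u by rewrite Guv Guv'.
    apply/ffunP => x; have [->//|xu] := eqVneq x u.
    apply/setP => y; have [->|yu] := eqVneq y u; first by rewrite s s' equ.
    have [xA|xA] := boolP (x \in A); last first.
      by rewrite (contraNF (h _ _) xA) (contraNF (h' _ _) xA).
    have [yA|yA] := boolP (y \in A); last first.
      by rewrite s s' (contraNF (h _ _) yA) (contraNF (h' _ _) yA).
    by move/ffunP/(_ x)/setP/(_ y): eq; rewrite !ffunE !inE xu xA !inE yu yA !andbT.
  rewrite -(card_in_imset inj); apply/subset_leq_card/subsetP => G'' /imsetP[G].
  rewrite !inE => /andP[/clsP cG _] ->; apply/clsP.
  exact: minor_closed_restrict cls_minor cG (subD1set A u).
(* Evaluated at the contracted graph, [X] contains both old neighbourhoods, so these are two subsets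
   of a small set; together with the contracted graph they determine [G]. *)
pose X (G : nbhds) := G v :|: [set u; v].
pose tgt := [set p : nbhds * ({set T} * {set T}) | [&& p.1 \in q, #|X p.1| <= 2 * low_degree + 2,
   p.2.1 \subset X p.1 & p.2.2 \subset X p.1]].
pose f (G : nbhds) := (contract u v G, (G u, G v)).
have inj : {in S2 &, injective f}.
  move=> G G'; rewrite !inE => /andP[/clsP cG /andP[vu _]] /andP[/clsP cG' /andP[vu' _]] [eq equ eqv].
  have g := cls_graph cG; have [s irr h] := g.
  have g' := cls_graph cG'; have [s' irr' h'] := g'.
  apply/ffunP => x; have [->//|xu] := eqVneq x u; have [->//|xv] := eqVneq x v.
  apply/setP => y; have [->|yu] := eqVneq y u; first by rewrite s s' equ.
  have [->|yv] := eqVneq y v; first by rewrite s s' eqv.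
  have [->|xy] := eqVneq y x; first by rewrite (negPf (irr _)) (negPf (irr' _)).
  move/ffunP/(_ x)/setP/(_ y): eq.
  by rewrite !ffunE !inE xu yu (eq_sym x y) xy (negPf xv) (negPf yv) /= !orbF.
have : f @: S2 \subset tgt.
  apply/subsetP => p /imsetP[G]; rewrite !inE => /andP[/clsP cG /and3P[vu lu lv]] -> /=.
  have g := cls_graph cG; have [s irr h] := g.
  have uv := graph_on_neq g vu.
  apply/and4P; split.
  - by apply/clsP; case: cls_minor => _ _; apply.
  - rewrite /X; apply: leq_trans (_ : #|G u :|: G v :|: [set u; v]| <= _).
      apply/subset_leq_card/setSU/subsetP => y; rewrite ffunE !inE.
      move=> /and4P[_ _ vy /or3P[->|/andP[_ ->]|/andP[/eqP yv _]]]; rewrite ?orbT //.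
      by rewrite yv eqxx in vy.
    rewrite cardsU; apply: leq_trans (leq_subr _ _) _; apply: leq_add.
      by rewrite cardsU; apply: leq_trans (leq_subr _ _) _; rewrite mul2n -addnn leq_add.
    by rewrite cards2; case: (_ != _).
  - apply/subsetP => y yu; rewrite !inE; have [->|yv] := eqVneq y v; rewrite ?orbT //.
    rewrite !ffunE !inE eqxx yu /= (eq_sym v u) uv (eq_sym v y) yv /=.
    by rewrite (eq_sym y u) (graph_on_neq g yu) orbT.
  - apply/subsetP => y yv; rewrite !inE; have [->|yu] := eqVneq y u; rewrite ?orbT //=.
    by rewrite !ffunE !inE eqxx yv /= (eq_sym v u) uv (graph_on_neq g yv) yu.
move=> /subset_leq_card; rewrite (card_in_imset inj) => /leq_trans; apply.
rewrite -sum1_card (partition_big fst (mem q)) /=; last first.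
  by move=> p; rewrite inE => /andP[].
rewrite mulnC -sum_nat_const; apply: leq_sum => G Gq.
rewrite sum1_card.
have [big|small] := boolP (#|X G| <= 2 * low_degree + 2); last first.
  rewrite eq_card0 // => p; rewrite unfold_in /= inE.
  by case: eqP => [->|_]; rewrite ?andbF // (negPf small) !andbF.
have inj2 : {in [set p in tgt | p.1 == G] &, injective snd}.
  by move=> [a b] [a' b'] /=; rewrite !inE /= => /andP[_ /eqP->] /andP[_ /eqP->] ->.
have -> : #|[pred p in tgt | p.1 == G]| = #|[set p in tgt | p.1 == G]|.
  by apply: eq_card => p; rewrite !inE.
rewrite -(card_in_imset inj2).
apply: leq_trans (_ : #|setX (powerset (X G)) (powerset (X G))| <= _).
  apply/subset_leq_card/subsetP => b /imsetP[p]; rewrite inE => /andP[].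
  by rewrite inE => /and4P[_ _ h1 h2] /eqP pG ->; rewrite inE !powersetE -pG h1 h2.
by rewrite cardsX card_powerset mulnn leq_exp2r // leq_exp2l.
Qed.

(** Double counting of the triples (G, u, v) with [reducible G u v]: a graph lies in at least
    [#|A| / 2] of them, and a pair (u, v) in at most [fiber_bound] times the bound for one vertex
    less. *)
Lemma card_sparse_class A : #|[set G | clsb A G]| <= (2 * fiber_bound) ^ #|A| * #|A|`!.
Proof.
have [n] := ubnP #|A|; elim: n => // n IHn in A * => le_n.
have [A0|A0] := eqVneq A set0.
  rewrite A0 cards0 expn0 mul1n fact0 -(cards1 ([ffun=> set0] : nbhds)).
  apply/subset_leq_card/subsetP => G; rewrite !inE => /clsP/cls_graph[s _ h].
  apply/eqP/ffunP => x; rewrite ffunE; apply/setP => y; rewrite inE.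
  by apply/negP => /h; rewrite inE.
have a0 : 0 < #|A| by rewrite card_gt0.
set q := [set G | clsb A G]; set M := fiber_bound.
pose B := (2 * M) ^ #|A|.-1 * (#|A|.-1)`!.
have step u v : u \in A -> v \in A -> #|[set G in q | reducible G u v]| <= M * B.
  move=> uA vA; rewrite (_ : finset _ = [set G | clsb A G && reducible G u v]); last first.
    by apply/setP => G; rewrite !inE.
  apply: leq_trans (card_reducible_fiber uA vA) _; rewrite leq_mul2l; apply/orP; right.
  have cA := cardsD1 u A; rewrite uA /= in cA.
  by have := IHn (A :\ u); rewrite /B cA /=; apply; rewrite cA in le_n.
have le1 : #|q| * #|A| <= 2 * \sum_(u in A) \sum_(v in A) #|[set G in q | reducible G u v]|.
  have -> : \sum_(u in A) \sum_(v in A) #|[set G in q | reducible G u v]|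
     = \sum_(G in q) \sum_(u in A) \sum_(v in A) (reducible G u v : nat).
    rewrite [RHS]exchange_big; apply: eq_bigr => u _ /=.
    rewrite exchange_big; apply: eq_bigr => v _ /=.
    rewrite -sum1_card (eq_bigl (fun G => (G \in q) && reducible G u v)); last first.
      by move=> G; rewrite !inE.
    by rewrite big_mkcondr; apply: eq_bigr => G _; case: ifP.
  rewrite -sum_nat_const big_distrr; apply: leq_sum => G; rewrite inE => /clsP cG /=.
  apply: leq_trans (card_reducible cG) _; rewrite leq_mul2l; apply/orP; right.
  rewrite -sum1_card big_mkcond [X in _ <= X]big_mkcond; apply: leq_sum => u _.
  rewrite inE; case: (u \in A) => //=; case: ifP => // /exists_inP[v vA r].
  by rewrite (bigD1 v vA) /= r.
have : #|q| * #|A| <= 2 * (#|A| * (#|A| * (M * B))).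
  apply: leq_trans le1 _; rewrite leq_mul2l -!sum_nat_const; apply: leq_sum => u uA.
  by apply: leq_sum => v vA; apply: step.
have -> : ((2 * M) ^ #|A| * #|A|`! = 2 * (#|A| * (M * B)))%N.
  by rewrite -{1 2}(prednK a0) factS expnS prednK // /B; lia.
move=> le; rewrite -(leq_pmul2r a0); apply: leq_trans le _.
by rewrite (mulnC #|A| (#|A| * _)) mulnA.
Qed.

End SparseClass.
End Minors.

(** * Crossing systems *)

Section CrossingNumbers.
Variable T : finType.

(* [U q x y] stands for the number of times the vertical upward ray from the
   vertex q meets the edge xy, and [t x y] for "x lies to the left of y"; the sum
   below then has the parity of the number of crossings of uv and wz. *)
Definition crossing_system (G : nbhds T) (U : T -> T -> T -> nat) (t : T -> T -> nat) :=
  [/\ forall q x y, U q x y = U q y x, forall x y, x != y -> t x y + t y x = 1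
    & forall u v w z, v \in G u -> z \in G w -> u != w -> u != z -> v != w -> v != z ->
      ~~ odd (U w u v + U z u v + U u w z + U v w z + (t w u + t z u + t w v + t z v))].

Lemma even_ex n : ~~ odd n -> exists k, n = 2 * k.
Proof. by move=> /even_halfK <-; exists n./2; rewrite mul2n. Qed.

Lemma even_trans m n p q : ~~ odd m -> ~~ odd n -> p + 2 * q = m + n -> ~~ odd p.
Proof.
move=> em en e; have := congr1 odd e.
by rewrite mul2n oddD odd_double oddD (negPf em) (negPf en) /= addbF => ->.
Qed.

Definition crossing_free (G : nbhds T) := exists U t, crossing_system G U t.

(** A new edge vy runs along v, u, y, so its ray counts are the sums of those of vu and uy. Adding
    the parity conditions of these two edges makes every term at [u] occur twice. *)
Lemma crossing_free_contract A G u v : graph_on A G -> v \in G u ->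
  crossing_free G -> crossing_free (contract u v G).
Proof.
move=> g vu [U [t [sU st cr]]]; have [s irr h] := g.
have uv := graph_on_neq g vu.
(* An edge vy that was present before the contraction keeps its own ray counts. *)
pose far y := y \notin G v.
pose U' q x y := if (x == v) && far y then U q v u + U q u y
  else if (y == v) && far x then U q v u + U q u x else U q x y.
have farv : far v by rewrite /far irr.
exists U', t; split=> // [q x y|a b c d].
  rewrite /U'; have [->|xv] := eqVneq x v; have [->|yv] := eqVneq y v => //=.
  by case: ifP => // _; rewrite sU.
  by case: ifP => // _; rewrite sU.
have cross x y : y \in contract u v G x -> [/\ x != u, y != u, x != y &
   [\/ y \in G x /\ forall q, U' q x y = U q x y, 
       [/\ x = v, y \in G u & forall q, U' q x y = U q u v + U q u y] |
       [/\ y = v, x \in G u & forall q, U' q x y = U q u v + U q u x]]].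
  rewrite ffunE inE => /and4P[xu yu xy hxy]; split=> //.
  rewrite /U' /far; have [xv|xv] := eqVneq x v.
    have yv : (y == v) = false by rewrite -xv eq_sym (negPf xy).
    rewrite yv xv; case yGv : (y \in G v) => /=; first by constructor 1.
    constructor 2; split=> // [|q]; last by rewrite (sU _ v u).
    by move: hxy; rewrite xv eqxx yGv yv /= orbF.
  have [yv|yv] := eqVneq y v.
    rewrite yv; case xGv : (x \in G v) => /=; first by constructor 1; split=> //; rewrite s.
    constructor 3; split=> // [|q]; last by rewrite (sU _ v u).
    by move: hxy; rewrite yv (negPf xv) eqxx s xGv.
  by constructor 1; split=> //; move: hxy; rewrite (negPf xv) (negPf yv) !orbF.
move=> /cross[au bu ab hab] /cross[cu du cd hcd] ac ad bc bd.
have uv' := vu; rewrite s in uv'.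
have [ua ub uc ud] : [/\ u != a, u != b, u != c & u != d] by rewrite !(eq_sym u).
case: hab => [[ba eab]|[av bu' eab]|[bv au' eab]]; case: hcd => [[dc ecd]|[cv du' ecd]|[dv cu' ecd]];
  rewrite !eab !ecd.
(* In the mixed cases [q] collects the terms at [u] that occur twice. Two disjoint edges cannot both
   pass through [v]. *)
- exact: cr.
- subst c; apply: (even_trans (q := U u a b + t u a + t u b) (cr _ _ _ _ ba vu au ac bu bc) (cr _ _ _ _ ba du' au ad bu bd)); clear; lia.
- subst d; apply: (even_trans (q := U u a b + t u a + t u b) (cr _ _ _ _ ba vu au ad bu bd) (cr _ _ _ _ ba cu' au ac bu bc)); clear; lia.
- subst a; apply: (even_trans (q := U u c d + t c u + t d u) (cr _ _ _ _ vu dc uc ud ac ad) (cr _ _ _ _ bu' dc uc ud bc bd)); clear; lia.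
- by move: ac; rewrite av cv eqxx.
- by move: ad; rewrite av dv eqxx.
- subst b; apply: (even_trans (q := U u c d + t c u + t d u) (cr _ _ _ _ vu dc uc ud bc bd) (cr _ _ _ _ au' dc uc ud ac ad)); clear; lia.
- by move: bc; rewrite bv cv eqxx.
- by move: bd; rewrite bv dv eqxx.
Qed.

Lemma minor_closed_crossing_free :
  minor_closed (fun A (G : nbhds T) => graph_on A G /\ crossing_free G).
Proof.
split=> [A G []//|A B G G' [g [U [t [sU st cr]]]] g' _ sub|A G u v [g cf] vu].
  split=> //; exists U, t; split=> // u v w z vu zw; apply: cr; exact: (subsetP (sub _)).
split; last exact: crossing_free_contract g vu cf.
exact: graph_on_contract g vu.
Qed.

(** Add the conditions for the 15 pairs of disjoint edges. Every [U] term occurs twice, and every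
    pair of vertices is compared six times. Orienting all comparisons alike by [t x y + t y x = 1]
    leaves the constant 15, three for each set of four vertices, up to even terms: a
    contradiction. *)
Lemma crossing_free_K5 (B : {set T}) : #|B| = 5 -> ~ crossing_free (complete_graph B).
Proof.
move=> cB [U [t [sU st cr]]].
move: (enum_uniq (mem B)) (mem_enum (mem B)) cB; rewrite cardE.
case: (enum _) => [|a [|b [|c [|d [|e []]]]]] //=.
move=> uq mB _.
have neq i j : i < j < 5 -> nth a [:: a; b; c; d; e] i != nth a [:: a; b; c; d; e] j.
  by move=> /andP[ij j5]; rewrite nth_uniq // ?ltn_eqF // (ltn_trans ij).
have E i j : i < j < 5 -> nth a [:: a; b; c; d; e] j \in complete_graph B (nth a [:: a; b; c; d; e] i).
  move=> ij; have := neq i j ij; case/andP: ij => ij j5.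
  by rewrite ffunE -!mB !mem_nth ?(ltn_trans ij) // !inE -mB mem_nth // andbT eq_sym.
have [[ab ac] [ad ae]] := ((neq 0 1 isT, neq 0 2 isT), (neq 0 3 isT, neq 0 4 isT)).
have [[bc bd] be] := ((neq 1 2 isT, neq 1 3 isT), neq 1 4 isT).
have [[cd ce] de] := ((neq 2 3 isT, neq 2 4 isT), neq 3 4 isT).
have [[Eab Eac] [Ead Eae]] := ((E 0 1 isT, E 0 2 isT), (E 0 3 isT, E 0 4 isT)).
have [[Ebc Ebd] Ebe] := ((E 1 2 isT, E 1 3 isT), E 1 4 isT).
have [[Ecd Ece] Ede] := ((E 2 3 isT, E 2 4 isT), E 3 4 isT).
rewrite /= in ab ac ad ae bc bd be cd ce de Eab Eac Ead Eae Ebc Ebd Ebe Ecd Ece Ede.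
have [ba ca] : b != a /\ c != a by rewrite !(eq_sym _ a).
have [da ea] : d != a /\ e != a by rewrite !(eq_sym _ a).
have [cb db] : c != b /\ d != b by rewrite !(eq_sym _ b).
have [eb dc] : e != b /\ d != c by rewrite (eq_sym e) (eq_sym d).
have [ec ed] : e != c /\ e != d by rewrite !(eq_sym e).
have [k0 e0] := even_ex (cr _ _ _ _ Eab Ecd ac ad bc bd).
have [k1 e1] := even_ex (cr _ _ _ _ Eac Ebd ab ad cb cd).
have [k2 e2] := even_ex (cr _ _ _ _ Ead Ebc ab ac db dc).
have [k3 e3] := even_ex (cr _ _ _ _ Eab Ece ac ae bc be).
have [k4 e4] := even_ex (cr _ _ _ _ Eac Ebe ab ae cb ce).
have [k5 e5] := even_ex (cr _ _ _ _ Eae Ebc ab ac eb ec).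
have [k6 e6] := even_ex (cr _ _ _ _ Eab Ede ad ae bd be).
have [k7 e7] := even_ex (cr _ _ _ _ Ead Ebe ab ae db de).
have [k8 e8] := even_ex (cr _ _ _ _ Eae Ebd ab ad eb ed).
have [k9 e9] := even_ex (cr _ _ _ _ Eac Ede ad ae cd ce).
have [k10 e10] := even_ex (cr _ _ _ _ Ead Ece ac ae dc de).
have [k11 e11] := even_ex (cr _ _ _ _ Eae Ecd ac ad ec ed).
have [k12 e12] := even_ex (cr _ _ _ _ Ebc Ede bd be cd ce).
have [k13 e13] := even_ex (cr _ _ _ _ Ebd Ece bc be dc de).
have [k14 e14] := even_ex (cr _ _ _ _ Ebe Ecd bc bd ec ed).
move: (st _ _ ab) (st _ _ ac) (st _ _ ad) (st _ _ ae) (st _ _ bc) (st _ _ bd) (st _ _ be)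
  (st _ _ cd) (st _ _ ce) (st _ _ de) e0 e1 e2 e3 e4 e5 e6 e7 e8 e9 e10 e11 e12 e13 e14.
clear; lia.
Qed.

(** The constant 16 is 2 ^ t.+1 for t = 3, the case in which [mader] yields a complete graph on five
    vertices. *)
Lemma crossing_free_sparse A (G : nbhds T) : graph_on A G -> crossing_free G ->
  \sum_(x in A) #|G x| <= 16 * #|A|.
Proof.
move=> g cf; have [A0|A0] := eqVneq A set0; first by rewrite A0 big_set0.
rewrite leqNgt; apply/negP => /ltnW le.
have [B [cB [_]]] := mader (t := 3) minor_closed_crossing_free (conj g cf) A0 le.
exact: crossing_free_K5.
Qed.

End CrossingNumbers.

Lemma card_crossing_free : exists C, forall (T : finType) (A : {set T}) (S : {set nbhds T}),
  (forall G, G \in S -> graph_on A G /\ crossing_free G) -> #|S| <= C ^ #|A| * #|A|`!.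
Proof.
(* The constant is made abstract, so that the tower of exponentials in [fiber_bound] is never
   evaluated. *)
move: (16) (@crossing_free_sparse) => c sparse.
exists (2 * fiber_bound c) => T A S hS.
have mc := @minor_closed_crossing_free T.
have sp (B : {set T}) G : graph_on B G /\ crossing_free G -> \sum_(x in B) #|G x| <= c * #|B|.
  by case; apply: sparse.
pose clsb (B : {set T}) (G : nbhds T) : bool := `[< graph_on B G /\ crossing_free G >].
have clsP B G : reflect (graph_on B G /\ crossing_free G) (clsb B G) by apply: asboolP.
apply: leq_trans (card_sparse_class mc sp clsP A).
by apply/subset_leq_card/subsetP => G /hS hG; rewrite inE; apply/clsP.
Qed.

From mathcomp Require Import all_classical all_reals all_analysis.
From mathcomp Require Import zify ring lra.
Import Order.TTheory GRing.Theory Num.Theory.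
Import numFieldNormedType.Exports.
Local Open Scope classical_set_scope.
Local Open Scope ring_scope.

(** * From drawings to crossing systems *)

Section Rays.
Variable R : realType.
Implicit Types (a b c d p q : R * R) (x y s t : R).

Definition line_height a b x : R := a.2 + (x - a.1) * (b.2 - a.2) / (b.1 - a.1).

(** The abscissa test is half-open: a ray through a vertex of a polygon is counted consistently for
    the two pieces at it, and a vertical segment is never met, which hides the division by zero in
    [line_height]. *)
Definition ray_meets c a b : bool :=
  ((a.1 < c.1) (+) (b.1 < c.1)) && (c.2 < line_height a b c.1).

Lemma line_heightC a b x : a.1 != b.1 -> line_height a b x = line_height b a x.
Proof.
move=> ab; rewrite /line_height.
have h1 : b.1 - a.1 != 0 by rewrite subr_eq0 eq_sym.
have h2 : a.1 - b.1 != 0 by rewrite subr_eq0.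
by field; rewrite h1 h2.
Qed.

Lemma ray_meetsC c a b : ray_meets c a b = ray_meets c b a.
Proof.
rewrite /ray_meets addbC; have [ab|ab] := eqVneq a.1 b.1; last by rewrite line_heightC.
by rewrite ab addbb.
Qed.

Definition segments_disjoint a b c d : Prop := forall s t, 0 <= s <= 1 -> 0 <= t <= 1 ->
  a + s *: (b - a) <> c + t *: (d - c).

Lemma segments_disjointCl a b c d : segments_disjoint a b c d -> segments_disjoint b a c d.
Proof.
move=> h s t s01 t01 e; apply: (h (1 - s) t); [by lra|by []|].
rewrite -e; congr pair => /=; rewrite /GRing.scale /=; ring.
Qed.

Lemma segments_disjointC a b c d : segments_disjoint a b c d -> segments_disjoint c d a b.
Proof. by move=> h s t s01 t01 e; apply: (h t s). Qed.

Lemma line_height_point a b x : a.1 < b.1 -> a.1 <= x <= b.1 ->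
  exists2 s, 0 <= s <= 1 & (x, line_height a b x) = a + s *: (b - a).
Proof.
move=> ab /andP[ax xb]; have ab0 : 0 < b.1 - a.1 by rewrite subr_gt0.
exists ((x - a.1) / (b.1 - a.1)).
  rewrite divr_ge0 ?subr_ge0 ?(ltW ab) //= ler_pdivrMr // mul1r; lra.
congr pair; rewrite /line_height /= /GRing.scale /=; first by rewrite divfK ?gt_eqF //; ring.
by rewrite mulrAC.
Qed.

Lemma line_height_neq a b c d x : a.1 < b.1 -> c.1 < d.1 ->
  segments_disjoint a b c d -> a.1 <= x <= b.1 -> c.1 <= x <= d.1 ->
  line_height a b x != line_height c d x.
Proof.
move=> ab cd dis xab xcd; apply/eqP => e.
have [s s01 es] := line_height_point ab xab.
have [t t01 et] := line_height_point cd xcd.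
by apply: (dis s t) => //; rewrite -es -et e.
Qed.

(** The difference of heights is affine; if its sign changed between [x] and [y], it would vanish at
    some [z] between them, a common point of the segments. *)
Lemma line_height_side a b c d x y : a.1 < b.1 -> c.1 < d.1 ->
  segments_disjoint a b c d -> a.1 <= x <= b.1 -> c.1 <= x <= d.1 ->
  a.1 <= y <= b.1 -> c.1 <= y <= d.1 ->
  line_height c d x < line_height a b x -> line_height c d y < line_height a b y.
Proof.
move=> ab cd dis xab xcd yab ycd ltx; rewrite ltNge le_eqVlt negb_or line_height_neq //=.
apply/negP => lty.
pose D z := line_height a b z - line_height c d z.
have Dx : 0 < D x by rewrite subr_gt0.
have Dy : 0 < - D y by rewrite oppr_gt0 subr_lt0.
have s0 : 0 < D x - D y by rewrite addr_gt0.
pose l := D x / (D x - D y).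
have l0 : 0 <= l by rewrite divr_ge0 ?ltW.
have l1 : l <= 1 by rewrite ler_pdivrMr // mul1r; lra.
have l1' : 0 <= 1 - l by lra.
pose z := (1 - l) * x + l * y.
have hz m n : m <= x <= n -> m <= y <= n -> m <= z <= n.
  move=> /andP[mx xn] /andP[my yn].
  have := mulr_ge0 l1' (_ : 0 <= x - m); have := mulr_ge0 l0 (_ : 0 <= y - m).
  have := mulr_ge0 l1' (_ : 0 <= n - x); have := mulr_ge0 l0 (_ : 0 <= n - y).
  rewrite !subr_ge0 => /(_ yn) h1 /(_ xn) h2 /(_ my) h3 /(_ mx) h4.
  by rewrite /z; apply/andP; split; lra.
have := line_height_neq ab cd dis (hz _ _ xab yab) (hz _ _ xcd ycd).
move=> /negP[]; rewrite -subr_eq0 -/(D z).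
have -> : D z = (1 - l) * D x + l * D y.
  have h1 : b.1 - a.1 != 0 by rewrite subr_eq0 gt_eqF.
  have h2 : d.1 - c.1 != 0 by rewrite subr_eq0 gt_eqF.
  by rewrite /D /z /line_height; field; rewrite h1 h2.
have h3 : D x - D y != 0 by rewrite gt_eqF.
by rewrite /l; apply/eqP; field.
Qed.

Lemma line_height_left a b : line_height a b a.1 = a.2.
Proof. by rewrite /line_height subrr !mul0r addr0. Qed.

Lemma line_height_right a b : a.1 < b.1 -> line_height a b b.1 = b.2.
Proof.
move=> ab; rewrite /line_height mulrAC divff ?mul1r; first by ring.
by rewrite subr_eq0 gt_eqF.
Qed.

(** This is the sum of [crossing_system] for two single segments. *)
Definition parity_sum a b c d : nat := (ray_meets c a b + ray_meets d a b
  + ray_meets a c d + ray_meets b c d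
  + ((c.1 < a.1)%R + (d.1 < a.1)%R + (c.1 < b.1)%R + (d.1 < b.1)%R))%N.

Lemma parity_sumCl a b c d : parity_sum b a c d = parity_sum a b c d.
Proof.
rewrite /parity_sum !(ray_meetsC _ b a); congr (_ + _)%N.
  by rewrite -!addnA; congr (_ + (_ + _))%N; rewrite addnC.
by rewrite -addnA addnC addnA.
Qed.

Lemma parity_sumCr a b c d : parity_sum a b d c = parity_sum a b c d.
Proof.
rewrite /parity_sum !(ray_meetsC _ d c) (addnC (ray_meets d a b)); congr (_ + _)%N.
by rewrite (addnC (d.1 < a.1)%R) -!addnA; congr (_ + (_ + _))%N; rewrite addnC.
Qed.

(** A ray from an end of one segment can meet the other only over an end of the common part of their
    projections to the x-axis. By [line_height_side] the same segment is on top at both ends of that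
    part, which settles each order of the four abscissae. *)
Lemma parity_sum_sorted a b c d : a.1 < b.1 -> c.1 < d.1 ->
  a.1 != c.1 -> a.1 != d.1 -> b.1 != c.1 -> b.1 != d.1 ->
  segments_disjoint a b c d -> ~~ odd (parity_sum a b c d).
Proof.
move=> ab cd ac ad bc bd dis.
have side := line_height_side ab cd dis.
have ne x := line_height_neq (x := x) ab cd dis.
have sidee x y : a.1 <= x <= b.1 -> c.1 <= x <= d.1 -> a.1 <= y <= b.1 -> c.1 <= y <= d.1 ->
   (line_height c d x < line_height a b x) = (line_height c d y < line_height a b y).
  by move=> *; apply/idP/idP; apply: side.
have flip x : a.1 <= x <= b.1 -> c.1 <= x <= d.1 ->
   (line_height a b x < line_height c d x) = ~~ (line_height c d x < line_height a b x).
  by move=> h1 h2; rewrite -leNgt lt_neqAle ne.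
rewrite /parity_sum /ray_meets.
rewrite -{1}(line_height_left c d) -{1}(line_height_right cd).
rewrite -{1}(line_height_left a b) -{1}(line_height_right ab).
case: (ltgtP a.1 c.1) ac => // ac _; case: (ltgtP b.1 c.1) bc => // bc _;
case: (ltgtP a.1 d.1) ad => // ad _; case: (ltgtP b.1 d.1) bd => // bd _ //=; try lra.
all: rewrite ?addn0 ?add0n.
- by rewrite flip ?(sidee b.1 c.1); [case: (_ < _)| lra..].
- by rewrite (sidee d.1 c.1); [case: (_ < _)| lra..].
- by rewrite !flip ?(sidee b.1 a.1); [case: (_ < _)| lra..].
- by rewrite flip ?(sidee d.1 a.1); [case: (_ < _)| lra..].
Qed.

Lemma parity_sumC a b c d :
  a.1 != c.1 -> a.1 != d.1 -> b.1 != c.1 -> b.1 != d.1 ->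
  odd (parity_sum c d a b) = odd (parity_sum a b c d).
Proof.
move=> ac ad bc bd; rewrite /parity_sum.
have flip x y : x != y -> (x < y) = ~~ (y < x) :> bool.
  by move=> xy; rewrite -leNgt lt_neqAle xy.
rewrite (flip _ _ ac) (flip _ _ ad) (flip _ _ bc) (flip _ _ bd) !oddD !oddb.
case: (ray_meets c a b); case: (ray_meets d a b); case: (ray_meets a c d);
case: (ray_meets b c d); case: (c.1 < a.1); case: (d.1 < a.1); case: (c.1 < b.1);
by case: (d.1 < b.1).
Qed.

(** Otherwise the line through [c] and [d] would pass above [a] but not above [b], and cd would cut
    the vertical segment. *)
Lemma ray_meets_vertical a b c d : a.1 = b.1 -> c.1 < d.1 ->
  a.1 != c.1 -> a.1 != d.1 ->
  segments_disjoint a b c d -> ray_meets a c d -> ray_meets b c d.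
Proof.
move=> ab cd ac ad dis; rewrite /ray_meets -ab => /andP[S lth]; rewrite S /=.
rewrite ltNge; apply/negP => hb.
have xcd : c.1 <= a.1 <= d.1.
  by move: S; case: (ltgtP c.1 a.1) => h1; case: (ltgtP d.1 a.1) => h2 //= _; lra.
have [t t01 et] := line_height_point cd xcd.
have ba : 0 < b.2 - a.2 by lra.
apply: (dis ((line_height c d a.1 - a.2) / (b.2 - a.2)) t) => //.
  by rewrite divr_ge0 ?ler_pdivrMr ?mul1r //=; lra.
rewrite -et; congr pair; rewrite /= /GRing.scale /=.
  by rewrite ab subrr mulr0 addr0.
by rewrite divfK ?gt_eqF //; ring.
Qed.

Lemma parity_sum_vertical a b c d : a.1 = b.1 ->
  a.1 != c.1 -> a.1 != d.1 -> b.1 != c.1 -> b.1 != d.1 ->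
  segments_disjoint a b c d -> ~~ odd (parity_sum a b c d).
Proof.
move=> ab; wlog cd : c d / c.1 <= d.1.
  move=> wh ac ad bc bd dis; have [cd|/ltW dc] := leP c.1 d.1; first exact: wh.
  rewrite -parity_sumCr; apply: wh => //.
  exact/segments_disjointC/segments_disjointCl/segments_disjointC.
move=> ac ad bc bd dis.
have -> : parity_sum a b c d = ((ray_meets a c d + ray_meets b c d)
    + ((c.1 < a.1)%R + (d.1 < a.1)%R).*2)%N.
  rewrite /parity_sum {1 2}/ray_meets ab !addbb /= !add0n; congr (_ + _)%N.
  by rewrite -addnn !addnA.
rewrite oddD odd_double addbF oddD !oddb.
move: cd; rewrite le_eqVlt => /orP[/eqP cd|cd].
  by rewrite /ray_meets cd !addbb.
suff -> : ray_meets a c d = ray_meets b c d by rewrite addbb.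
apply/idP/idP; apply: ray_meets_vertical => //.
exact: segments_disjointCl.
Qed.

Lemma parity_sum_even a b c d :
  a.1 != c.1 -> a.1 != d.1 -> b.1 != c.1 -> b.1 != d.1 ->
  segments_disjoint a b c d -> ~~ odd (parity_sum a b c d).
Proof.
wlog ab : a b / a.1 <= b.1.
  move=> wh ac ad bc bd dis; have [ab|/ltW ba] := leP a.1 b.1; first exact: wh.
  by rewrite -parity_sumCl; apply: wh => //; apply: segments_disjointCl.
wlog cd : c d / c.1 <= d.1.
  move=> wh ac ad bc bd dis; have [cd|/ltW dc] := leP c.1 d.1; first exact: wh.
  rewrite -parity_sumCr; apply: wh => //.
  exact/segments_disjointC/segments_disjointCl/segments_disjointC.
move=> ac ad bc bd dis; move: ab; rewrite le_eqVlt => /orP[/eqP|] ab.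
  exact: parity_sum_vertical.
move: cd; rewrite le_eqVlt => /orP[/eqP|] cd; last exact: parity_sum_sorted.
rewrite -parity_sumC //; apply: parity_sum_vertical; rewrite 1?eq_sym //.
exact: segments_disjointC.
Qed.

Lemma odd_telescope (F : nat -> nat) N :
  odd (\sum_(k < N) (F k + F k.+1)) = odd (F 0 + F N).
Proof.
elim: N => [|N IH]; first by rewrite big_ord0 oddD addbb.
by rewrite big_ord_recr /= oddD IH !oddD -addbA addKb.
Qed.

(** The sum of [parity_sum] over all pairs of pieces is even. In it an inner vertex of a polygon
    occurs once for each of its two pieces and cancels modulo 2, which leaves the terms of the end
    points. *)
Lemma polygon_parity_even N (P Q : nat -> R * R) :
  (forall k l, k <= N -> l <= N -> (P k).1 != (Q l).1)%N ->
  (forall k l, k < N -> l < N -> segments_disjoint (P k) (P k.+1) (Q l) (Q l.+1))%N ->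
  ~~ odd (\sum_(k < N) ray_meets (Q 0) (P k) (P k.+1)
        + \sum_(k < N) ray_meets (Q N) (P k) (P k.+1)
        + \sum_(l < N) ray_meets (P 0) (Q l) (Q l.+1)
        + \sum_(l < N) ray_meets (P N) (Q l) (Q l.+1)
        + (((Q 0).1 < (P 0).1)%R + ((Q N).1 < (P 0).1)%R
           + ((Q 0).1 < (P N).1)%R + ((Q N).1 < (P N).1)%R))%N.
Proof.
move=> ne dis.
have ev : ~~ odd (\sum_(k < N) \sum_(l < N) parity_sum (P k) (P k.+1) (Q l) (Q l.+1)).
  elim/big_ind: _ => // [m n em en|k _]; first by rewrite oddD (negPf em) (negPf en).
  elim/big_ind: _ => // [m n em en|l _]; first by rewrite oddD (negPf em) (negPf en).
  have kN := ltn_ord k; have lN := ltn_ord l.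
  by apply: parity_sum_even; rewrite ?ne ?(ltnW kN) ?(ltnW lN) //; apply: dis.
pose f l := (\sum_(k < N) ray_meets (Q l) (P k) (P k.+1))%N.
pose f' k := (\sum_(l < N) ray_meets (P k) (Q l) (Q l.+1))%N.
pose h k := (\sum_(l < N) (((Q l).1 < (P k).1)%R + ((Q l.+1).1 < (P k).1)%R))%N.
have e : (\sum_(k < N) \sum_(l < N) parity_sum (P k) (P k.+1) (Q l) (Q l.+1) =
   \sum_(l < N) (f l + f l.+1) + \sum_(k < N) (f' k + f' k.+1) + \sum_(k < N) (h k + h k.+1))%N.
  have -> : (\sum_(l < N) (f l + f l.+1) = \sum_(k < N) \sum_(l < N)
      (ray_meets (Q l) (P k) (P k.+1) + ray_meets (Q l.+1) (P k) (P k.+1)))%N.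
    by rewrite /f; under eq_bigr do rewrite -big_split /=; exact: exchange_big.
  rewrite -!big_split /=; apply: eq_bigr => k _.
  rewrite /f' /h -!big_split /=; apply: eq_bigr => l _.
  by rewrite /parity_sum -!addnA; do 4!congr (_ + _)%N.
move: ev; rewrite e !oddD !odd_telescope !oddD /h.
have odd_h k : odd (h k) = odd (((Q 0%N).1 < (P k).1)%R + ((Q N).1 < (P k).1)%R).
  by rewrite /h (odd_telescope (fun l => ((Q l).1 < (P k).1)%R : nat)).
rewrite -/(h 0%N) -/(h N) !odd_h !oddD /f /f' !addbA.
by rewrite -!addbA.
Qed.

End Rays.

(** * Compactness estimates for arcs *)

Section Clamp.
Variable R : realType.
Implicit Types (s t : R).

(** Precomposition with [clamp] turns an arc that is continuous only within [0, 1] into a map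
    continuous on the whole line. *)
Definition clamp t : R := Num.max 0 (Num.min 1 t).

Lemma clamp_itv t : clamp t \in `[0, 1].
Proof.
by rewrite in_itv /= /clamp le_max lexx /= ge_max ler01 ge_min lexx.
Qed.

Lemma clamp_id t : t \in `[0, 1] -> clamp t = t.
Proof.
by rewrite in_itv /= => /andP[t0 t1]; rewrite /clamp (min_idPr t1) (max_idPr t0).
Qed.

Lemma continuous_clamp : continuous clamp.
Proof.
move=> t; apply: continuous_max; first exact: cvg_cst.
by apply: continuous_min; [exact: cvg_cst|exact: cvg_id].
Qed.

Lemma continuous_comp_clamp (V : topologicalType) (g : R -> V) :
  {within `[0, 1], continuous g} -> continuous (g \o clamp).
Proof.
move=> /subspace_continuousP cg t.
have h : clamp x @[x --> t] --> within `[0, 1] (nbhs (clamp t)).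
  move=> W /= hW.
  have : nbhs t (clamp @^-1` [set x | `[0, 1]%classic x -> W x]) by apply: continuous_clamp.
  change (nbhs t (clamp @^-1` [set x | `[0, 1]%classic x -> W x]) -> nbhs t (clamp @^-1` W)).
  by apply: filterS => x /=; apply; exact: clamp_itv.
apply: (cvg_comp _ _ h); apply: cg; exact: clamp_itv.
Qed.

Lemma compact_norm_gt0 (T : topologicalType) (V : normedModType R) (K : set T) (f : T -> V) :
  compact K -> continuous f -> (forall x, K x -> f x != 0) ->
  exists2 d, 0 < d & forall x, K x -> d <= `|f x|.
Proof.
move=> cK cf f0; have [->|/set0P K0] := eqVneq K set0; first by exists 1.
have cn : {within K, continuous (fun x => `|f x|)}.
  apply: continuous_subspaceT => x; apply: continuous_comp; first exact: cf.
  exact: norm_continuous.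
have [c cKc min] := compact_EVT_min K0 cK cn.
exists `|f c|; first by rewrite normr_gt0 f0 //; apply: set_mem.
by move=> x Kx; apply: min; apply: mem_set.
Qed.

Lemma square_compact : compact (`[(0 : R), 1] `*` `[(0 : R), 1]).
Proof. by apply: compact_setX; apply: segment_compact. Qed.

Lemma continuous_dist (V : normedModType R) (f g : R -> V) : continuous f -> continuous g ->
  continuous (fun p : R * R => f p.1 - g p.2).
Proof.
move=> cf cg p; apply: cvgB.
  by apply: (@continuous_comp _ _ _ fst f); [exact: cvg_fst|exact: cf].
by apply: (@continuous_comp _ _ _ snd g); [exact: cvg_snd|exact: cg].
Qed.

(** The pairs whose values are at least [e] apart form a compact set that avoids the diagonal, so
    the distance of their parameters has a positive minimum. *)
Lemma itv_unif_continuous (V : normedModType R) (f : R -> V) e : continuous f -> 0 < e ->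
  exists2 d, 0 < d & forall s t, s \in `[0, 1] -> t \in `[0, 1] ->
    `|s - t| < d -> `|f s - f t| < e.
Proof.
move=> cf e0; pose far := (fun p : R * R => `|f p.1 - f p.2|) @^-1` [set x | e <= x].
have cfar : closed far.
  have cn : continuous (fun p : R * R => `|f p.1 - f p.2|); last first.
    by apply: preimage_closed => [p _|]; [exact: cn|exact: closed_ge].
  move=> p; apply: (@continuous_comp _ _ _ (fun p : R * R => f p.1 - f p.2) Num.norm).
    exact: continuous_dist.
  exact: norm_continuous.
have cK : compact (far `&` (`[(0 : R), 1] `*` `[(0 : R), 1])).
  by rewrite setIC; exact: compact_closedI square_compact cfar.
have [//||d d0 hd] := compact_norm_gt0 (f := fun p : R * R => p.1 - p.2) cK.
- by apply: (@continuous_dist R^o id id) => x; exact: cvg_id.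
- move=> [s t] [/= hst _]; apply/eqP => /eqP; rewrite subr_eq0 => /eqP st.
  by move: hst; rewrite /far /= st subrr normr0 leNgt e0.
exists d => // s t s01 t01; rewrite ltNge => /negP lt; rewrite ltNge; apply/negP => le.
by apply: lt; apply: (hd (s, t)); split.
Qed.

Lemma disjoint_arcs_dist (V : normedModType R) (f g : R -> V) : continuous f -> continuous g ->
  (forall s t, s \in `[0, 1] -> t \in `[0, 1] -> f s <> g t) ->
  exists2 d, 0 < d & forall s t, s \in `[0, 1] -> t \in `[0, 1] -> d <= `|f s - g t|.
Proof.
move=> cf cg fg.
have [||d d0 hd] := compact_norm_gt0 (f := fun p : R * R => f p.1 - g p.2) square_compact.
- exact: continuous_dist.
- by move=> [s t] [/= s01 t01]; rewrite subr_eq0; apply/eqP; apply: fg.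
by exists d => // s t s01 t01; apply: (hd (s, t)).
Qed.

End Clamp.

(** * Polygonal approximation of a drawing *)

Section PlanarCrossingFree.
Variable R : realType.
Implicit Types (a b c d p q : R * R) (s t : R).

Lemma dist_segment a b t : 0 <= t <= 1 -> `|a - (a + t *: (b - a))| <= `|a - b|.
Proof.
move=> /andP[t0 t1]; rewrite opprD addrA subrr add0r normrN normrZ ger0_norm //.
by rewrite distrC ler_piMl.
Qed.

Lemma segments_disjoint_near e a b c d : `|a - b| < e -> `|c - d| < e ->
  2 * e <= `|a - c| -> segments_disjoint a b c d.
Proof.
move=> ab cd ac s t s01 t01 e'.
have h1 := dist_segment a b s01; have h2 := dist_segment c d t01.
have : `|a - c| < 2 * e.
  rewrite -(subrKA (a + s *: (b - a))) {2}e' mulr2n mulrDl mul1r.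
  apply: le_lt_trans (ler_normD _ _) _; apply: ltrD.
    exact: le_lt_trans h1 ab.
  by rewrite distrC; apply: le_lt_trans h2 cd.
by rewrite ltNge ac.
Qed.

(** The arcs have a positive distance [d]. For a fine subdivision the chords are shorter than d / 2,
    so chords of different arcs cannot meet. *)
Lemma arc_polygons_disjoint (f g : R -> R * R) : continuous f -> continuous g ->
  (forall s t, s \in `[0, 1] -> t \in `[0, 1] -> f s <> g t) ->
  \forall N \near \oo, forall k l, (k < N)%N -> (l < N)%N ->
    segments_disjoint (f (k%:R / N%:R)) (f (k.+1%:R / N%:R))
                      (g (l%:R / N%:R)) (g (l.+1%:R / N%:R)).
Proof.
move=> cf cg fg; have [d d0 hd] := disjoint_arcs_dist cf cg fg.
have d2 : 0 < d / 2 by rewrite divr_gt0.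
have [m m0 hm] := itv_unif_continuous cf d2.
have [n n0 hn] := itv_unif_continuous cg d2.
have e0 : 0 < Num.min m n by rewrite lt_min m0.
have step N k : (k < N)%N -> k%:R / N%:R \in `[(0:R), 1] /\ k.+1%:R / N%:R \in `[(0:R), 1]
    /\ `|k%:R / N%:R - k.+1%:R / N%:R| = N%:R^-1 :> R.
  move=> kN; have N0 : 0 < N%:R :> R by rewrite ltr0n (leq_ltn_trans _ kN).
  rewrite !in_itv /= !divr_ge0 //= !ler_pdivrMr // !mul1r !ler_nat (ltnW kN) kN.
  split=> //; split=> //.
  by rewrite -mulrBl -natr1 opprD addrA subrr add0r mulN1r normrN gtr0_norm // invr_gt0.
near=> N.
have ltN : N%:R^-1 < Num.min m n.
  by near: N; apply: near_inftyS; exact: (near_infty_natSinv_lt (PosNum e0)).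
move: ltN; rewrite lt_min => /andP[Nm Nn].
move=> k l /step[k1 [k2 ek]] /step[l1 [l2 el]].
apply: (segments_disjoint_near (e := d / 2)).
- by apply: hm; rewrite ?ek.
- by apply: hn; rewrite ?el.
- by rewrite mulrC divfK ?pnatr_eq0 //; apply: hd.
Unshelve. all: by end_near.
Qed.

Definition shear (h : R) p : R * R := (p.1 + h * p.2, p.2).

Lemma segments_disjoint_shear h a b c d : segments_disjoint a b c d ->
  segments_disjoint (shear h a) (shear h b) (shear h c) (shear h d).
Proof.
move=> dis s t s01 t01 e; apply: (dis s t) => //.
have e2 := congr1 snd e; have e1 := congr1 fst e; rewrite /= /GRing.scale /= in e1 e2.
case: a b c d e1 e2 {dis e} => [a1 a2] [b1 b2] [c1 c2] [d1 d2] /= e1 e2.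
have e3 := congr1 (fun x => h * x) e2.
by congr pair; rewrite /= /GRing.scale //=; lra.
Qed.

(** Two distinct points are put on a vertical line by at most one shear, of parameter [b p q]; [h]
    exceeds all of these. This provides the distinct abscissae that [polygon_parity_even] asks
    for. *)
Lemma exists_shear (s : seq (R * R)) : exists h, forall p q, p \in s -> q \in s -> p != q ->
  (shear h p).1 != (shear h q).1.
Proof.
pose b p q := (q.1 - p.1) / (p.2 - q.2).
exists (1 + \sum_(p <- s) \sum_(q <- s) `|b p q|) => p q ps qs pq.
set h := 1 + _; apply/negP => /eqP; rewrite /= => e.
have e1 : h * (p.2 - q.2) = q.1 - p.1 by lra.
have [e2|ne] := eqVneq p.2 q.2.
  by move: e1 pq; rewrite e2 subrr mulr0 [p]surjective_pairing [q]surjective_pairing e2 => e1;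
    rewrite (_ : p.1 = q.1) ?eqxx //; lra.
have hb : h = b p q by rewrite /b -e1 mulfK // subr_eq0.
have : b p q <= \sum_(p <- s) \sum_(q <- s) `|b p q|.
  rewrite (big_rem p ps) /= (big_rem q qs) /= -addrA.
  apply: le_trans (ler_norm _) _; rewrite lerDl addr_ge0 ?sumr_ge0 // => i _.
  exact: sumr_ge0.
by rewrite -hb /h; lra.
Qed.

Definition adjacency (T : finType) (E : {set {set T}}) : nbhds T :=
  [ffun x => [set y | (x != y) && ([set x; y]%SET \in E)]%SET].

Lemma graph_on_adjacency (T : finType) (E : {set {set T}}) : graph_on finset.setT (adjacency E).
Proof.
split=> [x y|x|x y]; rewrite ?ffunE !inE ?eqxx //.
by rewrite eq_sym finset.setUC.
Qed.

Lemma set2_inj (T : finType) (x y u v : T) : [set x; y]%SET = [set u; v]%SET ->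
  x != y -> (x = u /\ y = v) \/ (x = v /\ y = u).
Proof.
move=> e xy.
have : x \in [set u; v]%SET by rewrite -e !inE eqxx.
have : y \in [set u; v]%SET by rewrite -e !inE eqxx orbT.
rewrite !inE => hy hx; case/orP: hx => /eqP xe; case/orP: hy => /eqP ye; [|by left|by right|];
  by rewrite xe ye eqxx in xy.
Qed.

Lemma arcs_disjoint (T : finType) (E : {set {set T}}) pos g e e' :
  plane_drawing (R := R) E pos g -> e \in E -> e' \in E -> [disjoint e & e']%B ->
  forall s t, s \in `[0, 1] -> t \in `[0, 1] -> g e s <> g e' t.
Proof.
move=> [ipos _ ends av cross] eE eE' dis.
have itv (d : {set T}) s : d \in E -> s \in `[0, 1] ->
    (s \in `]0, 1[) \/ (exists w, w \in d /\ g d s = pos w).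
  move=> dE; have [u [v [-> g0 g1]]] := ends d dE.
  rewrite !in_itv /= => /andP[]; rewrite le_eqVlt => /orP[/eqP<- _|s0].
    by right; exists u; rewrite ?inE ?eqxx.
  rewrite le_eqVlt => /orP[/eqP->|s1]; last by left; rewrite s0 s1.
  by right; exists v; rewrite ?inE ?eqxx ?orbT.
have ee' : e != e'.
  apply/eqP => ee; have [u [v [eu _ _]]] := ends e eE.
  have ue : u \in e by rewrite eu !inE eqxx.
  by have := disjointFr dis ue; rewrite -ee ue.
move=> s t /(itv _ _ eE)[s01|[w [we gw]]] /(itv _ _ eE')[t01|[w' [we' gw']]].
- exact: cross.
- by rewrite gw'; apply: av.
- by rewrite gw => e0; apply: (av _ w t eE' t01).
- rewrite gw gw' => /ipos ww; have := disjointFr dis we; by rewrite ww we'.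
Qed.

Lemma planar_crossing_free (T : finType) (E : {set {set T}}) :
  planar R E -> crossing_free (adjacency E).
Proof.
move=> [pos [g dr]]; have [ipos arcs ends av cross] := dr.
pose y e := g e \o @clamp R.
have cy e : e \in E -> continuous (y e).
  by move=> eE; apply: continuous_comp_clamp; case: (arcs e eE).
have y0 e : y e 0 = g e 0 by rewrite /y /= clamp_id // in_itv /= lexx ler01.
have y1 e : y e 1 = g e 1 by rewrite /y /= clamp_id // in_itv /= lexx ler01.
(* There are finitely many pairs of edges, so one number of pieces serves all of them. *)
have : \forall N \near \oo, forall ee : {set T} * {set T},
    ee.1 \in E -> ee.2 \in E -> [disjoint ee.1 & ee.2]%B ->
    forall k l, (k < N)%N -> (l < N)%N ->
    segments_disjoint (y ee.1 (k%:R / N%:R)) (y ee.1 (k.+1%:R / N%:R))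
                      (y ee.2 (l%:R / N%:R)) (y ee.2 (l.+1%:R / N%:R)).
  apply: filter_forall => -[e e'] /=.
  have [eE|] := boolP (e \in E); last by move=> _; near=> N.
  have [eE'|] := boolP (e' \in E); last by move=> _; near=> N.
  have [dis|] := boolP [disjoint e & e']%B; last by move=> _; near=> N.
  have dy s t : s \in `[0, 1] -> t \in `[0, 1] -> y e s <> y e' t.
    by move=> s01 t01; rewrite /y /= !clamp_id //; apply: (arcs_disjoint dr).
  have := arc_polygons_disjoint (cy _ eE) (cy _ eE') dy.
  by apply: filterS => N hN _ _ _; exact: hN.
move=> /(filterI (nbhs_infty_gt 0%N))/filter_ex[N [/= N0 hN]].
pose pts := [seq pos v | v <- enum T] ++
  [seq y e (k%:R / N%:R) | e <- enum {set T}, k <- iota 0 N.+1].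
have [h hh] := exists_shear pts.
have ptsv v : pos v \in pts by rewrite mem_cat map_f // mem_enum.
have ptse e k : (k <= N)%N -> y e (k%:R / N%:R) \in pts.
  move=> kN; rewrite mem_cat; apply/orP; right; apply/allpairsP; exists (e, k) => /=.
  by rewrite mem_enum; split=> //; have := mem_iota 0 N.+1 k; rewrite /= => ->.
pose P e k := shear h (y e (k%:R / N%:R)).
exists (fun q a b : T => \sum_(k < N) ray_meets (shear h (pos q)) (P [set a; b]%SET k) (P [set a; b]%SET k.+1))%N.
exists (fun a b : T => ((shear h (pos a)).1 < (shear h (pos b)).1)%R : nat).
split=> [q a b|a b ab|u v w z].
- by rewrite finset.setUC.
- have : pos a != pos b by apply: contra ab => /eqP/ipos->.
  by move=> /(hh _ _ (ptsv a) (ptsv b)); case: ltgtP.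
rewrite !ffunE !inE => /andP[uv eE] /andP[wz eE'] uw uz vw vz.
set e := [set u; v]%SET in eE *; set e' := [set w; z]%SET in eE' *.
have dis : [disjoint e & e']%B.
  rewrite finset.disjoints_subset; apply/fintype.subsetP => x; rewrite !inE negb_or.
  by move=> /orP[/eqP->|/eqP->]; rewrite ?uw ?uz ?vw ?vz.
have PQ k l : (k <= N)%N -> (l <= N)%N -> (P e k).1 != (P e' l).1.
  move=> kN lN; apply: hh; rewrite ?ptse //; apply/eqP.
  have itv m : (m <= N)%N -> m%:R / N%:R \in `[(0:R), 1].
    by move=> mN; rewrite in_itv /= divr_ge0 //= ler_pdivrMr ?ltr0n // mul1r ler_nat.
  by rewrite /y /= !clamp_id ?itv //; apply: (arcs_disjoint dr); rewrite ?itv.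
have sPQ k l : (k < N)%N -> (l < N)%N -> segments_disjoint (P e k) (P e k.+1) (P e' l) (P e' l.+1).
  by move=> kN lN; apply: segments_disjoint_shear; apply: (hN (e, e')).
have := polygon_parity_even PQ sPQ.
have [u' [v' [eu' g0 g1]]] := ends e eE; have [w' [z' [ew' g0' g1']]] := ends e' eE'.
have Nr : N%:R != 0 :> R by rewrite pnatr_eq0 -lt0n.
have -> : P e 0%N = shear h (pos u') by rewrite /P mul0r y0 g0.
have -> : P e' 0%N = shear h (pos w') by rewrite /P mul0r y0 g0'.
have -> : P e N = shear h (pos v') by rewrite /P divff // y1 g1.
have -> : P e' N = shear h (pos z') by rewrite /P divff // y1 g1'.
(* The arc of an edge may run in either direction, hence four cases, which differ by the order of
   the summands. *)
case: (set2_inj eu' uv) => [][<- <-]; case: (set2_inj ew' wz) => [][<- <-].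
- by [].
- by congr (~~ odd _); ring.
- by congr (~~ odd _); ring.
- by congr (~~ odd _); ring.
Unshelve. all: by end_near.
Qed.
End PlanarCrossingFree.

(** * Operations on drawings *)

Section Drawings.
Variables (R : realType) (T : finType).
Implicit Types (A B : {set T}) (E F : {set {set T}}) (e : {set T}) (u v w x : T).
Implicit Types (pos : T -> R * R) (g : {set T} -> R -> R * R) (z : R * R) (s t : R).

Definition drawing_on A E pos g : Prop :=
  [/\ {in A &, injective pos},
      forall e, e \in E -> plane_arc (g e),
      forall e, e \in E -> exists u v : T,
        [/\ u \in A, v \in A, e = [set u; v]%SET, g e 0 = pos u & g e 1 = pos v],
      forall e w t, e \in E -> w \in A -> t \in `]0, 1[ -> g e t <> pos w
    & forall e e' s t, e \in E -> e' \in E -> e != e' ->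
        s \in `]0, 1[ -> t \in `]0, 1[ -> g e s <> g e' t].

Definition drawn A E pos g z : Prop :=
  (exists2 w, w \in A & z = pos w) \/
  (exists e t, [/\ e \in E, t \in `[0, 1] & z = g e t]).

Definition planar_on A E : Prop := exists pos g, drawing_on A E pos g.

(** The vertex [w] sits on the boundary of a half-plane containing the drawing, and nothing else
    does. This replaces the notion of lying on the outer face. *)
Definition planar_at A E w : Prop := exists pos g,
  [/\ drawing_on A E pos g, w \in A, pos w = 0
    & forall z, drawn A E pos g z -> z = 0 \/ 0 < z.2].

Lemma planar_onT E : planar_on finset.setT E <-> planar R E.
Proof.
split=> -[pos [g [h1 h2 h3 h4 h5]]]; exists pos, g; split=> //.
- by move=> u v uv; apply: h1; rewrite ?inE.
- by move=> e /h3[u [v [_ _ -> g0 g1]]]; exists u, v.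
- by move=> e w t eE; apply: h4; rewrite ?inE.
- by move=> u v _ _; apply: h1.
- by move=> e /h3[u [v [-> g0 g1]]]; exists u, v; rewrite !inE.
- by move=> e w t eE _; apply: h4.
Qed.

Lemma planar_at_on A E w : planar_at A E w -> planar_on A E.
Proof. by move=> [pos [g [d _ _ _]]]; exists pos, g. Qed.

Lemma planar_on_edge A E e : planar_on A E -> e \in E ->
  exists u v, [/\ u \in A, v \in A, u != v & e = [set u; v]%SET].
Proof.
move=> [pos [g [inj arc ends _ _]]] eE; have [u [v [uA vA ee g0 g1]]] := ends e eE.
exists u, v; split=> //; apply/eqP => uv; have [_ ginj] := arc e eE.
have := ginj 0 1; rewrite !in_itv /= !lexx !ler01 g0 g1 uv => /(_ isT isT erefl) /eqP.
by rewrite eq_sym oner_eq0.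
Qed.

Lemma planar_on_sub A B E F : planar_on A E -> B \subset A -> F \subset E ->
  (forall e, e \in F -> e \subset B) -> planar_on B F.
Proof.
move=> [pos [g [h1 h2 h3 h4 h5]]] BA FE FB; exists pos, g.
have {}BA := fintype.subsetP BA; have {}FE := fintype.subsetP FE; split.
- by move=> u v /BA uA /BA vA; apply: h1.
- by move=> e /FE; apply: h2.
- move=> e eF; have [u [v [_ _ ee g0 g1]]] := h3 e (FE e eF).
  exists u, v; have := FB e eF; rewrite {1}ee => /fintype.subsetP sB.
  by split=> //; rewrite -?ee //; apply: sB; rewrite !inE eqxx ?orbT.
- by move=> e w t /FE eE /BA wA; apply: h4.
- by move=> e e' s t /FE eE /FE eE'; apply: h5.
Qed.

Lemma sub_itv01 t : t \in `]0, 1[ -> t \in `[0, 1].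
Proof. by rewrite !in_itv /= => /andP[/ltW-> /ltW->]. Qed.

Lemma drawn_edge A E pos g e t : e \in E -> t \in `[0, 1] -> drawn A E pos g (g e t).
Proof. by move=> eE t01; right; exists e, t. Qed.

Lemma drawn_vertex A E pos g w : w \in A -> drawn A E pos g (pos w).
Proof. by move=> wA; left; exists w. Qed.

Lemma drawing_on_comp A E pos g (f : R * R -> R * R) :
  drawing_on A E pos g ->
  (forall z, drawn A E pos g z -> {for z, continuous f}) ->
  (forall z z', drawn A E pos g z -> drawn A E pos g z' -> f z = f z' -> z = z') ->
  drawing_on A E (f \o pos) (fun e => f \o g e).
Proof.
move=> [h1 h2 h3 h4 h5] cf inj.
have dv := @drawn_vertex A E pos g; have de := @drawn_edge A E pos g.
split.
- by move=> u v uA vA /inj uv; apply: h1 => //; apply: uv; apply: dv.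
- move=> e eE; have [ce ie] := h2 e eE; split.
    apply: within_continuous_comp => // z; rewrite inE => -[t t01 <-].
    by apply: cf; apply: de.
  by move=> s t s01 t01 /inj st; apply: ie => //; apply: st; apply: de.
- by move=> e eE; have [u [v [? ? ? g0 g1]]] := h3 e eE; exists u, v; rewrite /= g0 g1.
- move=> e w t eE wA t01 /inj ew; apply: (h4 e w t) => //.
  by apply: ew; [apply: de (sub_itv01 t01)|apply: dv].
- move=> e e' s t eE eE' ee' s01 t01 /inj st; apply: (h5 e e' s t) => //.
  by apply: st; apply: de; rewrite ?sub_itv01.
Qed.

Lemma drawn_comp A E pos g (f : R * R -> R * R) z :
  drawn A E (f \o pos) (fun e => f \o g e) z ->
  exists2 z', drawn A E pos g z' & z = f z'.
Proof.
move=> [[w wA ->]|[e [t [eE t01 ->]]]].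
  by exists (pos w) => //; apply: drawn_vertex.
by exists (g e t) => //; apply: drawn_edge.
Qed.

Lemma continuous_pair (U : topologicalType) (f1 f2 : U -> R) (p : U) :
  {for p, continuous f1} -> {for p, continuous f2} ->
  {for p, continuous (fun q => (f1 q, f2 q) : R * R)}.
Proof. by move=> c1 c2; rewrite /prop_for /continuous_at; exact: cvg_pair c1 c2. Qed.

Lemma continuous_fst z : {for z, continuous (fst : R * R -> R)}.
Proof. exact: cvg_fst. Qed.

Lemma continuous_snd z : {for z, continuous (snd : R * R -> R)}.
Proof. exact: cvg_snd. Qed.

(* The half-plane is squeezed into a quadrant by (x, y) |-> (+- y exp x, y), which
   collapses the x-axis to 0. *)
Lemma planar_at_quadrant A E w (b : R) : b != 0 -> planar_at A E w -> exists pos g,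
  [/\ drawing_on A E pos g, w \in A, pos w = 0
    & forall z, drawn A E pos g z -> z = 0 \/ 0 < z.2 /\ 0 < b * z.1].
Proof.
move=> b0 [pos [g [d wA w0 up]]].
pose f z : R * R := (b * (z.2 * expR z.1), z.2).
have f0 : f 0 = 0 by rewrite /f /= mul0r mulr0.
exists (f \o pos), (fun e => f \o g e); split=> //.
- apply: drawing_on_comp d _ _.
    move=> z _; apply: continuous_pair; last exact: continuous_snd.
    apply: cvgM; first exact: cvg_cst.
    apply: cvgM; first exact: continuous_snd.
    by apply: continuous_comp; [exact: continuous_fst|exact: continuous_expR].
  move=> z z' /up hz /up hz'; rewrite /f => -[e1 e2].
  have [z0|h] := hz; have [z0'|h'] := hz'; first by rewrite z0.
  + by rewrite -e2 z0 /= ltxx in h'.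
  + by rewrite e2 z0' /= ltxx in h.
  rewrite [z]surjective_pairing [z']surjective_pairing e2; congr pair.
  apply: expR_inj; move: e1; rewrite e2 => /(mulfI b0)/mulfI; apply.
  by rewrite gt_eqF.
- by rewrite /= w0.
- move=> z /drawn_comp[z' /up[->|hz'] ->]; first by left.
  right; split=> //=; rewrite mulrA; apply: mulr_gt0; last by rewrite mulr_gt0 ?expR_gt0.
  by rewrite -expr2 lt_neqAle eq_sym sqrf_eq0 b0 sqr_ge0.
Qed.

(** The two drawings are squeezed into opposite quadrants of the upper half-plane and then share the
    origin only. *)
Lemma planar_at_wedge A B E F w : planar_at A E w -> planar_at B F w ->
  (A :&: B = [set w])%SET -> planar_at (A :|: B)%SET (E :|: F)%SET w.
Proof.
move=> pE pF AB.
have [|p1 [g1 [d1 wA w1 up1]]] := planar_at_quadrant (b := 1) _ pE; first by rewrite oner_eq0.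
have [|p2 [g2 [d2 wB w2 up2]]] := planar_at_quadrant (b := -1) _ pF; first by rewrite oppr_eq0 oner_eq0.
have [i1 a1 e1 v1 c1] := d1; have [i2 a2 e2 v2 c2] := d2.
have meet z : drawn A E p1 g1 z -> drawn B F p2 g2 z -> z = 0.
  move=> /up1[//|[_ h1]] /up2[//|[_]]; rewrite mulN1r oppr_gt0 => h2.
  by have := lt_trans h1; rewrite mul1r => /(_ _ h2); rewrite ltxx.
have only0 v : v \in A -> v \in B -> v = w.
  move=> vA vB; have : v \in A :&: B by rewrite inE vA vB.
  by rewrite AB inE => /eqP.
have p10 v : v \in A -> p1 v = 0 -> v = w by move=> vA v0; apply: i1; rewrite ?w1.
have p20 v : v \in B -> p2 v = 0 -> v = w by move=> vB v0; apply: i2; rewrite ?w2.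
pose p v := if v \in A then p1 v else p2 v.
pose g e := if e \in E then g1 e else g2 e.
have pA v : v \in A -> p v = p1 v by rewrite /p => ->.
have pB v : v \in B -> p v = p2 v.
  by rewrite /p; case: ifP => // vA vB; rewrite (only0 v) // w1 w2.
have gE e t : e \in E -> g e t = g1 e t by rewrite /g => ->.
have gF e t : e \in F -> e \notin E -> g e t = g2 e t by rewrite /g => _ /negPf->.
have EF e : e \in E :|: F -> e \in E \/ (e \in F /\ e \notin E).
  by rewrite inE; case: (e \in E) => /=; [left|right].
have dr z : drawn (A :|: B) (E :|: F) p g z -> drawn A E p1 g1 z \/ drawn B F p2 g2 z.
  move=> [[v vAB ->]|[e [t [eEF t01 ->]]]].
    move: vAB; rewrite inE => /orP[vA|vB]; [left|right].
      by rewrite pA //; apply: drawn_vertex.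
    by rewrite pB //; apply: drawn_vertex.
  have [eE|[eF eE]] := EF e eEF; [left|right].
    by rewrite gE //; apply: drawn_edge.
  by rewrite gF //; apply: drawn_edge.
exists p, g; split.
- split.
  + move=> u v; rewrite !inE => /orP[uA|uB] /orP[vA|vB].
    * by rewrite !pA //; apply: i1.
    * rewrite pA // pB // => uv; have u0 := meet (p1 u) (drawn_vertex _ _ _ uA).
      have {}u0 : p1 u = 0 by apply: u0; rewrite uv; apply: drawn_vertex.
      by rewrite (p10 u) // (p20 v) // -uv.
    * rewrite pB // pA // => uv; have v0 := meet (p1 v) (drawn_vertex _ _ _ vA).
      have {}v0 : p1 v = 0 by apply: v0; rewrite -uv; apply: drawn_vertex.
      by rewrite (p10 v) // (p20 u) // uv.
    * by rewrite !pB //; apply: i2.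
  + by move=> e /EF[eE|[eF eE]]; rewrite /g ?eE ?(negPf eE); [apply: a1|apply: a2].
  + move=> e /EF[eE|[eF eE]].
      have [u [v [uA vA eq h0 h1]]] := e1 e eE; exists u, v.
      by rewrite !gE // !pA // !inE uA vA.
    have [u [v [uB vB eq h0 h1]]] := e2 e eF; exists u, v.
    by rewrite !gF // !pB // !inE uB vB !orbT.
  + move=> e v t /EF[eE|[eF eE]]; rewrite inE => /orP[vA|vB] t01.
    * by rewrite gE // pA //; apply: v1.
    * rewrite gE // pB // => ev; apply: (v1 e w t eE wA t01); rewrite w1.
      apply: meet; first by apply: drawn_edge (sub_itv01 t01).
      by rewrite ev; apply: drawn_vertex.
    * rewrite gF // pA // => ev; apply: (v2 e w t eF wB t01); rewrite w2.
      apply: meet; last by apply: drawn_edge (sub_itv01 t01).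
      by rewrite ev; apply: drawn_vertex.
    * by rewrite gF // pB //; apply: v2.
  + move=> e e' s t /EF[eE|[eF eE]] /EF[eE'|[eF' eE']] ee' s01 t01.
    * by rewrite !gE //; apply: c1.
    * rewrite gE // gF // => st; apply: (v1 e w s eE wA s01); rewrite w1.
      apply: meet; first by apply: drawn_edge (sub_itv01 s01).
      by rewrite st; apply: drawn_edge (sub_itv01 t01).
    * rewrite gF // gE // => st; apply: (v1 e' w t eE' wA t01); rewrite w1.
      apply: meet; first by apply: drawn_edge (sub_itv01 t01).
      by rewrite -st; apply: drawn_edge (sub_itv01 s01).
    * by rewrite !gF //; apply: c2.
- by rewrite inE wA.
- by rewrite pA.
- by move=> z /dr[/up1|/up2] [->|[h _]]; [left|right|left|right].
Qed.

(** The drawing is raised by 1 and the new edge is the vertical segment from the origin to [w]. *)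
Lemma planar_at_pendant A E w x : planar_at A E w -> x \notin A ->
  planar_at (x |: A)%SET ([set x; w]%SET |: E)%SET x.
Proof.
move=> [pos [g [d wA w0 up]]] xA.
pose f z : R * R := (z.1, z.2 + 1).
have d' : drawing_on A E (f \o pos) (fun e => f \o g e).
  apply: drawing_on_comp d _ _.
    move=> z _; apply: continuous_pair; first exact: continuous_fst.
    by apply: cvgD; [exact: continuous_snd|exact: cvg_cst].
  move=> [a b] [a' b'] _ _ [/= -> e]; congr pair; lra.
have up' z : drawn A E (f \o pos) (fun e => f \o g e) z -> z = (0, 1) \/ 1 < z.2.
  move=> /drawn_comp[z' /up[->|h] ->]; first by left; rewrite /f /= add0r.
  by right; rewrite /= ltrDr.
have [i1 a1 e1 v1 c1] := d'; set p1 := f \o pos in i1 e1 v1 up' d'.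
set g1 := (fun e => f \o g e) in a1 e1 v1 c1 up' d'.
have pw : p1 w = (0, 1) by rewrite /p1 /= w0 /f /= add0r.
pose e0 : {set T} := [set x; w]%SET.
have e0E : e0 \notin E.
  apply/negP => /e1[u [v [uA vA eq _ _]]]; move: xA.
  have : x \in e0 by rewrite !inE eqxx.
  by rewrite eq !inE => /orP[]/eqP->; rewrite ?uA ?vA.
pose p v := if v == x then 0 else p1 v.
pose g2 e t := if e == e0 then (0, t) else g1 e t.
have pA v : v \in A -> p v = p1 v.
  by rewrite /p; case: eqP => // ->; rewrite (negPf xA).
have px : p x = 0 by rewrite /p eqxx.
have gE e t : e \in E -> g2 e t = g1 e t.
  by rewrite /g2; case: eqP => // ->; rewrite (negPf e0E).
have g0 t : g2 e0 t = (0, t) by rewrite /g2 eqxx.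
have low z : drawn A E p1 g1 z -> 1 <= z.2 by move=> /up'[->//|/ltW].
have lowv v : v \in A -> 1 <= (p1 v).2 by move=> vA; apply: low; apply: drawn_vertex.
have lowe e t : e \in E -> t \in `[0, 1] -> 1 <= (g1 e t).2.
  by move=> eE t01; apply: low; apply: drawn_edge.
exists p, g2; split; rewrite ?inE ?eqxx //.
- split.
  + move=> u v; rewrite !inE => /orP[/eqP->|uA] /orP[/eqP->|vA] //; rewrite ?px ?pA //.
    * by move=> eq; have := lowv v vA; rewrite -eq /= ler10.
    * by move=> eq; have := lowv u uA; rewrite eq /= ler10.
    * exact: i1.
  + move=> e; rewrite finset.in_setU1 => /orP[/eqP->|eE].
      split; last by move=> s t _ _; rewrite !g0 => -[].
      apply: continuous_subspaceT; rewrite (_ : g2 e0 = fun t => (0, t)).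
        by move=> t; apply: continuous_pair; [exact: cvg_cst|exact: cvg_id].
      by apply/funext => t; rewrite g0.
    rewrite (_ : g2 e = g1 e); first exact: a1.
    by apply/funext => t; rewrite gE.
  + move=> e; rewrite finset.in_setU1 => /orP[/eqP->|eE].
      by exists x, w; rewrite !g0 px pA // pw !inE eqxx wA orbT.
    have [u [v [uA vA eq h0 h1]]] := e1 e eE; exists u, v.
    by rewrite !gE // !pA // !inE uA vA !orbT.
  + move=> e v t; rewrite !finset.in_setU1 => /orP[/eqP->|eE] /orP[/eqP->|vA] t01.
    * by rewrite g0 px => -[t0]; rewrite t0 in_itv /= ltxx in t01.
    * rewrite g0 pA // => eq; have := lowv v vA; rewrite -eq /=.
      by move: t01; rewrite in_itv /=; lra.
    * by rewrite gE // px => eq; have := lowe e t eE (sub_itv01 t01); rewrite eq /= ler10.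
    * by rewrite gE // pA //; apply: v1.
  + move=> e e' s t; rewrite !finset.in_setU1 => /orP[/eqP->|eE] /orP[/eqP->|eE'] ee' s01 t01.
    * by rewrite eqxx in ee'.
    * rewrite g0 gE // => eq; have := lowe e' t eE' (sub_itv01 t01); rewrite -eq /=.
      by move: s01; rewrite in_itv /=; lra.
    * rewrite g0 gE // => eq; have := lowe e s eE (sub_itv01 s01); rewrite eq /=.
      by move: t01; rewrite in_itv /=; lra.
    * by rewrite !gE //; apply: c1.
- move=> z [[v vA ->]|[e [t [eE t01 ->]]]].
    move: vA; rewrite finset.in_setU1 => /orP[/eqP->|vA]; first by left.
    by right; rewrite pA //; have := lowv v vA; lra.
  move: eE; rewrite finset.in_setU1 => /orP[/eqP->|eE].
    rewrite g0 /=; move: t01; rewrite in_itv /= => /andP[]; rewrite le_eqVlt => /orP[/eqP<-|? _].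
      by left.
    by right.
  by right; rewrite gE //; have := lowe e t eE t01; lra.
Qed.

End Drawings.

(** * Subdividing an edge and moving the new vertex to the boundary *)

Section Subdivision.
Variables (R : realType) (T : finType).
Implicit Types (A B : {set T}) (E F : {set {set T}}) (e : {set T}) (u v w : T).
Implicit Types (pos : T -> R * R) (g : {set T} -> R -> R * R) (z : R * R) (s t : R).

(* Inversion in a circle centred at (0, - h), followed by a reflection, fixes 0 and maps the
   exterior of the disc of diameter [(0, - h), 0] to the upper half-plane. *)
Lemma planar_at_inversion A E pos g w (d : R) : drawing_on A E pos g -> w \in A ->
  pos w = 0 -> 0 < d ->
  (forall z, drawn A E pos g z -> z.2 = 0 \/ d <= `|z.1| + `|z.2|) -> planar_at R A E w.
Proof.
move=> dr wA w0 d0 out; pose h := d / 2; have h0 : 0 < h by rewrite divr_gt0.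
pose good z := z = 0 \/ 0 < z.1 ^+ 2 + z.2 ^+ 2 + h * z.2.
have isgood z : drawn A E pos g z -> good z.
  move=> /out[z2|far]; rewrite /good.
    rewrite z2 mulr0 addr0 expr0n /= addr0.
    have [z1|z1] := eqVneq z.1 0; last by right; rewrite lt_neqAle eq_sym sqrf_eq0 z1 sqr_ge0.
    by left; rewrite [z]surjective_pairing z1 z2.
  right; have dh : d = h + h by rewrite /h; lra.
  rewrite dh in far.
  have [z2|z2] := leP 0 z.2.
    have := mulr_ge0 (ltW h0) z2; have := sqr_ge0 z.1; have := sqr_ge0 z.2.
    rewrite (ger0_norm z2) in far.
    have [y0|y0] := eqVneq z.2 0.
      rewrite y0 addr0 in far; have x0 : 0 < `|z.1| by lra.
      have : 0 < `|z.1| ^+ 2 by rewrite exprn_gt0.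
      by rewrite real_normK ?num_real // y0; lra.
    have : 0 < z.2 ^+ 2 by rewrite lt_neqAle eq_sym sqrf_eq0 y0 sqr_ge0.
    lra.
  rewrite (ltr0_norm z2) in far.
  have [big|small] := leP (- z.2) h.
    have x1 : h <= `|z.1| by lra.
    have : h * h <= `|z.1| ^+ 2 by rewrite expr2 ler_pM // ltW.
    have : h * (- z.2) <= h * h by rewrite ler_pM2l.
    have : 0 < z.2 ^+ 2 by rewrite lt_neqAle eq_sym sqrf_eq0 lt_eqF // sqr_ge0.
    by rewrite real_normK ?num_real //; lra.
  have : h * (- z.2) < (- z.2) * (- z.2) by rewrite ltr_pM2r // oppr_gt0.
  have := sqr_ge0 z.1; rewrite expr2; lra.
pose q z := z.1 ^+ 2 + (z.2 + h) ^+ 2.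
have q0 z : good z -> 0 < q z.
  rewrite /q => -[->|gz]; first by rewrite expr0n /= !add0r exprn_gt0.
  rewrite lt_neqAle eq_sym addr_ge0 ?sqr_ge0 // andbT paddr_eq0 ?sqr_ge0 //.
  rewrite !sqrf_eq0; apply/negP => /andP[/eqP z1 /eqP z2].
  have z2' : z.2 = - h by lra.
  by move: gz; rewrite z1 z2' expr0n /= sqrrN add0r mulrN expr2 subrr ltxx.
pose f z : R * R := (z.1 / q z, h^-1 - (z.2 + h) / q z).
have f0 : f 0 = 0.
  rewrite /f /q /= expr0n /= !add0r mul0r; congr pair.
  have hn : h != 0 by rewrite gt_eqF.
  by field.
exists (f \o pos), (fun e => f \o g e); split=> //.
- apply: drawing_on_comp dr _ _.
    move=> z /isgood/q0 qz.
    have cq : {for z, continuous q}.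
      apply: cvgD; first by apply: cvgM; exact: continuous_fst.
      by apply: cvgM; (apply: cvgD; [exact: continuous_snd|exact: cvg_cst]).
    have cv : {for z, continuous (fun z => (q z)^-1)} by apply: cvgV; rewrite ?gt_eqF.
    apply: continuous_pair.
      by apply: cvgM => //; exact: continuous_fst.
    apply: cvgB; first exact: cvg_cst.
    by apply: cvgM => //; apply: cvgD; [exact: continuous_snd|exact: cvg_cst].
  move=> z z' /isgood/q0 qz /isgood/q0 qz' [e1 e2].
  have {}e2 : (z.2 + h) / q z = (z'.2 + h) / q z' by lra.
  (* Inversion takes the squared distance [q] to the centre to its inverse, so [q], and then the
     point, can be read off the image. *)
  have inv y : 0 < q y -> (q y)^-1 = (y.1 / q y) ^+ 2 + ((y.2 + h) / q y) ^+ 2.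
    move=> qy; rewrite !expr_div_n -mulrDl -/(q y) expr2 invfM mulrA divff ?mul1r //.
    by rewrite gt_eqF.
  have eq : q z = q z' by apply: invr_inj; rewrite (inv z qz) (inv z' qz') e1 e2.
  rewrite eq in e1 e2; have qn : (q z')^-1 != 0 by rewrite invr_eq0 gt_eqF.
  have {}e1 := mulIf qn e1; have {}e2 := mulIf qn e2.
  by rewrite [z]surjective_pairing [z']surjective_pairing e1; congr pair; lra.
- by rewrite /= w0.
- move=> z /drawn_comp[y /isgood gy ->]; have qy := q0 y gy.
  case: gy => [->|gy]; first by left.
  right; rewrite /= subr_gt0 ltr_pdivrMr // mulrC ltr_pdivlMr //.
  by rewrite /q; nra.
Qed.

Lemma norm_pair_le z : `|z| <= `|z.1| + `|z.2|.
Proof. by rewrite prod_normE ge_max lerDl lerDr !normr_ge0. Qed.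

(** The map [f] is complex division by [d] after moving [pos w] to 0. It sends the line of direction
    [d] to the x-axis, and dividing [r] by [D] pays for the change of norm. *)
Lemma planar_at_chord A E pos g w (d : R * R) (r : R) : drawing_on A E pos g -> w \in A ->
  d != 0 -> 0 < r ->
  (forall z, drawn A E pos g z ->
     (exists x : R, z = pos w + x *: d) \/ r <= `|z - pos w|) -> planar_at R A E w.
Proof.
move=> dr wA d0 r0 out; set m := pos w.
pose n := d.1 ^+ 2 + d.2 ^+ 2; pose D := `|d.1| + `|d.2|.
have dn : ~~ ((d.1 == 0) && (d.2 == 0)).
  apply: contra d0 => /andP[/eqP e1 /eqP e2].
  by rewrite [d]surjective_pairing e1 e2.
have n0 : 0 < n by rewrite lt_neqAle eq_sym addr_ge0 ?sqr_ge0 // andbT paddr_eq0 ?sqr_ge0 // !sqrf_eq0.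
have D0 : 0 < D by rewrite lt_neqAle eq_sym addr_ge0 // andbT paddr_eq0 // !normr_eq0.
pose f z : R * R := (((z.1 - m.1) * d.1 + (z.2 - m.2) * d.2) / n,
                     ((z.2 - m.2) * d.1 - (z.1 - m.1) * d.2) / n).
have fK z : z - m = ((f z).1 * d.1 - (f z).2 * d.2, (f z).1 * d.2 + (f z).2 * d.1).
  have nn : n != 0 by rewrite gt_eqF.
  by rewrite [z - m]surjective_pairing; congr pair; rewrite /f /n /=; field.
have fc : continuous f.
  move=> z.
  have c1 : {for z, continuous (fun z => z.1 - m.1)}.
    by apply: cvgB; [exact: continuous_fst|exact: cvg_cst].
  have c2 : {for z, continuous (fun z => z.2 - m.2)}.
    by apply: cvgB; [exact: continuous_snd|exact: cvg_cst].
  apply: (continuous_pair (f1 := fun z => (f z).1) (f2 := fun z => (f z).2)).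
    apply: cvgM; last exact: cvg_cst.
    by apply: cvgD; (apply: cvgM; [|exact: cvg_cst]).
  apply: cvgM; last exact: cvg_cst.
  by apply: cvgB; (apply: cvgM; [|exact: cvg_cst]).
apply: (@planar_at_inversion A E (f \o pos) (fun e => f \o g e) w (r / D)) => //.
- apply: drawing_on_comp dr _ _ => [z _|z z' _ _ eq]; first exact: fc.
  by apply: (addIr (- m)); rewrite !fK eq.
- by rewrite /f /= -/m !subrr !mul0r subrr addr0 mul0r.
- by rewrite divr_gt0.
- move=> z /drawn_comp[y /out[[x ->]|far] ->].
    left; rewrite /f /= /GRing.scale /=; apply/eqP; rewrite mulf_eq0; apply/orP; left; apply/eqP.
    by rewrite -/m; ring.
  right; rewrite ler_pdivrMr //; apply: le_trans far _; rewrite fK.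
  apply: le_trans (norm_pair_le _) _; rewrite /= /D.
  set a := (f y).1; set b := (f y).2.
  have := ler_normB (a * d.1) (b * d.2); have := ler_normD (a * d.2) (b * d.1).
  by rewrite !normrM; lra.
Qed.


Lemma itv_halfP t : t \in `[0, 1] ->
  (t <= 1 / 2 /\ clamp (2 * t) = 2 * t /\ clamp (2 * t - 1) = 0) \/
  (1 / 2 < t /\ clamp (2 * t) = 1 /\ clamp (2 * t - 1) = 2 * t - 1).
Proof.
rewrite in_itv /= => /andP[t0 t1]; have [h|h] := leP t (1 / 2); [left|right].
  split=> //; rewrite clamp_id; last by rewrite in_itv /=; lra.
  by split=> //; rewrite /clamp min_r; [rewrite max_l //; lra|lra].
split=> //; rewrite [clamp (2 * t - 1)]clamp_id; last by rewrite in_itv /=; lra.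
by split=> //; rewrite /clamp min_l; [rewrite max_r //; lra|lra].
Qed.

(** The arc [f], run at double speed, followed by the segment from [f 1] to [f 1 + c]. Clamping
    gives one formula for both halves, and so continuity by composition. *)
Definition extend_arc (f : R -> R * R) (c : R * R) t : R * R :=
  f (clamp (2 * t)) + clamp (2 * t - 1) *: c.

Lemma extend_arcP f c t : t \in `[0, 1] ->
  (t <= 1 / 2 /\ extend_arc f c t = f (2 * t)) \/
  (1 / 2 < t /\ extend_arc f c t = f 1 + (2 * t - 1) *: c).
Proof.
move=> /itv_halfP[[h [h1 h2]]|[h [h1 h2]]]; [left|right]; split=> //;
  by rewrite /extend_arc h1 h2 // scale0r addr0.
Qed.

Lemma extend_arc0 f c : extend_arc f c 0 = f 0.
Proof.
have [|[_ ->]|[h _]] := @extend_arcP f c 0; first by rewrite in_itv /= lexx ler01.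
  by rewrite mulr0.
by exfalso; lra.
Qed.

Lemma extend_arc1 f c : extend_arc f c 1 = f 1 + c.
Proof.
have [|[h _]|[_ ->]] := @extend_arcP f c 1; first by rewrite in_itv /= lexx ler01.
  by exfalso; lra.
by rewrite (_ : 2 * 1 - 1 = 1) ?scale1r //; lra.
Qed.

Lemma plane_arc_extend (f : R -> R * R) (c : R * R) : continuous f -> {in `[0, 1] &, injective f} -> c != 0 ->
  (forall s t, 0 <= s < 1 -> 0 <= t <= 1 -> f s <> f 1 + t *: c) ->
  plane_arc (extend_arc f c).
Proof.
move=> cf inj c0 far; split.
  apply: continuous_subspaceT => t.
  have lin (a : R) : {for t, continuous (fun t => clamp (2 * t + a))}.
    apply: (@continuous_comp _ _ _ (fun t => 2 * t + a) (@clamp R)); last exact: continuous_clamp.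
    by apply: cvgD; [apply: cvgM; [exact: cvg_cst|exact: cvg_id]|exact: cvg_cst].
  apply: cvgD; last by apply: cvgZl; exact: (lin (-1)).
  have := lin 0; rewrite (_ : (fun t => clamp (2 * t + 0)) = fun t => clamp (2 * t)).
    by move=> l0; apply: (@continuous_comp _ _ _ (fun t => clamp (2 * t)) f) => //; exact: cf.
  by apply/funext => x; rewrite addr0.
have scI (x y : R) : x *: c = y *: c -> x = y.
  move=> e; apply/eqP; rewrite -subr_eq0; have : (x - y) *: c == 0 by rewrite scalerBl e subrr.
  by rewrite scaler_eq0 (negPf c0) orbF.
move=> s t s01 t01; move: (s01) (t01); rewrite !in_itv /= => /andP[s0 s1] /andP[t0 t1].
case: (extend_arcP f c s01) => [[hs ->]|[hs ->]]; case: (extend_arcP f c t01) => [[ht ->]|[ht ->]].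
- by move=> e; have : 2 * s = 2 * t; [apply: inj => //; rewrite in_itv /=; lra|lra].
- have [s2|s2] := ltP (2 * s) 1; first by move=> /far []; lra.
  have -> : 2 * s = 1 by lra.
  by rewrite -{1}[f 1]addr0 -{1}(scale0r c) => /addrI/scI; lra.
- have [t2|t2] := ltP (2 * t) 1; first by move=> /esym/far []; lra.
  have -> : 2 * t = 1 by lra.
  by rewrite -[X in _ = X]addr0 -[X in _ = _ + X](scale0r c) => /addrI/scI; lra.
- by move=> /addrI/scI; lra.
Qed.

Lemma in_ball_convex (p a b : R * R) (r l : R) : `|a - p| <= r -> `|b - p| <= r -> 0 <= l <= 1 ->
  `|a + l *: (b - a) - p| <= r.
Proof.
move=> ha hb /andP[l0 l1]; have l1' : 0 <= 1 - l by lra.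
have -> : a + l *: (b - a) - p = (1 - l) *: (a - p) + l *: (b - p).
  by congr pair; rewrite /= /GRing.scale /=; ring.
apply: le_trans (ler_normD _ _) _; rewrite !normrZ !ger0_norm //.
have := ler_wpM2l l0 hb; have := ler_wpM2l l1' ha; lra.
Qed.

(** The parameters [s] and [t] are the first and the last in [0, 1] at which the arc is in the
    closed ball; they exist by compactness. *)
Lemma arc_enters_ball (f : R -> R * R) (p : R * R) (r : R) : continuous f -> 0 < r -> f (1 / 2) = p ->
  r < `|f 0 - p| -> r < `|f 1 - p| ->
  exists s t : R, [/\ 0 < s, s < t, t < 1, `|f s - p| <= r /\ `|f t - p| <= r
    & forall x : R, 0 <= x <= 1 -> x < s \/ t < x -> r < `|f x - p|].
Proof.
move=> cf r0 fp far0 far1.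
have cn : continuous (fun x => `|f x - p|).
  move=> x; apply: (@continuous_comp _ _ _ (fun x => f x - p) Num.norm).
    by apply: cvgB; [exact: cf|exact: cvg_cst].
  exact: norm_continuous.
pose S := `[0, 1]%classic `&` (fun x => `|f x - p|) @^-1` [set x | x <= r].
have cS : compact S.
  apply: compact_closedI; first exact: segment_compact.
  by apply: preimage_closed => [x _|]; [exact: cn|exact: closed_le].
have Sh : S (1 / 2).
  by split; rewrite /= ?fp ?subrr ?normr0 ?ltW // in_itv /=; lra.
have S0 : S !=set0 by exists (1 / 2).
have cid : {within S, continuous (@id R)} by apply: continuous_subspaceT => x; exact: cvg_id.
have [s sS mins] := compact_EVT_min S0 cS cid.
have [t tS maxt] := compact_EVT_max S0 cS cid.
move: sS tS; rewrite !inE => -[/= s01 sr] [/= t01 tr].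
have [d d0 hd] := itv_unif_continuous cf r0.
(* A parameter below 1 / 2 that is still in the ball, which forces s < t. *)
pose y := 1 / 2 - Num.min d (1 / 2) / 2.
have m0 : 0 < Num.min d (1 / 2) by rewrite lt_min d0; lra.
have md : Num.min d (1 / 2) <= d by rewrite ge_min lexx.
have mh : Num.min d (1 / 2) <= 1 / 2 by rewrite ge_min lexx orbT.
have y01 : y \in `[0, 1] by rewrite in_itv /= /y; lra.
have yS : S y.
  split=> //=; rewrite -fp; apply/ltW/hd => //; first by rewrite in_itv /=; lra.
  by rewrite /y addrAC subrr add0r normrN ger0_norm; lra.
have sy : s <= y by apply: mins; rewrite inE.
have ht : 1 / 2 <= t by apply: maxt; rewrite inE.
exists s, t; split=> //.
- move: s01; rewrite in_itv /= => /andP[]; rewrite le_eqVlt => /orP[/eqP s0|//].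
  by move: sr; rewrite -s0 leNgt far0.
- by rewrite /y in sy; lra.
- move: t01; rewrite in_itv /= => /andP[_]; rewrite le_eqVlt => /orP[/eqP t1|//].
  by move: tr; rewrite t1 leNgt far1.
- move=> x x01 h; rewrite ltNge; apply/negP => xr.
  have xS : x \in S by rewrite inE; split.
  have := mins x xS; have := maxt x xS; move=> /= h1 h2; lra.
Qed.

Lemma isolated_midpoint A E pos g e : drawing_on A E pos g -> e \in E ->
  exists2 r : R, 0 < r & (forall x, x \in A -> r < `|pos x - g e (1 / 2)|) /\
    (forall e' t, e' \in E -> e' != e -> t \in `[0, 1] -> r < `|g e' t - g e (1 / 2)|).
Proof.
move=> [i1 a1 e1 v1 c1] eE; set p := g e (1 / 2).
have h01 : 1 / 2 \in `](0 : R), 1[ by rewrite in_itv /=; lra.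
have N1 : \forall r \near (0 : R)^'+, forall x : T, x \in A -> r < `|pos x - p|.
  apply: filter_forall => x; have [xA|] := boolP (x \in A); last by move=> _; near=> r.
  have : 0 < `|pos x - p|.
    by rewrite normr_gt0 subr_eq0 eq_sym; apply/eqP; apply: v1.
  by move=> /nbhs_right_lt; apply: filterS => r.
have N2 : \forall r \near (0 : R)^'+, forall e' : {set T}, e' \in E -> e' != e ->
    forall t, t \in `[0, 1] -> r < `|g e' t - p|.
  apply: filter_forall => e'; have [eE'|] := boolP (e' \in E); last by move=> _; near=> r.
  have [ee'|] := boolP (e' != e); last by move=> _; near=> r.
  have cg : continuous (fun t => g e' (clamp t) - p).
    move=> t; apply: cvgB; last exact: cvg_cst.
    by apply: (@continuous_comp_clamp R _ (g e')); case: (a1 e' eE').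
  have [t /= t01|d d0 hd] := compact_norm_gt0 (@segment_compact R 0 1) cg.
    rewrite clamp_id // subr_eq0; apply/eqP.
    have [u [v [uA vA _ g0 g1]]] := e1 e' eE'.
    move: t01; rewrite in_itv /= => /andP[]; rewrite le_eqVlt => /orP[/eqP<- _|t0].
      by rewrite g0 => h; apply: (v1 e u (1 / 2)).
    rewrite le_eqVlt => /orP[/eqP->|t1]; first by rewrite g1 => h; apply: (v1 e v (1 / 2)).
    by apply: c1 => //; rewrite in_itv /= t0 t1.
  move: (nbhs_right_lt d0); apply: filterS => r rd _ _ t t01.
  by have := hd t t01; rewrite clamp_id //; exact: lt_le_trans.
have [r [/= r0 [h1 h2]]] := filter_ex (filterI (nbhs_right_gt (0 : R)) (filterI N1 N2)).
by exists r => //; split=> // e' t eE' ee'; apply: h2.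
Unshelve. all: by end_near.
Qed.

End Subdivision.

Section Subdivide.
Variables (R : realType) (T : finType).
Implicit Types (A B : {set T}) (E F : {set {set T}}) (e : {set T}) (u v w : T).
Implicit Types (pos : T -> R * R) (g : {set T} -> R -> R * R) (s t : R).

(** Around the midpoint of the arc there is a ball that meets no vertex and no other edge. Between
    the first entry and the last exit the arc is replaced by a chord, and [w] is the middle of the
    chord. Near [w] only this straight piece is drawn, so [planar_at_chord] applies. *)
Lemma planar_at_subdivide_oriented A E pos g u v w (e : {set T}) :
  drawing_on A E pos g -> e \in E -> e = [set u; v]%SET -> w \notin A ->
  u \in A -> v \in A -> g e 0 = pos u -> g e 1 = pos v ->
  planar_at R (w |: A)%SET ([set u; w] |: ([set v; w] |: E :\ e))%SET w.
Proof.
move=> dr eE ee wA uA vA g0 g1; have [i1 a1 e1 v1 c1] := dr.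
have uv : u != v.
  apply/eqP => uv; have [_ ginj] := a1 e eE.
  have := ginj 0 1; rewrite !in_itv /= !lexx !ler01 g0 g1 uv => /(_ isT isT erefl) /eqP.
  by rewrite eq_sym oner_eq0.
have [r r0 [hv he]] := isolated_midpoint dr eE.
pose y t := g e (clamp t).
have cy : continuous y by apply: (@continuous_comp_clamp R _ (g e)); case: (a1 e eE).
have yE t : t \in `[0, 1] -> y t = g e t by move=> t01; rewrite /y clamp_id.
have itv t : 0 <= t <= 1 -> t \in `[0, 1] by rewrite in_itv.
have y0 : y 0 = pos u by rewrite yE ?itv ?lexx ?ler01 //.
have y1 : y 1 = pos v by rewrite yE ?itv ?lexx ?ler01 //.
have yinj : {in `[0, 1] &, injective y}.
  by move=> s t s01 t01; rewrite !yE //; apply: (a1 e eE).2.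
set p := g e (1 / 2) in hv he.
have yp : y (1 / 2) = p by rewrite yE // itv //; lra.
(* The chord is taken in the ball of half the radius, so that other edges and vertices stay at
   distance at least r / 2 from its points. *)
have rh : 0 < r / 2 by lra.
have [||s [t [s0 st t1 [sr tr] out]]] := arc_enters_ball cy rh yp.
- by rewrite y0; apply: lt_trans (hv u uA); lra.
- by rewrite y1; apply: lt_trans (hv v vA); lra.
have s01 : s \in `[0, 1] by apply: itv; lra.
have t01 : t \in `[0, 1] by apply: itv; lra.
set a := y s in sr; set b := y t in tr.
have ab : b - a != 0.
  by rewrite subr_eq0; apply/eqP => /(yinj _ _ t01 s01) ts; move: st; rewrite ts ltxx.
pose c : R * R := 2^-1 *: (b - a); pose m := a + c.
have c0 : c != 0 by rewrite scaler_eq0 (negPf ab) orbF invr_eq0 pnatr_eq0.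
have bE : b = m + c.
  rewrite /m /c -addrA -scalerDl (_ : 2^-1 + 2^-1 = 1); first by rewrite scale1r addrC subrK.
  by lra.
have mball : `|m - p| <= r / 2.
  by rewrite /m /c; apply: in_ball_convex => //; lra.
have aE : a = m - c by rewrite /m addrK.
(* The parts of the arc that are kept, both parametrized from the old end towards the ball; [f2]
   therefore runs backwards from [v]. *)
pose f1 x := y (s * x); pose f2 x := y (1 - (1 - t) * x).
have f11 : f1 1 = a by rewrite /f1 mulr1.
have f21 : f2 1 = b by rewrite /f2 mulr1 opprB addrC subrK.
have cf1 : continuous f1.
  move=> x; apply: (@continuous_comp _ _ _ (fun x => s * x) y); last exact: cy.
  by apply: cvgM; [exact: cvg_cst|exact: cvg_id].
have cf2 : continuous f2.
  move=> x; apply: (@continuous_comp _ _ _ (fun x => 1 - (1 - t) * x) y); last exact: cy.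
  by apply: cvgB; [exact: cvg_cst|apply: cvgM; [exact: cvg_cst|exact: cvg_id]].
have rng1 x : 0 <= x <= 1 -> 0 <= s * x <= s.
  by move=> /andP[x0 x1]; rewrite mulr_ge0 ?(ltW s0) //= ger_pMr.
have rng2 x : 0 <= x <= 1 -> t <= 1 - (1 - t) * x <= 1.
  move=> /andP[x0 x1]; have t1' : 0 < 1 - t by rewrite subr_gt0.
  have : 0 <= (1 - t) * x by rewrite mulr_ge0 // ltW.
  have : (1 - t) * x <= 1 - t by rewrite ger_pMr.
  clear; lra.
have if1 : {in `[0, 1] &, injective f1}.
  move=> x x'; rewrite !in_itv /= => /rng1 h /rng1 h' /yinj eq.
  by apply: (mulfI (lt0r_neq0 s0)); apply: eq; apply: itv; clear -h h' s0 st t1; lra.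
have if2 : {in `[0, 1] &, injective f2}.
  move=> x x'; rewrite !in_itv /= => /rng2 h /rng2 h' /yinj eq.
  have t1' : 1 - t != 0 by rewrite subr_eq0 gt_eqF.
  apply: (mulfI t1'); have : 1 - (1 - t) * x = 1 - (1 - t) * x' by apply: eq; apply: itv; clear -h h' s0 st t1; lra.
  by move=> /addrI/oppr_inj.
have chord1 x : 0 <= x <= 1 -> `|a + x *: c - p| <= r / 2.
  move=> x01; rewrite (_ : c = m - a); last by rewrite /m addrAC subrr add0r.
  exact: in_ball_convex.
have chord2 x : 0 <= x <= 1 -> `|b + x *: - c - p| <= r / 2.
  move=> x01; rewrite (_ : - c = m - b); last by rewrite bE opprD addrA subrr add0r.
  exact: in_ball_convex.
have far1 x x' : 0 <= x < 1 -> 0 <= x' <= 1 -> f1 x <> f1 1 + x' *: c.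
  move=> /andP[x0 x1] x01' eq; have := chord1 x' x01'; rewrite -f11 -eq leNgt.
  have h : s * x < s by rewrite gtr_pMr.
  have h0 : 0 <= s * x by rewrite mulr_ge0 // ltW.
  by rewrite /f1 out //; [clear -h h0 st t1; lra|left].
have far2 x x' : 0 <= x < 1 -> 0 <= x' <= 1 -> f2 x <> f2 1 + x' *: - c.
  move=> /andP[x0 x1] x01' eq; have := chord2 x' x01'; rewrite -f21 -eq leNgt.
  have h : (1 - t) * x < 1 - t by rewrite gtr_pMr // subr_gt0.
  have h0 : 0 <= (1 - t) * x by rewrite mulr_ge0 // subr_ge0 ltW.
  by rewrite /f2 out //; [clear -h h0 s0 st t1; lra|right; clear -h; lra].
have nc0 : - c != 0 by rewrite oppr_eq0.
have arc1 := plane_arc_extend cf1 if1 c0 far1.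
have arc2 := plane_arc_extend cf2 if2 nc0 far2.
set h1 := extend_arc f1 c in arc1; set h2 := extend_arc f2 (- c) in arc2.
have h10 : h1 0 = pos u by rewrite /h1 extend_arc0 /f1 mulr0.
have h20 : h2 0 = pos v by rewrite /h2 extend_arc0 /f2 mulr0 subr0.
have h11 : h1 1 = m by rewrite /h1 extend_arc1 f11.
have h21 : h2 1 = m by rewrite /h2 extend_arc1 f21 bE addrK.
have h1P x : x \in `]0, 1[ -> (exists2 x', 0 < x' <= s & h1 x = y x') \/
    (exists2 l, 0 < l < 1 & h1 x = a + l *: c).
  move=> x01; have := sub_itv01 x01; move: x01; rewrite in_itv /= => /andP[x0 x1].
  rewrite /h1 => /(extend_arcP f1 c)[[h ->]|[h ->]]; [left; exists (s * (2 * x))|right; exists (2 * x - 1)] => //.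
  - by rewrite mulr_gt0 //= ?ger_pMr //; clear -h x0 x1; lra.
  - clear -h x0 x1; lra.
  - by rewrite f11.
have h2P x : x \in `]0, 1[ -> (exists2 x', t <= x' < 1 & h2 x = y x') \/
    (exists2 l, 0 < l < 1 & h2 x = b + l *: - c).
  move=> x01; have := sub_itv01 x01; move: x01; rewrite in_itv /= => /andP[x0 x1].
  rewrite /h2 => /(extend_arcP f2 (- c))[[h ->]|[h ->]]; [left; exists (1 - (1 - t) * (2 * x))|right; exists (2 * x - 1)] => //.
  - have t1' : 0 < 1 - t by rewrite subr_gt0.
    have : 0 < (1 - t) * (2 * x) by rewrite mulr_gt0 //; clear -x0; lra.
    have : (1 - t) * (2 * x) <= 1 - t by rewrite ger_pMr //; clear -h; lra.
    clear; lra.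
  - clear -h x0 x1; lra.
  - by rewrite f21.
have yav x' (z' : T) : 0 < x' < 1 -> z' \in A -> y x' <> pos z'.
  by move=> h zA; rewrite yE; [apply: v1|apply: itv; clear -h; lra].
have ycr x' e' l : 0 < x' < 1 -> e' \in E -> e' != e -> l \in `]0, 1[ -> y x' <> g e' l.
  move=> h eE' ee' l01; rewrite yE; last by apply: itv; clear -h; lra.
  by apply: c1 => //; rewrite eq_sym.
have scI (x x' : R) : x *: c = x' *: c -> x = x'.
  move=> eq; apply/eqP; rewrite -subr_eq0; have : (x - x') *: c == 0 by rewrite scalerBl eq subrr.
  by rewrite scaler_eq0 (negPf c0) orbF.
(* A kept point of the arc that lies in the ball, in particular on the chord, has its parameter
   between [s] and [t]; so only the ends of the chord remain possible. *)
have inball x' : 0 < x' < 1 -> `|y x' - p| <= r / 2 -> s <= x' <= t.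
  move=> h ball; apply/andP; split; rewrite leNgt; apply/negP => lt;
    (move: ball; rewrite leNgt; apply/negP; rewrite negbK; apply: out; first by clear -h; lra).
    by left.
  by right.
have F1 x (z : T) : x \in `]0, 1[ -> z \in A -> h1 x <> pos z.
  move=> /h1P[[x' h ->]|[l l01 ->]] zA; first by apply: yav => //; clear -h s0 st t1; lra.
  move=> eq; have := hv z zA; rewrite -eq; have := chord1 l; clear -l01 r0; lra.
have F2 x (z : T) : x \in `]0, 1[ -> z \in A -> h2 x <> pos z.
  move=> /h2P[[x' h ->]|[l l01 ->]] zA; first by apply: yav => //; clear -h s0 st t1; lra.
  move=> eq; have := hv z zA; rewrite -eq; have := chord2 l; clear -l01 r0; lra.
(* Points of the chord are written as m + x c, with [a] at x = -1 and [b] at x = 1, which turns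
   coincidences into equations between reals. *)
have mcI (x x' : R) : m + x *: c = m + x' *: c -> x = x' by move=> /addrI/scI.
have na l : a + l *: c = m + (l - 1) *: c by rewrite aE scalerBl scale1r addrA addrAC.
have nb l : b + l *: - c = m + (1 - l) *: c by rewrite bE scalerN scalerBl scale1r addrA.
have na0 : a = m + (- 1) *: c by rewrite aE scaleN1r.
have nb0 : b = m + 1 *: c by rewrite bE scale1r.
have nm0 : m = m + 0 *: c by rewrite scale0r addr0.
have F3 x : x \in `]0, 1[ -> h1 x <> m.
  move=> /h1P[[x' h ->]|[l l01 ->]] eq.
    have ge : s <= x' <= t by apply: inball; [clear -h s0 st t1; lra|rewrite eq].
    have xs : x' = s by clear -ge h; lra.
    by move: eq; rewrite xs -/a na0 [X in _ = X]nm0 => /mcI; clear; lra.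
  by move: eq; rewrite na [X in _ = X]nm0 => /mcI; clear -l01; lra.
have F4 x : x \in `]0, 1[ -> h2 x <> m.
  move=> /h2P[[x' h ->]|[l l01 ->]] eq.
    have ge : s <= x' <= t by apply: inball; [clear -h s0 st t1; lra|rewrite eq].
    have xs : x' = t by clear -ge h; lra.
    by move: eq; rewrite xs -/b nb0 [X in _ = X]nm0 => /mcI; clear; lra.
  by move: eq; rewrite nb [X in _ = X]nm0 => /mcI; clear -l01; lra.
have F5 x e' l : x \in `]0, 1[ -> e' \in E -> e' != e -> l \in `]0, 1[ -> h1 x <> g e' l.
  move=> /h1P[[x' h ->]|[x' h ->]] eE' ee' l01; first by apply: ycr => //; clear -h s0 st t1; lra.
  move=> eq; have := he e' l eE' ee' (sub_itv01 l01); rewrite -eq; have := chord1 x'; clear -h r0; lra.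
have F6 x e' l : x \in `]0, 1[ -> e' \in E -> e' != e -> l \in `]0, 1[ -> h2 x <> g e' l.
  move=> /h2P[[x' h ->]|[x' h ->]] eE' ee' l01; first by apply: ycr => //; clear -h s0 st t1; lra.
  move=> eq; have := he e' l eE' ee' (sub_itv01 l01); rewrite -eq; have := chord2 x'; clear -h r0; lra.
have F7 x x' : x \in `]0, 1[ -> x' \in `]0, 1[ -> h1 x <> h2 x'.
  move=> /h1P[[z h ->]|[z h ->]] /h2P[[z' h' ->]|[z' h' ->]] eq.
  - have zz : z = z' by apply: yinj eq; apply: itv; clear -h h' s0 st t1; lra.
    by clear -zz h h' st; lra.
  - have ge : s <= z <= t by apply: inball; [clear -h s0 st t1; lra|rewrite eq; apply: chord2; clear -h'; lra].
    have zs : z = s by clear -ge h; lra.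
    by move: eq; rewrite zs -/a na0 nb => /mcI; clear -h'; lra.
  - have ge : s <= z' <= t by apply: inball; [clear -h' s0 st t1; lra|rewrite -eq; apply: chord1; clear -h; lra].
    have zs : z' = t by clear -ge h'; lra.
    by move: eq; rewrite zs -/b nb0 na => /mcI; clear -h; lra.
  - by move: eq; rewrite na nb => /mcI; clear -h h'; lra.
have F8 e' l : e' \in E -> e' != e -> l \in `[0, 1] -> r / 2 <= `|g e' l - m|.
  move=> eE' ee' l01; have := he e' l eE' ee' l01.
  have := ler_normD (g e' l - m) (m - p); rewrite addrA subrK; move: mball; clear; lra.
have F9 (z : T) : z \in A -> r / 2 <= `|pos z - m|.
  move=> zA; have := hv z zA.
  have := ler_normD (pos z - m) (m - p); rewrite addrA subrK; move: mball; clear; lra.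
have fm1 x : 0 <= x <= 1 -> f1 x != m.
  move=> /andP[x0]; rewrite le_eqVlt => /orP[/eqP->|x1]; apply/eqP.
    rewrite f11 /m -[X in X = _]addr0 => /addrI/esym c00.
    by rewrite c00 eqxx in c0.
  by move=> eq; apply: (far1 x 1); rewrite ?x0 ?x1 ?ler01 ?lexx // scale1r f11.
have fm2 x : 0 <= x <= 1 -> f2 x != m.
  move=> /andP[x0]; rewrite le_eqVlt => /orP[/eqP->|x1]; apply/eqP.
    rewrite f21 bE -[X in _ = X]addr0 => /addrI c00.
    by rewrite c00 eqxx in c0.
  move=> eq; apply: (far2 x 1); rewrite ?x0 ?x1 ?ler01 ?lexx // scale1r f21.
  by rewrite bE addrK.
have cd (f : R -> R * R) : continuous f -> continuous (fun x => f x - m).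
  by move=> cf x; apply: cvgB; [exact: cf|exact: cvg_cst].
(* The kept parts of the arc are compact and miss [m]. Their distances to it, together with r / 2,
   bound the radius within which only the chord is drawn. *)
have [x x01|d1 d10 hd1] := compact_norm_gt0 (@segment_compact R 0 1) (cd _ cf1).
  by rewrite subr_eq0; apply: fm1; move: x01; rewrite /= in_itv.
have [x x01|d2 d20 hd2] := compact_norm_gt0 (@segment_compact R 0 1) (cd _ cf2).
  by rewrite subr_eq0; apply: fm2; move: x01; rewrite /= in_itv.
have cases x : x \in `[0, 1] -> (exists k : R, h1 x = m + k *: c) \/ d1 <= `|h1 x - m|.
  move=> x01; move: (x01); rewrite in_itv /= => x01'.
  rewrite /h1; case: (extend_arcP f1 c x01) => [[h ->]|[h ->]].
    by right; apply: hd1; rewrite /= in_itv /=; clear -h x01'; lra.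
  by left; exists (2 * x - 1 - 1); rewrite f11 na.
have cases' x : x \in `[0, 1] -> (exists k : R, h2 x = m + k *: c) \/ d2 <= `|h2 x - m|.
  move=> x01; move: (x01); rewrite in_itv /= => x01'.
  rewrite /h2; case: (extend_arcP f2 (- c) x01) => [[h ->]|[h ->]].
    by right; apply: hd2; rewrite /= in_itv /=; clear -h x01'; lra.
  by left; exists (1 - (2 * x - 1)); rewrite f21 nb.
clearbody h1 h2.
clear h1P h2P far1 far2 chord1 chord2 inball yav ycr out hv he hd1 hd2 fm1 fm2.
pose eu : {set T} := [set u; w]%SET; pose ev : {set T} := [set v; w]%SET.
have wE e' : e' \in E -> w \notin e'.
  move=> /e1[z [z' [zA zA' -> _ _]]]; rewrite !inE negb_or.
  by apply/andP; split; apply: contraNneq wA => ->.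
have euE : eu \notin E by apply/negP => /wE; rewrite !inE eqxx orbT.
have evE : ev \notin E by apply/negP => /wE; rewrite !inE eqxx orbT.
have uw : u != w by apply: contraNneq wA => <-.
have vw : v != w by apply: contraNneq wA => <-.
have evu : ev != eu.
  apply/eqP => eq; have : v \in eu by rewrite -eq !inE eqxx.
  by rewrite !inE eq_sym (negPf uv) (negPf vw).
clear y0 y1 yinj cy yE yp.
pose q (z : T) := if z == w then m else pos z.
pose G e' := if e' == eu then h1 else if e' == ev then h2 else g e'.
have qA (z : T) : z \in A -> q z = pos z.
  by rewrite /q; case: eqP => // ->; rewrite (negPf wA).
have qw : q w = m by rewrite /q eqxx.
have Gu : G eu = h1 by rewrite /G eqxx.
have Gv : G ev = h2 by rewrite /G (negPf evu) eqxx.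
have GE e' : e' \in E -> G e' = g e'.
  move=> eE'; rewrite /G; case: eqP => [eq|_]; first by rewrite -eq eE' in euE.
  by case: eqP => // eq; rewrite -eq eE' in evE.
clearbody q G.
have newE e' : e' \in eu |: (ev |: E :\ e) -> [\/ e' = eu, e' = ev | e' \in E /\ e' != e].
  rewrite !finset.in_setU1 finset.in_setD1 => /or3P[/eqP|/eqP|/andP[h h']];
  by [constructor 1|constructor 2|constructor 3].
apply: (planar_at_chord (pos := q) (g := G) (d := c) (r := Num.min (r / 2) (Num.min d1 d2))).
- split.
  + move=> z z'; rewrite !finset.in_setU1 => /orP[/eqP->|zA] /orP[/eqP->|zA'] //; rewrite ?qw ?qA //.
    * by move=> eq; have := F9 z' zA'; rewrite -eq subrr normr0 leNgt rh.
    * by move=> eq; have := F9 z zA; rewrite eq subrr normr0 leNgt rh.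
    * exact: i1.
  + by move=> e' /newE[->|->|[eE' _]]; rewrite ?Gu ?Gv ?GE //; apply: a1.
  + move=> e' /newE[->|->|[eE' _]].
    * by exists u, w; rewrite Gu qA // qw !inE eqxx uA orbT.
    * by exists v, w; rewrite Gv qA // qw !inE eqxx vA orbT.
    * have [z [z' [zA zA' eq gz gz']]] := e1 e' eE'; exists z, z'.
      by rewrite GE // !qA // !inE zA zA' !orbT.
  + move=> e' z x /newE[->|->|[eE' ne]]; rewrite finset.in_setU1 => /orP[/eqP->|zA] x01;
      rewrite ?Gu ?Gv ?GE ?qw ?qA //; [exact: F3|exact: F1|exact: F4|exact: F2| |exact: v1].
    by move=> eq; have := F8 e' x eE' ne (sub_itv01 x01); rewrite eq subrr normr0 leNgt rh.
  + move=> e' e'' x x' /newE[->|->|[eE' ne]] /newE[->|->|[eE'' ne']] dif x01 x01';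
      rewrite ?Gu ?Gv ?GE //; rewrite ?eqxx // in dif.
    * exact: F7.
    * exact: F5.
    * by apply/nesym; apply: F7.
    * exact: F6.
    * by apply/nesym; apply: F5.
    * by apply/nesym; apply: F6.
    * exact: c1.
- by rewrite finset.in_setU1 eqxx.
- by [].
- by rewrite !lt_min rh d10 d20.
move=> z; rewrite qw => -[[z' + ->]|[e' [x [/newE ne x01 ->]]]].
  rewrite finset.in_setU1 => /orP[/eqP->|zA].
    by left; exists 0; rewrite qw scale0r addr0.
  by right; rewrite qA // ge_min F9.
case: ne => [->|->|[eE' ne]]; rewrite ?Gu ?Gv ?GE //.
- by have [?|far] := cases x x01; [left|right; rewrite !ge_min far ?orbT].
- by have [?|far] := cases' x x01; [left|right; rewrite !ge_min far ?orbT].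
- by right; rewrite ge_min F8.
Qed.

Lemma planar_at_subdivide A E u v w : planar_on R A E -> [set u; v]%SET \in E -> w \notin A ->
  planar_at R (w |: A)%SET
    ([set u; w] |: ([set v; w] |: E :\ [set u; v]))%SET w.
Proof.
move=> [pos [g dr]] eE wA; have [i1 a1 e1 v1 c1] := dr.
have [u' [v' [uA vA ee g0 g1]]] := e1 _ eE.
have uv' : u' != v'.
  apply/eqP => uv; have [_ ginj] := a1 _ eE.
  have := ginj 0 1; rewrite !in_itv /= !lexx !ler01 g0 g1 uv => /(_ isT isT erefl) /eqP.
  by rewrite eq_sym oner_eq0.
have := planar_at_subdivide_oriented dr eE ee wA uA vA g0 g1.
have [[-> ->]//|[-> ->]] := set2_inj (esym ee) uv'.
by rewrite finset.setUCA.
Qed.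

End Subdivide.

(** * Small planar graphs *)

Section Relabel.
Variables (R : realType) (T T' : finType) (f : T -> T') (A : {set T}).
Hypothesis injf : {in A &, injective f}.
Implicit Types (E : {set {set T}}) (e : {set T}) (w : T).

Definition relabel E : {set {set T'}} := [set f @: (e : {set T}) | e in E]%SET.

Lemma imset_inj_on (e e' : {set T}) : e \subset A -> e' \subset A -> (f @: e = f @: e')%SET -> e = e'.
Proof.
have sub (d d' : {set T}) : d \subset A -> d' \subset A -> (f @: d = f @: d')%SET -> d \subset d'.
  move=> /fintype.subsetP dA /fintype.subsetP dA' eq; apply/fintype.subsetP => x xd.
  have : f x \in (f @: d')%SET by rewrite -eq imset_f.
  by move=> /imsetP[y yd fxy]; rewrite (injf (dA _ xd) (dA' _ yd) fxy).
move=> eA eA' eq; apply/eqP; rewrite finset.eqEsubset.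
by apply/andP; split; apply: sub.
Qed.

Lemma relabel_drawing E (pos : T -> R * R) g : drawing_on A E pos g ->
  exists pos' g', [/\ drawing_on (f @: A)%SET (relabel E) pos' g',
    forall x, x \in A -> pos' (f x) = pos x & forall e, e \in E -> g' (f @: e)%SET = g e].
Proof.
move=> [i1 a1 e1 v1 c1].
have sub e : e \in E -> e \subset A.
  by move=> /e1[u [v [uA vA -> _ _]]]; rewrite finset.subUset !finset.sub1set uA vA.
pose pos' y : R * R := if [pick x in A | f x == y] is Some x then pos x else 0.
pose g' (e' : {set T'}) : R -> R * R := if [pick e in E | (f @: (e : {set T}))%SET == e'] is Some e then g e else fun=> 0.
have posE x : x \in A -> pos' (f x) = pos x.
  move=> xA; rewrite /pos'; case: pickP => [y /andP[yA /eqP/injf->]//|/(_ x)].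
  by rewrite xA eqxx.
have gE e : e \in E -> g' (f @: e)%SET = g e.
  move=> eE; rewrite /g'; case: pickP => [d /andP[dE /eqP]|/(_ e)].
    by move=> /imset_inj_on->; rewrite ?sub.
  by rewrite eE eqxx.
exists pos', g'; split=> //; split.
- by move=> y y' /imsetP[x xA ->] /imsetP[x' xA' ->]; rewrite !posE // => /i1->.
- by move=> e' /imsetP[e eE ->]; rewrite gE //; apply: a1.
- move=> e' /imsetP[e eE ->]; rewrite gE //; have [u [v [uA vA ee g0 g1]]] := e1 e eE.
  by exists (f u), (f v); rewrite !posE // !imset_f // {1}ee imsetU !imset_set1.
- by move=> e' y t /imsetP[e eE ->] /imsetP[x xA ->]; rewrite gE // posE //; apply: v1.
- move=> e' d' s t /imsetP[e eE ->] /imsetP[d dE ->] ne; rewrite !gE //.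
  by apply: c1 => //; apply: contraNneq ne => ->.
Qed.

Lemma planar_on_relabel E : planar_on R A E -> planar_on R (f @: A)%SET (relabel E).
Proof.
by move=> [pos [g /relabel_drawing[pos' [g' [d _ _]]]]]; exists pos', g'.
Qed.

Lemma planar_at_relabel E w : planar_at R A E w ->
  planar_at R (f @: A)%SET (relabel E) (f w).
Proof.
move=> [pos [g [d wA w0 up]]]; have [pos' [g' [d' posE gE]]] := relabel_drawing d.
exists pos', g'; split=> //; [exact: imset_f|by rewrite posE|].
move=> z [[y /imsetP[x xA ->] ->]|[e' [t [/imsetP[e eE ->] t01 ->]]]]; apply: up.
  by rewrite posE //; apply: drawn_vertex.
by rewrite gE //; apply: drawn_edge.
Qed.

End Relabel.

Definition adjacent (T : finType) (E : {set {set T}}) : rel T :=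
  fun x y => [set x; y]%SET \in E.

Definition connected_on (T : finType) (A : {set T}) (E : {set {set T}}) : bool :=
  [forall x in A, forall y in A, connect (adjacent E) x y].

Section StraightLine.
Variables (m : nat) (c : nat -> nat * nat) (s : seq (nat * nat)).

Definition nat_edge (p : nat * nat) : {set 'I_m.+1} := [set inord p.1; inord p.2]%SET.
Definition straight_edges : {set {set 'I_m.+1}} := [set e in map nat_edge s]%SET.

(** Twice the signed area of the triangle abd. *)
Definition ccw (a b d : nat * nat) : int :=
  (b.1%:Z - a.1%:Z) * (d.2%:Z - a.2%:Z) - (b.2%:Z - a.2%:Z) * (d.1%:Z - a.1%:Z).

(* The second segment lies on one side of the line through the first, touching it at
   most at one endpoint. *)
Definition one_side (p q : nat * nat) : bool :=
  let x := ccw (c p.1) (c p.2) (c q.1) in let y := ccw (c p.1) (c p.2) (c q.2) in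
  (0 <= x * y) && (x + y != 0).

(** A sufficient test by integer signs alone: vertices are compared with the whole line through an
    edge, which is stronger than avoiding the segment. *)
Definition straight_line_check : bool :=
  [&& all (fun p => (p.1 < p.2 < m.+1)%N) s, uniq s, uniq (map c (iota 0 m.+1)),
      all (fun p => all (fun w => [|| w == p.1, w == p.2 | ccw (c p.1) (c p.2) (c w) != 0])
        (iota 0 m.+1)) s
    & all (fun p => all (fun q => [|| p == q, one_side p q | one_side q p]) s) s].

Hypothesis ok : straight_line_check.

Lemma straight_bound p : p \in s -> (p.1 < p.2 < m.+1)%N.
Proof. by case/and5P: ok => /allP h _ _ _ _ /h. Qed.

Lemma nat_edgeP p (i : 'I_m.+1) : p \in s -> (i \in nat_edge p) = (p.1 == val i) || (p.2 == val i).
Proof.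
move=> /straight_bound/andP[h1 h2]; rewrite !inE -!val_eqE /= !inordK //; last exact: ltn_trans h2.
by rewrite !(eq_sym (val i)).
Qed.

Lemma nat_edge_inj : {in s &, injective nat_edge}.
Proof.
move=> [a b] [a' b'] ps qs eq.
have /andP[/= h1 h2] := straight_bound ps; have /andP[/= h1' h2'] := straight_bound qs.
have mem (i : nat) (h : (i < m.+1)%N) : (a == i) || (b == i) = (a' == i) || (b' == i).
  by have := nat_edgeP (Ordinal h) ps; rewrite eq nat_edgeP //= => ->.
have := mem a (ltn_trans h1 h2); have := mem b h2.
have := mem a' (ltn_trans h1' h2'); have := mem b' h2'.
rewrite !eqxx ?orbT /= => e1 e2 e3 e4.
have [-> ->] : a = a' /\ b = b'.
  by move: e1 e2 e3 e4; do !case: eqP => /= ?; move=> // *; lia.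
by [].
Qed.

Lemma straight_edgesP e : reflect (exists2 p, p \in s & e = nat_edge p) (e \in straight_edges).
Proof. by rewrite inE; apply: (iffP mapP). Qed.

Lemma degree_straight (i : 'I_m.+1) :
  degree straight_edges i = count (fun p => (p.1 == val i) || (p.2 == val i)) s.
Proof.
have -> : degree straight_edges i =
   #|[set e in map nat_edge [seq p <- s | (p.1 == val i) || (p.2 == val i)]]%SET|.
  apply: eq_card => e; rewrite !inE; apply/andP/mapP => [[/mapP[p ps ->]]|[p]].
    by rewrite nat_edgeP // => pi; exists p; rewrite // mem_filter pi.
  rewrite mem_filter => /andP[pi ps] ->; split; last by rewrite nat_edgeP.
  exact: map_f.
rewrite cardsE -size_filter -(size_map nat_edge); apply/card_uniqP.
rewrite map_inj_in_uniq; first by apply: filter_uniq; case/and5P: ok.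
by move=> p q; rewrite !mem_filter => /andP[_ ps] /andP[_ qs]; apply: nat_edge_inj.
Qed.

Lemma connected_straight : all (fun i => has (fun p => p.2 == i) s) (iota 1 m) ->
  connected_on finset.setT straight_edges.
Proof.
move=> /allP h; have sym : connect_sym (adjacent straight_edges).
  by apply: sym_connect_sym => x y; rewrite /adjacent finset.setUC.
have c0 k : (k < m.+1)%N -> connect (adjacent straight_edges) ord0 (inord k).
  elim/ltn_ind: k => -[|k] IH km; first by rewrite (_ : inord 0 = ord0) //; apply: val_inj; rewrite /= inordK.
  have : k.+1 \in iota 1 m by rewrite mem_iota /= add1n.
  move=> /h/hasP[p ps /eqP pk]; have /andP[h1 h2] := straight_bound ps.
  apply: connect_trans (IH p.1 _ _) _; rewrite -?pk //; first exact: ltn_trans h2.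
  by apply: connect1; apply/straight_edgesP; exists p.
apply/forall_inP => x _; apply/forall_inP => y _.
apply: connect_trans (_ : connect _ x ord0) _.
  by rewrite sym -(inord_val x); apply: c0.
by rewrite -(inord_val y); apply: c0.
Qed.

Lemma planar_straight (R : realType) : planar_on R finset.setT straight_edges.
Proof.
case/and5P: ok => _ us uc /allP av /allP cr.
pose P (k : nat) : R * R := ((c k).1%:R, (c k).2%:R).
pose seg (p : nat * nat) (t : R) : R * R := P p.1 + t *: (P p.2 - P p.1).
pose g e := seg (nth (0%N, 0%N) s (index e (map nat_edge s))).
have gE p : p \in s -> g (nat_edge p) = seg p.
  move=> ps; rewrite /g; congr seg; apply: nat_edge_inj => //.
    by rewrite mem_nth // -(size_map nat_edge) index_mem map_f.
  by rewrite -(nth_map _ (nat_edge (0%N, 0%N))) ?nth_index ?map_f // -(size_map nat_edge) index_mem map_f.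
pose o (p : nat * nat) (z : R * R) : R := ((P p.2).1 - (P p.1).1) * (z.2 - (P p.1).2)
   - ((P p.2).2 - (P p.1).2) * (z.1 - (P p.1).1).
have oE p k : o p (P k) = (ccw (c p.1) (c p.2) (c k))%:~R.
  by rewrite /o /ccw /P /= !(rmorphB, rmorphM, pmulrn).
have o0 p t : o p (seg p t) = 0 by rewrite /o /seg /= /GRing.scale /=; ring.
have oseg p q t : o p (seg q t) = (1 - t) * o p (P q.1) + t * o p (P q.2).
  by rewrite /o /seg /= /GRing.scale /=; ring.
have injP k k' : (k < m.+1)%N -> (k' < m.+1)%N -> P k = P k' -> k = k'.
  move=> km km' [/eqP]; rewrite eqr_nat => /eqP e1 /eqP; rewrite eqr_nat => /eqP e2.
  have : nth (c 0) (map c (iota 0 m.+1)) k = nth (c 0) (map c (iota 0 m.+1)) k'.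
    by rewrite !(nth_map 0%N) ?size_iota // !nth_iota // !add0n [c k]surjective_pairing e1 e2 -surjective_pairing.
  by move/eqP; rewrite nth_uniq ?size_map ?size_iota // => /eqP.
have ne p : p \in s -> P p.2 - P p.1 != 0.
  move=> /straight_bound/andP[h1 h2]; rewrite subr_eq0; apply/eqP => e.
  by have e1 := injP _ _ h2 (ltn_trans h1 h2) e; rewrite e1 ltnn in h1.
(* The affine function [o p] vanishes on the segment [p]. At the ends of [q] its values have no
   opposite signs and are not both zero, so it has no zero inside [q]. *)
have side p q t : one_side p q -> t \in `]0, 1[ -> o p (seg q t) != 0.
  rewrite in_itv /= => /andP[xy0 xyn] /andP[t0 t1]; rewrite oseg !oE.
  move: xy0 xyn; set x := ccw _ _ _; set y := ccw _ _ _ => xy0 xyn.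
  have h1 : 0 <= x%:~R * y%:~R :> R by rewrite -intrM ler0z.
  have h2 : x%:~R + y%:~R != 0 :> R by rewrite -intrD intr_eq0.
  apply/eqP => eq; have t1' : 0 < 1 - t by lra.
  have sq : 0 <= (1 - t) * (1 - t) * x%:~R ^+ 2 + t * t * y%:~R ^+ 2 by nra.
  have m0 : ((1 - t) * x%:~R + t * y%:~R) ^+ 2 = 0 :> R by rewrite eq expr0n.
  have tt : 0 <= (1 - t) * t by rewrite mulr_ge0 // ltW.
  have h3 := mulr_ge0 tt h1.
  have x2 := sqr_ge0 ((1 - t) * x%:~R : R); have y2 := sqr_ge0 (t * y%:~R : R).
  have X0 : ((1 - t) * x%:~R) ^+ 2 = 0 :> R by rewrite !expr2 in m0 x2 y2 *; nra.
  have Y0 : (t * y%:~R) ^+ 2 = 0 :> R by rewrite !expr2 in m0 x2 y2 *; nra.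
  move/eqP: X0; rewrite sqrf_eq0 mulf_eq0 gt_eqF //= => /eqP x0.
  move/eqP: Y0; rewrite sqrf_eq0 mulf_eq0 gt_eqF //= => /eqP y0.
  by move: h2; rewrite x0 y0 addr0 eqxx.
exists (fun i : 'I_m.+1 => P (val i)), g; split.
- by move=> i j _ _ ij; apply: val_inj; apply: injP ij; apply: ltn_ord.
- move=> e /straight_edgesP[p ps ->]; rewrite gE //; split.
    apply: continuous_subspaceT => t; apply: cvgD; first exact: cvg_cst.
    by apply: cvgZl; exact: cvg_id.
  move=> t t' _ _ /addrI eq; apply/eqP; rewrite -subr_eq0.
  have : (t - t') *: (P p.2 - P p.1) == 0 by rewrite scalerBl eq subrr.
  by rewrite scaler_eq0 (negPf (ne p ps)) orbF.
- move=> e /straight_edgesP[p ps ->]; rewrite gE //; have /andP[h1 h2] := straight_bound ps.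
  exists (inord p.1), (inord p.2); rewrite !inE /seg /= !inordK //; last exact: ltn_trans h2.
  by rewrite scale0r addr0 scale1r addrC subrK.
- move=> e w t /straight_edgesP[p ps ->] _ t01; rewrite gE // => eq.
  have /andP[h1 h2] := straight_bound ps.
  rewrite /= in eq; have /allP/(_ (val w)) := av p ps; rewrite mem_iota /= add0n ltn_ord => /(_ isT).
  move: t01; rewrite in_itv /= => /andP[t0 t1].
  case/or3P => [/eqP wp|/eqP wp|].
  + move/eqP: eq; rewrite wp /seg -subr_eq0 addrAC subrr add0r scaler_eq0 (negPf (ne p ps)) orbF.
    by move/eqP; lra.
  + move/eqP: eq; rewrite wp /seg -subr_eq0.
    have -> : P p.1 + t *: (P p.2 - P p.1) - P p.2 = (t - 1) *: (P p.2 - P p.1).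
      by rewrite scalerBl scale1r opprB addrA addrAC addrC addrA.
    by rewrite scaler_eq0 (negPf (ne p ps)) orbF => /eqP; lra.
  + by rewrite -(intr_eq0 R) -oE -eq o0 eqxx.
- move=> e e' t t' /straight_edgesP[p ps ->] /straight_edgesP[q qs ->] pq t01 t01'.
  rewrite !gE // => eq; have /allP/(_ q qs) := cr p ps.
  case/or3P => [/eqP pq'|/side/(_ t01')|/side/(_ t01)].
  + by rewrite pq' eqxx in pq.
  + by rewrite -eq o0 eqxx.
  + by rewrite eq o0 eqxx.
Qed.

End StraightLine.

Section BaseGraphs.
Variable R : realType.

(* Straight-line drawings with small integer coordinates of the triangle, the 4-cycle,
   the octahedron, the square antiprism, the icosahedron and the hexagonal antiprism
   with both hexagons coned off. *)
Definition triangle_pos := [:: (2, 3); (0, 2); (2, 0)]%N.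
Definition triangle := [:: (0, 1); (0, 2); (1, 2)]%N.
Definition square_pos := [:: (1, 3); (0, 2); (0, 0); (2, 1)]%N.
Definition square := [:: (0, 1); (0, 3); (1, 2); (2, 3)]%N.
Definition octahedron_pos := [:: (3, 0); (4, 3); (0, 2); (2, 1); (3, 1); (2, 2)]%N.
Definition octahedron := [:: (0, 1); (0, 2); (0, 3); (0, 4); (1, 2); (1, 4); (1, 5); (2, 3);
  (2, 5); (3, 4); (3, 5); (4, 5)]%N.
Definition antiprism_pos := [:: (4, 5); (0, 4); (1, 0); (5, 1); (4, 3); (2, 4); (1, 2); (3, 1)]%N.
Definition antiprism := [:: (0, 1); (0, 3); (0, 4); (0, 5); (1, 2); (1, 5); (1, 6); (2, 3);
  (2, 6); (2, 7); (3, 4); (3, 7); (4, 5); (4, 7); (5, 6); (6, 7)]%N.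
Definition icosahedron_pos := [:: (0, 0); (16, 2); (10, 8); (6, 10); (3, 7); (4, 3); (8, 2);
  (11, 4); (9, 7); (5, 6); (5, 15); (7, 4)]%N.
Definition icosahedron := [:: (0, 1); (0, 4); (0, 5); (0, 6); (0, 10); (1, 2); (1, 6); (1, 7);
  (1, 10); (2, 3); (2, 7); (2, 8); (2, 10); (3, 4); (3, 8); (3, 9); (3, 10); (4, 5); (4, 9);
  (4, 10); (5, 6); (5, 9); (5, 11); (6, 7); (6, 11); (7, 8); (7, 11); (8, 9); (8, 11); (9, 11)]%N.
Definition coned_antiprism_pos := [:: (11, 0); (24, 17); (11, 17); (7, 16); (5, 14); (6, 10);
  (10, 8); (15, 10); (15, 15); (10, 15); (8, 14); (8, 12); (0, 18); (11, 12)]%N.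
Definition coned_antiprism := [:: (0, 1); (0, 5); (0, 6); (0, 7); (0, 12); (1, 2); (1, 7);
  (1, 8); (1, 12); (2, 3); (2, 8); (2, 9); (2, 12); (3, 4); (3, 9); (3, 10); (3, 12); (4, 5);
  (4, 10); (4, 11); (4, 12); (5, 6); (5, 11); (5, 12); (6, 7); (6, 11); (6, 13); (7, 8); (7, 13);
  (8, 9); (8, 13); (9, 10); (9, 13); (10, 11); (10, 13); (11, 13)]%N.

(* Every vertex other than 0 has a smaller neighbour, which ensures connectedness. *)
Definition base_check m (c s : seq (nat * nat)) (d : pred nat) : bool :=
  [&& straight_line_check m (nth (0, 0)%N c) s, all (fun i => has (fun p => p.2 == i) s) (iota 1 m)
    & all (fun i => d (count (fun p => (p.1 == i) || (p.2 == i)) s)) (iota 0 m.+1)].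

Lemma base_graph m c s (d : pred nat) : base_check m c s d -> exists E : {set {set 'I_m.+1}},
  [/\ planar_on R finset.setT E, connected_on finset.setT E & forall i, d (degree E i)].
Proof.
move=> /and3P[ok /(connected_straight ok) conn /allP deg].
exists (straight_edges m s); split=> // [|i].
  exact: planar_straight ok R.
by rewrite (degree_straight ok); apply: deg; rewrite mem_iota /= add0n.
Qed.

Lemma triangle_ok : base_check 2 triangle_pos triangle (pred1 2%N).
Proof. by vm_compute. Qed.
Lemma square_ok : base_check 3 square_pos square (pred1 2%N).
Proof. by vm_compute. Qed.
Lemma octahedron_ok : base_check 5 octahedron_pos octahedron (pred1 4%N).
Proof. by vm_compute. Qed.
Lemma antiprism_ok : base_check 7 antiprism_pos antiprism (pred1 4%N).
Proof. by vm_compute. Qed.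
Lemma icosahedron_ok : base_check 11 icosahedron_pos icosahedron (pred1 5%N).
Proof. by vm_compute. Qed.
Lemma coned_antiprism_ok : base_check 13 coned_antiprism_pos coned_antiprism (pred2 5%N 6%N).
Proof. by vm_compute. Qed.

End BaseGraphs.

(** * Connected components *)

Section Classes.
Variables (R : realType) (Q : pred nat).

Definition planar_with_degrees (T : finType) (A : {set T}) (E : {set {set T}}) : bool :=
  `[< planar_on R A E >] && [forall v in A, Q (degree E v)].

Definition connected_planar (T : finType) (A : {set T}) (E : {set {set T}}) : bool :=
  planar_with_degrees A E && connected_on A E.

Definition nb_connected n : nat :=
  #|[set E : {set {set 'I_n}} | connected_planar finset.setT E]%SET|.

Lemma planar_edge_sub (T : finType) (A : {set T}) E e : planar_on R A E -> e \in E -> e \subset A.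
Proof.
move=> pl eE; have [u [v [uA vA _ ->]]] := planar_on_edge pl eE.
by rewrite finset.subUset !finset.sub1set uA vA.
Qed.

Lemma connect_homo (T T' : finType) (f : T -> T') (e : rel T) (e' : rel T') :
  (forall x y, e x y -> connect e' (f x) (f y)) ->
  forall x y, connect e x y -> connect e' (f x) (f y).
Proof.
move=> h x y /connectP[p]; elim: p x => [|z p IH] x /=; first by move=> _ ->.
by move=> /andP[/h xz /IH zy] /zy; apply: connect_trans.
Qed.

Lemma adjacent_sym (T : finType) (E : {set {set T}}) : connect_sym (adjacent E).
Proof. by apply: sym_connect_sym => x y; rewrite /adjacent finset.setUC. Qed.

Section Transfer.
Variables (T T' : finType) (f : T -> T') (A : {set T}).
Hypothesis injf : {in A &, injective f}.

Lemma degree_relabel (E : {set {set T}}) v : (forall e, e \in E -> e \subset A) -> v \in A ->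
  degree (relabel f E) (f v) = degree E v.
Proof.
move=> sub vA; rewrite /degree.
have inj : {in [set e in E | v \in e]%SET &, injective (fun e : {set T} => (f @: e)%SET)}.
  by move=> e e'; rewrite !inE => /andP[eE _] /andP[eE' _]; apply: (imset_inj_on injf); apply: sub.
rewrite -(card_in_imset inj); apply: eq_card => e'; rewrite !inE.
apply/andP/imsetP => [[/imsetP[e eE ->] /imsetP[w we fvw]]|[e]].
  exists e => //; rewrite !inE eE /=.
  by rewrite (injf vA _ fvw) //; apply: (fintype.subsetP (sub e eE)).
by rewrite !inE => /andP[eE ve] ->; rewrite !imset_f.
Qed.

Lemma connected_relabel (E : {set {set T}}) : connected_on A E ->
  connected_on (f @: A)%SET (relabel f E).
Proof.
move=> /forall_inP c; apply/forall_inP => y /imsetP[x xA ->].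
apply/forall_inP => y' /imsetP[x' xA' ->].
have /forall_inP/(_ x' xA') := c x xA; apply: connect_homo => a b ab.
by apply: connect1; rewrite /adjacent -imset_set1 -[[set f b]%SET]imset_set1 -imsetU; apply: imset_f.
Qed.

Lemma connected_planar_relabel (E : {set {set T}}) : connected_planar A E ->
  connected_planar (f @: A)%SET (relabel f E).
Proof.
move=> /andP[/andP[/asboolP pl /forall_inP dg] conn].
rewrite /connected_planar (connected_relabel conn) andbT.
apply/andP; split; first by apply/asboolP; apply: planar_on_relabel.
apply/forall_inP => y /imsetP[x xA ->]; rewrite degree_relabel ?dg // => e.
exact: planar_edge_sub pl.
Qed.

Lemma card_connected_planar_le :
  (#|[set E : {set {set T}} | connected_planar A E]%SET| <=
   #|[set E : {set {set T'}} | connected_planar (f @: A) E]%SET|)%N.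
Proof.
have inj : {in [set E : {set {set T}} | connected_planar A E]%SET &, injective (relabel f)}.
  have sub (E E' : {set {set T}}) : planar_on R A E -> planar_on R A E' ->
      relabel f E = relabel f E' -> E \subset E'.
    move=> pl pl' eq; apply/fintype.subsetP => e eE.
    have : (f @: e)%SET \in relabel f E' by rewrite -eq imset_f.
    move=> /imsetP[e' eE' /(imset_inj_on injf) ->] //.
      exact: planar_edge_sub pl eE.
    exact: planar_edge_sub pl' eE'.
  move=> E E'; rewrite !inE => /andP[/andP[/asboolP pl _] _] /andP[/andP[/asboolP pl' _] _] eq.
  by apply/eqP; rewrite finset.eqEsubset; apply/andP; split; apply: sub.
rewrite -(card_in_imset inj); apply/subset_leq_card/fintype.subsetP => E' /imsetP[E].
by rewrite !inE => /connected_planar_relabel cE ->.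
Qed.

End Transfer.

Lemma exists_bijection (T T' : finType) (A : {set T}) (A' : {set T'}) : #|A| = #|A'| -> A != finset.set0 ->
  exists f : T -> T', {in A &, injective f} /\ (f @: A)%SET = A'.
Proof.
move=> cA /finset.set0Pn[x0 xA0].
have /card_gt0P[y0 yA0] : (0 < #|A'|)%N by rewrite -cA; apply/card_gt0P; exists x0.
pose f x := nth y0 (enum A') (index x (enum A)); exists f.
have lt x : x \in A -> (index x (enum A) < size (enum A'))%N.
  by move=> xA; rewrite -cardE -cA cardE index_mem mem_enum.
have inj : {in A &, injective f}.
  move=> x x' xA xA' /eqP; rewrite /f nth_uniq ?enum_uniq ?lt // => /eqP eq.
  by rewrite -(nth_index x0 (_ : x \in enum A)) ?mem_enum // eq nth_index ?mem_enum.
split=> //; apply/eqP; rewrite finset.eqEcard (card_in_imset inj) cA leqnn andbT.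
by apply/fintype.subsetP => y /imsetP[x xA ->]; rewrite -mem_enum mem_nth ?lt.
Qed.

Lemma card_connected_planar (T : finType) (A : {set T}) : A != finset.set0 ->
  #|[set E : {set {set T}} | connected_planar A E]%SET| = nb_connected #|A|.
Proof.
move=> A0; have cT : #|A| = #|[set: 'I_#|A|]%SET| by rewrite finset.cardsT card_ord.
have T0 : [set: 'I_#|A|]%SET != finset.set0 by rewrite -card_gt0 -cT card_gt0.
have [f [injf imf]] := exists_bijection cT A0.
have [g [injg img]] := exists_bijection (esym cT) T0.
apply/eqP; rewrite eqn_leq /nb_connected; apply/andP; split.
  by rewrite -imf; apply: card_connected_planar_le.
by have := card_connected_planar_le injg; rewrite img.
Qed.

Definition component (T : finType) (E : {set {set T}}) x : {set T} :=
  [set y | connect (adjacent E) x y]%SET.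

Definition edges_within (T : finType) (E : {set {set T}}) (A : {set T}) : {set {set T}} :=
  [set e in E | e \subset A]%SET.

Lemma component_edge (T : finType) (E : {set {set T}}) x u v :
  [set u; v]%SET \in E -> (u \in component E x) = (v \in component E x).
Proof.
move=> uv; rewrite !inE; apply/idP/idP => /connect_trans; apply; last rewrite adjacent_sym;
  exact: connect1.
Qed.

Lemma connect_within (T : finType) (E : {set {set T}}) x y : connect (adjacent E) x y ->
  connect (adjacent (edges_within E (component E x))) x y.
Proof.
move=> /connectP[p]; elim/last_ind: p y => [|p z IH] y /=; first by move=> _ ->.
rewrite rcons_path last_rcons => /andP[hp hz] ->.
have h := IH _ hp erefl; apply: connect_trans h (connect1 _).
have c : last x p \in component E x by rewrite inE; apply/connectP; exists p.
rewrite /adjacent inE; apply/andP; split => //.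
by rewrite finset.subUset !finset.sub1set c -(component_edge _ hz).
Qed.

Lemma connected_component (T : finType) (E : {set {set T}}) x :
  connected_on (component E x) (edges_within E (component E x)).
Proof.
apply/forall_inP => y; rewrite inE => xy; apply/forall_inP => z; rewrite inE => xz.
apply: connect_trans (connect_within xz).
by rewrite adjacent_sym; apply: connect_within.
Qed.

Lemma degree_within (T : finType) (E : {set {set T}}) (A : {set T}) v :
  (forall e, e \in E -> v \in e -> e \subset A) ->
  degree (edges_within E A) v = degree E v.
Proof.
move=> h; apply: eq_card => e; rewrite !inE; apply/andP/andP => [[/andP[-> _] ->]//|[eE ve]].
by rewrite eE ve (h e).
Qed.

Lemma planar_with_degrees_within (T : finType) (A B : {set T}) (E : {set {set T}}) :
  planar_with_degrees A E -> B \subset A ->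
  (forall e v, e \in E -> v \in e -> v \in B -> e \subset B) ->
  planar_with_degrees B (edges_within E B).
Proof.
move=> /andP[/asboolP pl /forall_inP dg] BA cl; apply/andP; split.
  apply/asboolP; apply: (planar_on_sub pl BA).
    by apply/fintype.subsetP => e; rewrite inE => /andP[].
  by move=> e; rewrite inE => /andP[].
apply/forall_inP => v vB; rewrite degree_within; first by apply: dg; apply: (fintype.subsetP BA).
by move=> e eE ve; apply: cl vB.
Qed.

(** Here [K] is the component of [x]. No edge leaves it, so a graph is determined by its parts on
    [K] and on the complement, and degrees are unchanged in both. *)
Lemma card_planar_with_degrees_rec (T : finType) (A : {set T}) x : x \in A ->
  (#|[set E : {set {set T}} | planar_with_degrees A E]%SET| <=
   \sum_(K : {set T} | (K \subset A) && (x \in K))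
     nb_connected #|K| * #|[set E : {set {set T}} | planar_with_degrees (A :\: K) E]%SET|)%N.
Proof.
move=> xA; rewrite -sum1_card.
rewrite (partition_big (fun E => component E x) (fun K => (K \subset A) && (x \in K))); last first.
  move=> E; rewrite inE => /andP[/asboolP pl _]; rewrite inE connect0 andbT.
  apply/fintype.subsetP => y; rewrite inE => /connectP[p].
  elim/last_ind: p y => [|p z IH] y /=; first by move=> _ ->.
  rewrite rcons_path last_rcons => /andP[_ hz] ->.
  by have := planar_edge_sub pl hz; rewrite finset.subUset !finset.sub1set => /andP[].
apply: leq_sum => K /andP[KA xK].
have K0 : K != finset.set0 by apply/finset.set0Pn; exists x.
rewrite -(card_connected_planar K0) -cardsX.
rewrite sum1_card.
pose S : {set {set {set T}}} := [set E | planar_with_degrees A E && (component E x == K)]%SET.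
have -> : #|[pred E | (E \in [set E | planar_with_degrees A E]%SET) && (component E x == K)]| = #|S|.
  by apply: eq_card => E; rewrite !inE.
have cl (E : {set {set T}}) e v : planar_on R A E -> component E x = K -> e \in E -> v \in e ->
    (v \in K -> e \subset K) /\ (v \notin K -> e \subset A :\: K).
  move=> pl cK eE; have [a [b [aA bA ab ee]]] := planar_on_edge pl eE.
  have eab : [set a; b]%SET \in E by rewrite -ee.
  have := component_edge x eab; rewrite cK => hab; rewrite ee !inE finset.subUset !finset.sub1set.
  move=> hv; split=> hK.
    by case/orP: hv hK => /eqP->; rewrite ?hab ?(esym hab) => ->.
  rewrite finset.subUset !finset.sub1set !inE aA bA !andbT.
  by case/orP: hv hK => /eqP->; rewrite -?hab ?hab => ->; rewrite ?hab.
have inj : {in S &, injective (fun E : {set {set T}} => (edges_within E K, edges_within E (A :\: K)))}.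
  have half (E E' : {set {set T}}) : E \in S -> E' \in S ->
     (edges_within E K, edges_within E (A :\: K)) = (edges_within E' K, edges_within E' (A :\: K)) ->
     E \subset E'.
    rewrite !inE => /andP[/andP[/asboolP pl _] /eqP cK] _ [e1 e2].
    apply/fintype.subsetP => e eE; have [a [b [_ _ _ ee]]] := planar_on_edge pl eE.
    have ae : a \in e by rewrite ee !inE eqxx.
    have [c1 c2] := cl E e a pl cK eE ae.
    have [aK|aK] := boolP (a \in K).
      have : e \in edges_within E' K by rewrite -e1 inE eE c1.
      by rewrite inE => /andP[].
    have : e \in edges_within E' (A :\: K) by rewrite -e2 inE eE c2.
    by rewrite inE => /andP[].
  move=> E E' ES ES' eq; apply/eqP; rewrite finset.eqEsubset.
  by rewrite (half _ _ ES ES' eq) (half _ _ ES' ES (esym eq)).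
rewrite -(card_in_imset inj); apply/subset_leq_card/fintype.subsetP => p /imsetP[E].
rewrite inE => /andP[pd /eqP cK] ->; have /andP[/asboolP pl _] := pd.
rewrite !inE /=; apply/andP; split.
  apply/andP; split; last by rewrite -cK; apply: connected_component.
  apply: planar_with_degrees_within pd KA _ => e v eE ve vK.
  by have [h _] := cl E e v pl cK eE ve; apply: h.
apply: planar_with_degrees_within pd _ _; first exact: finset.subsetDl.
move=> e v eE ve; rewrite !inE => /andP[vK _].
by have [_ h] := cl E e v pl cK eE ve; apply: h.
Qed.

Lemma card_planar_with_degrees_crude (T : finType) (A : {set T}) :
  (#|[set E : {set {set T}} | planar_with_degrees A E]%SET| <= 2 ^ (2 ^ #|A|))%N.
Proof.
rewrite -card_powerset -card_powerset; apply/subset_leq_card/fintype.subsetP => E.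
rewrite !inE => /andP[/asboolP pl _]; apply/fintype.subsetP => e eE.
by rewrite inE; apply: planar_edge_sub pl eE.
Qed.

End Classes.

(** * Gluing *)

Section Subdivided.
Variables (R : realType) (T : finType).
Implicit Types (A B X : {set T}) (E F : {set {set T}}) (e : {set T}) (u v w x y : T).

Definition subdivided u v w E : {set {set T}} :=
  ([set u; w] |: ([set v; w] |: E :\ [set u; v]))%SET.

Lemma degree_setU E F x : (forall e, e \in E -> e \in F -> False) ->
  degree (E :|: F)%SET x = (degree E x + degree F x)%N.
Proof.
move=> h; rewrite /degree -[RHS]cardsUI (_ : _ :&: _ = finset.set0)%SET.
  by rewrite cards0 addn0; apply: eq_card => e; rewrite !inE; case: (x \in e); rewrite ?andbT ?andbF.
apply/setP => e; rewrite !inE; apply/negP => /andP[/andP[eE _] /andP[eF _]]; exact: h e eE eF.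
Qed.

Lemma degree_set1 e x : degree [set e]%SET x = (x \in e) :> nat.
Proof.
rewrite /degree; case: (boolP (x \in e)) => xe.
  rewrite (_ : [set e0 in [set e] | x \in e0]%SET = [set e]%SET) ?cards1 //.
  by apply/setP => d; rewrite !inE andb_idr // => /eqP->.
rewrite (_ : [set e0 in [set e] | x \in e0]%SET = finset.set0) ?cards0 //.
by apply/setP => d; rewrite !inE; apply/negP => /andP[/eqP->]; apply/negP.
Qed.

Lemma degree_out E A x : (forall e, e \in E -> e \subset A) -> x \notin A -> degree E x = 0%N.
Proof.
move=> h xA; apply/eqP; rewrite cards_eq0; apply/eqP/setP => e; rewrite !inE.
by apply/negP => /andP[/h /fintype.subsetP eA /eA]; apply/negP.
Qed.

Lemma degree_D1 E e x : e \in E -> degree E x = ((x \in e) + degree (E :\ e)%SET x)%N.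
Proof.
move=> eE; rewrite -{1}(finset.setD1K eE) degree_setU ?degree_set1 // => d.
by rewrite !inE => /eqP->; rewrite eqxx.
Qed.

Section OneEdge.
Variables (A : {set T}) (E : {set {set T}}) (u v w : T).
Hypotheses (pl : planar_on R A E) (uvE : [set u; v]%SET \in E) (wA : w \notin A).

Lemma subdivided_ends : [/\ u \in A, v \in A, u != v, u != w & v != w].
Proof.
have [a [b [aA bA ab e]]] := planar_on_edge pl uvE.
have := planar_edge_sub pl uvE; rewrite finset.subUset !finset.sub1set => /andP[uA vA].
split=> //; try by apply: contraNneq wA => <-.
apply: contraTneq ab => uv; move: (cards2 a b); rewrite -e uv finset.setUid cards1.
by case: (a != b).
Qed.

Lemma subdivided_sub e : e \in subdivided u v w E -> e \subset (w |: A)%SET.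
Proof.
have [uA vA _ _ _] := subdivided_ends.
rewrite !finset.in_setU1 finset.in_setD1 => /or3P[/eqP->|/eqP->|/andP[_ eE]].
- by rewrite finset.subUset !finset.sub1set !inE eqxx uA orbT.
- by rewrite finset.subUset !finset.sub1set !inE eqxx vA orbT.
- exact: fintype.subset_trans (planar_edge_sub pl eE) (finset.subsetUr _ _).
Qed.

Lemma subdivided_meets e : e \in subdivided u v w E -> exists2 a, a \in e & a \in A.
Proof.
have [uA vA _ _ _] := subdivided_ends.
rewrite !finset.in_setU1 finset.in_setD1 => /or3P[/eqP->|/eqP->|/andP[_ eE]].
- by exists u; rewrite ?inE ?eqxx.
- by exists v; rewrite ?inE ?eqxx.
- have [a [b [aA _ _ ->]]] := planar_on_edge pl eE.
  by exists a; rewrite ?inE ?eqxx.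
Qed.

(** The ends [u] and [v] exchange the edge uv for an edge to [w]. *)
Lemma degree_subdivided x : degree (subdivided u v w E) x =
  if x == w then 2%N else degree E x.
Proof.
have [uA vA uv uw vw] := subdivided_ends.
have nE y : [set y; w]%SET \notin E.
  apply: contra wA => /(planar_edge_sub pl).
  by rewrite finset.subUset !finset.sub1set => /andP[].
rewrite /subdivided degree_setU; last first.
  move=> e; rewrite inE => /eqP->; rewrite finset.in_setU1 finset.in_setD1 (negPf (nE u)) andbF orbF.
  move=> /eqP eq; have : u \in [set v; w]%SET by rewrite -eq !inE eqxx.
  by rewrite !inE (negPf uv) (negPf uw).
rewrite degree_setU; last first.
  by move=> e; rewrite inE => /eqP->; rewrite finset.in_setD1 (negPf (nE v)) andbF.
rewrite !degree_set1 !inE; have [->|xw] := eqVneq x w.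
  rewrite (degree_out _ wA) ?orbT // => e; rewrite finset.in_setD1 => /andP[_ eE].
  exact: planar_edge_sub pl eE.
rewrite !orbF (degree_D1 x uvE) !inE addnA; congr addn.
by case: eqVneq => [->|_]; rewrite ?(negPf uv) //; case: eqP.
Qed.

Lemma connected_subdivided : connected_on A E -> connected_on (w |: A)%SET (subdivided u v w E).
Proof.
have [uA vA uv uw vw] := subdivided_ends; set E' := subdivided _ _ _ _.
move=> /forall_inP cA.
have cu : connect (adjacent E') u w by apply: connect1; rewrite /adjacent !inE eqxx.
have cv : connect (adjacent E') v w by apply: connect1; rewrite /adjacent !inE eqxx orbT.
have sub x y : connect (adjacent E) x y -> connect (adjacent E') x y.
  apply: (connect_homo (f := id)) => a b ab.
  have [eq|ne] := eqVneq [set a; b]%SET [set u; v]%SET; last first.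
    by rewrite /adjacent in ab; apply: connect1; rewrite /adjacent !inE ne ab !orbT.
  have abn : a != b by have [_ _] := subdivided_ends; move: (cards2 a b); rewrite eq cards2 uv; case: (a != b).
  have vu : connect (adjacent E') u v by apply: connect_trans cu _; rewrite adjacent_sym.
  by case: (set2_inj eq abn) => -[-> ->] //; rewrite adjacent_sym.
have cw x : x \in (w |: A)%SET -> connect (adjacent E') x w.
  rewrite finset.in_setU1 => /orP[/eqP->//|xA].
  by apply: connect_trans cu; apply: sub; have /forall_inP/(_ u uA) := cA x xA.
apply/forall_inP => x /cw xw; apply/forall_inP => y /cw yw.
by apply: connect_trans xw _; rewrite adjacent_sym.
Qed.

End OneEdge.

Lemma connected_union A B E F x : connected_on A E -> connected_on B F -> x \in A -> x \in B ->
  connected_on (A :|: B)%SET (E :|: F)%SET.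
Proof.
move=> /forall_inP cA /forall_inP cB xA xB.
have sE y z : connect (adjacent E) y z -> connect (adjacent (E :|: F)%SET) y z.
  by apply: (connect_homo (f := id)) => a b; rewrite /adjacent => ab; apply: connect1; rewrite inE ab.
have sF y z : connect (adjacent F) y z -> connect (adjacent (E :|: F)%SET) y z.
  by apply: (connect_homo (f := id)) => a b; rewrite /adjacent => ab; apply: connect1; rewrite inE ab orbT.
have cx y : y \in (A :|: B)%SET -> connect (adjacent (E :|: F)%SET) y x.
  rewrite inE => /orP[yA|yB]; [apply: sE; have /forall_inP := cA y yA|apply: sF; have /forall_inP := cB y yB];
  exact.
apply/forall_inP => y /cx yx; apply/forall_inP => z /cx zx.
by apply: connect_trans yx _; rewrite adjacent_sym.
Qed.

End Subdivided.

(** * Linking graphs and the gluing map *)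

Section Linkers.
Variables (R : realType) (Q : pred nat) (s : nat).

(** A vertex that subdivides an edge receives two new edges, and four when it subdivides both. *)
Definition linked_degree (F : {set {set 'I_s}}) (x1 x2 i : 'I_s) : nat :=
  (degree F i + 2 * (i == x1) + 2 * (i == x2))%N.

(** The vertices [x1] and [x2] themselves subdivide the two edges. The first clause is the planarity
    that gluing asks for: once [f x1] is on the boundary, the linker can be added so that [f x2]
    comes to the boundary. The last clause secures a minimum degree at most 5. *)
Definition linker (F : {set {set 'I_s}}) (x1 x2 : 'I_s) : Prop :=
  [/\ forall (T : finType) (f : 'I_s -> T) (A : {set T}) E, injective f ->
        planar_at R A E (f x1) -> (A :&: f @: finset.setT = [set f x1])%SET ->
        planar_at R (A :|: f @: finset.setT)%SET (E :|: relabel f F)%SET (f x2),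
      planar_on R finset.setT F, connected_on finset.setT F,
      forall i, Q (linked_degree F x1 x2 i)
    & exists i, (linked_degree F x1 x2 i <= 5)%N].

Lemma linker_wedge F x : planar_at R finset.setT F x -> connected_on finset.setT F ->
  (forall i, Q (linked_degree F x x i)) -> (exists i, (linked_degree F x x i <= 5)%N) ->
  linker F x x.
Proof.
move=> pl conn hQ h5; split=> // [T f A E injf pA AX|]; last exact: planar_at_on pl.
apply: planar_at_wedge pA _ AX; apply: planar_at_relabel => //.
by move=> i j _ _; apply: injf.
Qed.

Section Glue.
Variables (T : finType) (f : 'I_s -> T) (F : {set {set 'I_s}}) (x1 x2 : 'I_s).
Variables (A B : {set T}) (E1 E2 : {set {set T}}) (u1 v1 u2 v2 : T).
Let X : {set T} := (f @: finset.setT)%SET.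
Hypotheses (injf : injective f) (lnk : linker F x1 x2).
Hypotheses (AB : forall x, x \in A -> x \notin B) (AX : forall x, x \in A -> x \notin X)
  (BX : forall x, x \in B -> x \notin X) (ABX : forall x, [|| x \in A, x \in B | x \in X]).
Hypotheses (cE1 : connected_planar R Q A E1) (cE2 : connected_planar R Q B E2).
Hypotheses (e1 : [set u1; v1]%SET \in E1) (e2 : [set u2; v2]%SET \in E2).

Definition glue : {set {set T}} := (subdivided u1 v1 (f x1) E1 :|: relabel f F
  :|: subdivided u2 v2 (f x2) E2)%SET.

Let pl1 : planar_on R A E1. Proof. by case/andP: cE1 => /andP[/asboolP]. Qed.
Let pl2 : planar_on R B E2. Proof. by case/andP: cE2 => /andP[/asboolP]. Qed.
Let sub1 e : e \in E1 -> e \subset A. Proof. exact: planar_edge_sub pl1. Qed.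
Let sub2 e : e \in E2 -> e \subset B. Proof. exact: planar_edge_sub pl2. Qed.
Let fX i : f i \in X. Proof. by rewrite imset_f. Qed.
Let x1A : f x1 \notin A. Proof. by apply/negP => /AX; rewrite fX. Qed.
Let x2B : f x2 \notin B. Proof. by apply/negP => /BX; rewrite fX. Qed.

Lemma planar_glue : planar_on R finset.setT glue.
Proof.
have [lpl _ _ _ _] := lnk.
have p1 := planar_at_subdivide pl1 e1 x1A; have p2 := planar_at_subdivide pl2 e2 x2B.
have I1 : ((f x1 |: A) :&: X = [set f x1])%SET.
  apply/setP => y; rewrite !inE; have [->|_] := eqVneq y (f x1); first by rewrite fX.
  by apply/negP => /andP[/AX/negP].
have I2 : ((f x1 |: A :|: X) :&: (f x2 |: B) = [set f x2])%SET.
  apply/setP => y; rewrite !inE; have [->|_] /= := eqVneq y (f x2); first by rewrite fX !orbT.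
  apply/negP => /andP[/orP[/orP[/eqP->|yA]|yX] yB].
  - by have := BX yB; rewrite fX.
  - by have := AB yA; rewrite yB.
  - by have := BX yB; rewrite yX.
have := planar_at_on (planar_at_wedge (lpl T f _ _ injf p1 I1) p2 I2).
suff -> : (f x1 |: A :|: X :|: (f x2 |: B) = finset.setT)%SET by [].
apply/setP => y; rewrite !inE; case/or3P: (ABX y) => ->; rewrite ?orbT //.
Qed.

Lemma relabel_sub e : e \in relabel f F -> e \subset X.
Proof. by move=> /imsetP[d _ ->]; apply: imsetS; apply: finset.subsetT. Qed.

Lemma degree_glue x : degree glue x =
  (degree (subdivided u1 v1 (f x1) E1) x + degree (relabel f F) x
   + degree (subdivided u2 v2 (f x2) E2) x)%N.
Proof.
rewrite /glue degree_setU.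
  rewrite degree_setU // => e /(subdivided_meets pl1 e1 x1A)[a ae /AX aX] /relabel_sub.
  by move=> /fintype.subsetP/(_ a ae); apply/negP.
move=> e + /(subdivided_meets pl2 e2 x2B)[a ae aB].
rewrite inE => /orP[/(subdivided_sub pl1 e1 x1A)|/relabel_sub] /fintype.subsetP/(_ a ae).
  rewrite finset.in_setU1 => /orP[/eqP ax|/AB]; last by rewrite aB.
  by have := BX aB; rewrite ax fX.
by move=> aX; have := BX aB; rewrite aX.
Qed.

Lemma degree_glue_linker i : degree glue (f i) = linked_degree F x1 x2 i.
Proof.
have fA : f i \notin A by apply/negP => /AX; rewrite fX.
have fB : f i \notin B by apply/negP => /BX; rewrite fX.
rewrite degree_glue (degree_subdivided pl1 e1 x1A) (degree_subdivided pl2 e2 x2B).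
rewrite (degree_out sub1 fA) (degree_out sub2 fB).
have hs e : e \in F -> e \subset finset.setT by move=> _; apply: finset.subsetT.
have hi : {in finset.setT &, injective f} by move=> a b _ _; apply: injf.
rewrite (degree_relabel hi hs (finset.in_setT i)).
rewrite !(inj_eq injf) /linked_degree; move: (degree F i) => z.
by case: (i == x1); case: (i == x2); rewrite /= ?add0n ?muln0 ?muln1 ?addn0 // ?[(2 + z)%N]addnC.
Qed.

Lemma degree_glue1 x : x \in A -> degree glue x = degree E1 x.
Proof.
move=> xA; rewrite degree_glue (degree_subdivided pl1 e1 x1A) (degree_subdivided pl2 e2 x2B).
have ne i : x != f i by apply: contraNneq (AX xA) => ->.
rewrite !(negPf (ne _)) (degree_out relabel_sub (AX xA)).
by rewrite (degree_out sub2 (AB xA)) !addn0.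
Qed.

Lemma degree_glue2 x : x \in B -> degree glue x = degree E2 x.
Proof.
move=> xB; rewrite degree_glue (degree_subdivided pl1 e1 x1A) (degree_subdivided pl2 e2 x2B).
have ne i : x != f i by apply: contraNneq (BX xB) => ->.
have xA : x \notin A by apply/negP => /AB; rewrite xB.
by rewrite !(negPf (ne _)) (degree_out relabel_sub (BX xB)) (degree_out sub1 xA).
Qed.

Lemma connected_planar_glue : connected_planar R Q finset.setT glue /\
  exists x, (degree glue x <= 5)%N.
Proof.
have [_ _ lc lQ [i5 hi5]] := lnk.
split; last by exists (f i5); rewrite degree_glue_linker.
have /andP[/andP[_ /forall_inP d1] c1] := cE1.
have /andP[/andP[_ /forall_inP d2] c2] := cE2.
apply/andP; split; first (apply/andP; split).
- by apply/asboolP; apply: planar_glue.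
- apply/forall_inP => x _; case/or3P: (ABX x) => [xA|xB|/imsetP[i _ ->]].
  + by rewrite degree_glue1 // d1.
  + by rewrite degree_glue2 // d2.
  + by rewrite degree_glue_linker.
have c1' := connected_subdivided pl1 e1 x1A c1.
have c2' := connected_subdivided pl2 e2 x2B c2.
have c3 := connected_union c1' (connected_relabel f lc) (x := f x1).
have m1 : f x1 \in (f x1 |: A)%SET by rewrite !inE eqxx.
have m2 : f x2 \in (f x2 |: B)%SET by rewrite !inE eqxx.
have m3 : f x2 \in (f x1 |: A :|: X)%SET by rewrite finset.in_setU fX orbT.
have := connected_union (c3 m1 (fX x1)) c2' m3 m2.
suff -> : (f x1 |: A :|: X :|: (f x2 |: B) = finset.setT)%SET by [].
by apply/setP => y; rewrite !inE; case/or3P: (ABX y) => ->; rewrite ?orbT.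
Qed.

(** Every edge that gluing adds touches the linker, so deleting those and restoring the two
    subdivided edges returns the union. The next lemmas separate its two parts. *)
Lemma glue_unglue : (E1 :|: E2 = [set e in glue | [forall x in e, x \notin X]]
  :|: [set [set u1; v1]; [set u2; v2]])%SET.
Proof.
have out1 e : e \in E1 -> [forall x in e, x \notin X].
  move=> /(planar_edge_sub pl1)/fintype.subsetP h; apply/forall_inP => x /h; exact: AX.
have out2 e : e \in E2 -> [forall x in e, x \notin X].
  move=> /(planar_edge_sub pl2)/fintype.subsetP h; apply/forall_inP => x /h; exact: BX.
apply/setP => e; rewrite !inE; apply/idP/idP => [/orP[eE|eE]|].
- by rewrite eE (out1 e eE); case: (e == [set u1; v1]%SET); rewrite /= ?orbT.
- by rewrite eE (out2 e eE); case: (e == [set u2; v2]%SET); rewrite /= ?orbT.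
have bad i y : ~~ [forall x in [set y; f i]%SET, x \notin X].
  by apply/negP => /forall_inP/(_ (f i)); rewrite !inE eqxx orbT fX => /(_ isT).
case/orP => [/andP[h out]|/orP[/eqP->|/eqP->]]; rewrite ?e1 ?e2 ?orbT //.
case/orP: h => [/orP[|eF]|].
- case/or3P => [/eqP ee|/eqP ee|/andP[_ ->]//]; by move: out; rewrite ee (negPf (bad _ _)).
- have [_ plF _ _ _] := lnk; case/imsetP: eF out => d dF ->.
  have [a [b [_ _ _ ->]]] := planar_on_edge plF dF.
  by move=> /forall_inP/(_ (f a)); rewrite imset_f ?inE ?eqxx // fX => /(_ isT).
- case/or3P => [/eqP ee|/eqP ee|/andP[_ ->]]; rewrite ?orbT //; by move: out; rewrite ee (negPf (bad _ _)).
Qed.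

Lemma unglue_component : A = component (E1 :|: E2)%SET u1.
Proof.
have u1A : u1 \in A.
  by have := planar_edge_sub pl1 e1; rewrite finset.subUset !finset.sub1set => /andP[].
have /andP[_ /forall_inP c1] := cE1.
apply/eqP; rewrite finset.eqEsubset; apply/andP; split; apply/fintype.subsetP => y.
  move=> yA; rewrite inE; have /forall_inP/(_ y yA) := c1 u1 u1A.
  by apply: (connect_homo (f := id)) => a b; rewrite /adjacent => ab; apply: connect1; rewrite inE ab.
rewrite inE => /connectP[p]; elim/last_ind: p y => [|p z IH] y /=; first by move=> _ ->.
rewrite rcons_path last_rcons => /andP[hp hz] ->.
have lA := IH _ hp erefl; move: hz; rewrite /adjacent inE => /orP[/(planar_edge_sub pl1)|/(planar_edge_sub pl2)];
  rewrite finset.subUset !finset.sub1set => /andP[h1 h2] //.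
by have := AB lA; rewrite h1.
Qed.

Lemma unglue1 : E1 = edges_within (E1 :|: E2)%SET A.
Proof.
apply/setP => e; rewrite !inE; apply/idP/andP => [eE|[/orP[//|eE] eA]].
  by rewrite eE (planar_edge_sub pl1 eE).
have [a [b [aB _ _ ee]]] := planar_on_edge pl2 eE.
have aA : a \in A by apply: (fintype.subsetP eA); rewrite ee !inE eqxx.
by have := AB aA; rewrite aB.
Qed.

Lemma unglue2 : E2 = ((E1 :|: E2) :\: E1)%SET.
Proof.
apply/setP => e; rewrite !inE; apply/idP/andP => [eE|[/negPf-> //]].
rewrite eE orbT; split=> //; apply/negP => eE'.
have [a [b [aB _ _ ee]]] := planar_on_edge pl2 eE.
have aA : a \in A by apply: (fintype.subsetP (planar_edge_sub pl1 eE')); rewrite ee !inE eqxx.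
by have := AB aA; rewrite aB.
Qed.

End Glue.

Definition nb_connected5 n : nat := #|[set E : {set {set 'I_n}} |
  connected_planar R Q finset.setT E && [exists v, (degree E v <= 5)%N]]%SET|.

Lemma card_disjoint_pairs n a b :
  #|[set p : {set 'I_n} * {set 'I_n} | [&& #|p.1| == a, #|p.2| == b & p.2 \subset ~: p.1]]%SET|
  = ('C(n, a) * 'C(n - a, b))%N.
Proof.
rewrite -sum1_card (partition_big fst (fun A : {set 'I_n} => #|A| == a)) /=; last first.
  by move=> p; rewrite inE => /and3P[].
rewrite (eq_bigr (fun=> 'C(n - a, b))).
  rewrite sum_nat_const; congr muln.
  rewrite -[in RHS](card_ord n) -finset.cardsT -cards_draws -finset.cardsE.
  by apply: eq_card => A; rewrite !inE finset.subsetT.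
move=> A /eqP cA; have -> : (n - a)%N = #|(~: A)%SET| by rewrite cardsCs finset.setCK cA card_ord.
rewrite -cards_draws sum1_card.
have inj : {in [set B : {set 'I_n} | B \subset ~: A & #|B| == b]%SET &, injective (fun B => (A, B))}.
  by move=> B B' _ _ [].
rewrite -(card_in_imset inj); apply: eq_card => -[A' B].
rewrite [LHS](_ : _ = [&& #|A'| == a, #|B| == b & B \subset ~: A'] && (A' == A))%SET; last first.
  by rewrite unfold_in /= inE.
apply/andP/imsetP => [[/and3P[h1 h2 h3] /eqP AA]|[B']].
  by exists B; rewrite ?inE -AA ?h2 ?h3.
by rewrite inE => /andP[h1 h2] [-> ->]; rewrite eqxx cA h1 h2 eqxx.
Qed.

Lemma connected_planar_has_edge (T : finType) (A : {set T}) E : connected_planar R Q A E ->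
  (1 < #|A|)%N -> exists u v, [set u; v]%SET \in E.
Proof.
move=> /andP[_ /forall_inP c] /card_gt1P[x [y [xA yA xy]]].
have /forall_inP/(_ y yA) := c x xA; move=> /connectP[[|z p]] /=.
  by move=> _ yx; rewrite yx eqxx in xy.
by move=> /andP[xz _] _; exists x, z.
Qed.

(** The two graphs and their vertex sets are decoded from the glued graph, the placement of the
    linker ([n ^ s] choices) and the ends of the two subdivided edges ([n ^ 4] choices). *)
Lemma card_glue F x1 x2 a b n : linker F x1 x2 -> (1 < a)%N -> (1 < b)%N -> n = (a + b + s)%N ->
  ('C(n, a) * 'C(n - a, b) * (nb_connected R Q a * nb_connected R Q b) <=
   nb_connected5 n * n ^ (s + 4))%N.
Proof.
move=> lnk a1 b1 nE; have n0 : (0 < n)%N by lia.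
pose x0 : 'I_n := Ordinal n0.
pose pairs := [set p : {set 'I_n} * {set 'I_n} | [&& #|p.1| == a, #|p.2| == b & p.2 \subset ~: p.1]]%SET.
pose D := [set q : ({set 'I_n} * {set 'I_n}) * ({set {set 'I_n}} * {set {set 'I_n}}) |
  [&& q.1 \in pairs, connected_planar R Q q.1.1 q.2.1 & connected_planar R Q q.1.2 q.2.2]]%SET.
have cD : #|D| = ('C(n, a) * 'C(n - a, b) * (nb_connected R Q a * nb_connected R Q b))%N.
  rewrite -card_disjoint_pairs -/pairs -sum1_card (partition_big fst (mem pairs)) /=; last first.
    by move=> q; rewrite inE => /and3P[].
  rewrite -sum_nat_const; apply: eq_bigr => -[A B] ABp; rewrite sum1_card.
  have := ABp; rewrite inE /= => /and3P[/eqP cA /eqP cB _].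
  have A0 : A != finset.set0 by rewrite -card_gt0 cA ltnW.
  have B0 : B != finset.set0 by rewrite -card_gt0 cB ltnW.
  rewrite -cA -cB -(card_connected_planar R Q A0) -(card_connected_planar R Q B0) -cardsX.
  have inj : injective (fun E : {set {set 'I_n}} * {set {set 'I_n}} => ((A, B), E)) by move=> E E' [].
  rewrite -(card_imset _ inj); apply: eq_card => -[[A' B'] [E1 E2]].
  rewrite [LHS](_ : _ = [&& (A', B') \in pairs, connected_planar R Q A' E1 & connected_planar R Q B' E2]
    && ((A', B') == (A, B))); last by rewrite unfold_in /= [in LHS]inE.
  apply/idP/imsetP => [/andP[/and3P[_ h2 h3] /eqP[AA BB]]|[[E1' E2']]].
    by exists (E1, E2); rewrite ?AA ?BB // finset.in_setX !inE /= -AA -BB h2.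
  by rewrite finset.in_setX !inE => /andP[h1 h2] [-> -> -> ->]; move: ABp; rewrite inE => ->; rewrite h1 h2 eqxx.
(* The default is never reached, since a connected graph on at least two vertices has an edge. *)
pose pick_edge (E : {set {set 'I_n}}) := odflt (x0, x0) [pick p : 'I_n * 'I_n | [set p.1; p.2]%SET \in E].
have pickP E A : connected_planar R Q A E -> (1 < #|A|)%N -> [set (pick_edge E).1; (pick_edge E).2]%SET \in E.
  move=> cE A1; rewrite /pick_edge; case: pickP => [//|none].
  by have [u [v uv]] := connected_planar_has_edge cE A1; have := none (u, v); rewrite uv.
(* The linker is placed on the complement of the two vertex sets, which has exactly [s] elements. *)
pose emb (A B : {set 'I_n}) : {ffun 'I_s -> 'I_n} := [ffun i => nth x0 (enum (~: (A :|: B))%SET) (val i)].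
pose code (q : ({set 'I_n} * {set 'I_n}) * ({set {set 'I_n}} * {set {set 'I_n}})) :=
  (glue (emb q.1.1 q.1.2) F x1 x2 q.2.1 q.2.2 (pick_edge q.2.1).1 (pick_edge q.2.1).2
     (pick_edge q.2.2).1 (pick_edge q.2.2).2,
   (emb q.1.1 q.1.2, (pick_edge q.2.1, pick_edge q.2.2))).
have facts q : q \in D -> [/\ injective (emb q.1.1 q.1.2),
   (forall x, x \in q.1.1 -> x \notin q.1.2) ,
   (forall x, x \in q.1.1 -> x \notin (emb q.1.1 q.1.2 @: finset.setT)%SET),
   (forall x, x \in q.1.2 -> x \notin (emb q.1.1 q.1.2 @: finset.setT)%SET) &
   (forall x, [|| x \in q.1.1, x \in q.1.2 | x \in (emb q.1.1 q.1.2 @: finset.setT)%SET])].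
  case: q => -[A B] [E1 E2]; rewrite !inE /= => /and3P[/and3P[/eqP cA /eqP cB BA] _ _].
  have AB x : x \in A -> x \notin B.
    by apply: contraL => /(fintype.subsetP BA); rewrite inE.
  have cC : #|(~: (A :|: B))%SET| = s.
    rewrite cardsCs finset.setCK card_ord cardsU (_ : (A :&: B)%SET = finset.set0) ?cards0 ?cA ?cB.
      by rewrite nE; lia.
    by apply/setP => x; rewrite !inE; apply/negP => /andP[/AB/negP].
  have lt (i : 'I_s) : (val i < size (enum (~: (A :|: B))%SET))%N by rewrite -cardE cC ltn_ord.
  have ei : injective (emb A B).
    move=> i i'; rewrite !ffunE => /eqP; rewrite nth_uniq ?enum_uniq ?lt // => /eqP.
    exact: val_inj.
  have im : (emb A B @: finset.setT = ~: (A :|: B))%SET.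
    apply/eqP; rewrite finset.eqEcard (card_imset _ ei) finset.cardsT card_ord cC leqnn andbT.
    by apply/fintype.subsetP => y /imsetP[i _ ->]; rewrite ffunE -mem_enum mem_nth.
  rewrite im; split=> // x; rewrite !inE negb_or.
  - by move=> ->.
  - by move=> ->; rewrite andbF.
  - by case: (x \in A); case: (x \in B).
have facts' q : q \in D -> [/\ connected_planar R Q q.1.1 q.2.1, connected_planar R Q q.1.2 q.2.2,
  [set (pick_edge q.2.1).1; (pick_edge q.2.1).2]%SET \in q.2.1 &
  [set (pick_edge q.2.2).1; (pick_edge q.2.2).2]%SET \in q.2.2].
  by rewrite !inE => /and3P[/and3P[/eqP cA /eqP cB _] c1 c2]; split; rewrite ?(pickP _ _ c1) ?(pickP _ _ c2) ?cA ?cB.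
have inj : {in D &, injective code}.
  move=> [[A B] [E1 E2]] [[A' B'] [E1' E2']] qD qD' [eg ee ep1 ep2].
  have [/= i1 AB AX BX ABX] := facts _ qD; have [/= i1' AB' AX' BX' ABX'] := facts _ qD'.
  have [/= c1 c2 p1 p2] := facts' _ qD; have [/= c1' c2' p1' p2'] := facts' _ qD'.
  have U := glue_unglue lnk AX BX c1 c2 p1 p2.
  have U' := glue_unglue lnk AX' BX' c1' c2' p1' p2'.
  have EU : (E1 :|: E2 = E1' :|: E2')%SET by rewrite U U' eg ee ep1 ep2.
  have AA : A = A'.
    rewrite (unglue_component AB c1 c2 p1) (unglue_component AB' c1' c2' p1').
    by rewrite EU ep1.
  have EE1 : E1 = E1' by rewrite (unglue1 AB c1 c2) (unglue1 AB' c1' c2') EU AA.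
  have EE2 : E2 = E2' by rewrite (unglue2 AB c1 c2) (unglue2 AB' c1' c2') EU EE1.
  have BB : B = B'.
    have co (C C' : {set 'I_n}) (g : 'I_s -> 'I_n) : (forall x, x \in C -> x \notin C') ->
      (forall x, x \in C' -> x \notin (g @: finset.setT)%SET) ->
      (forall x, [|| x \in C, x \in C' | x \in (g @: finset.setT)%SET]) ->
      C' = (~: (C :|: g @: finset.setT))%SET.
      move=> h1 h2 h3; apply/setP => x; rewrite finset.in_setC finset.in_setU negb_or.
      have := h3 x; have := h1 x; have := h2 x.
      case: (x \in C); case: (x \in C'); case: (x \in (g @: finset.setT)%SET) => //= h h' _;
        by [have := h isT|have := h' isT].
    by rewrite (co _ _ _ AB BX ABX) (co _ _ _ AB' BX' ABX') ee AA.
  by rewrite AA BB EE1 EE2.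
rewrite -cD -(card_in_imset inj).
set G := [set E : {set {set 'I_n}} | connected_planar R Q finset.setT E && [exists v, (degree E v <= 5)%N]]%SET.
have -> : (nb_connected5 n * n ^ (s + 4) = #|finset.setX G [set: {ffun 'I_s -> 'I_n} * (('I_n * 'I_n) * ('I_n * 'I_n))]%SET|)%N.
  rewrite cardsX finset.cardsT !card_prod card_ffun !card_ord; congr muln.
  by rewrite expnD; congr muln; rewrite !expnS expn0 muln1 !mulnA.
apply/subset_leq_card/fintype.subsetP => t /imsetP[q qD ->].
have [i1 AB AX BX ABX] := facts q qD; have [c1 c2 p1 p2] := facts' q qD.
have [cg [x dx]] := connected_planar_glue i1 lnk AB AX BX ABX c1 c2 p1 p2.
by rewrite !inE /= andbT cg; apply/existsP; exists x.
Qed.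

End Linkers.

(** * The linking graphs and the base graphs *)

Section Point.
Variables (R : realType) (T : finType).

Lemma planar_at_point (w : T) : planar_at R [set w]%SET finset.set0 w.
Proof.
exists (fun=> 0), (fun _ _ => 0); split; rewrite ?inE //.
  split; try by move=> e; rewrite inE.
  by move=> x y; rewrite !inE => /eqP-> /eqP->.
by move=> z [[x _ ->]|[e [t [+ _ _]]]]; [left|rewrite inE].
Qed.

Lemma connected_point (w : T) E : connected_on [set w]%SET E.
Proof.
by apply/forall_inP => x; rewrite inE => /eqP->; apply/forall_inP => y; rewrite inE => /eqP->.
Qed.

End Point.

Section Examples.
Variables (R : realType) (Q : pred nat).

Lemma linker_point : Q 4%N -> linker R Q finset.set0 (ord0 : 'I_1) ord0.
Proof.
move=> Q4; have dg i : linked_degree finset.set0 (ord0 : 'I_1) ord0 i = 4%N.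
  rewrite /linked_degree (degree_out (A := finset.set0)) ?inE // ?ord1 ?eqxx // => e.
  by rewrite inE.
have T1 : [set: 'I_1]%SET = [set ord0]%SET by apply/setP => i; rewrite !inE (ord1 i) eqxx.
apply: linker_wedge; rewrite ?T1.
- exact: planar_at_point.
- exact: connected_point.
- by move=> i; rewrite dg.
- by exists ord0; rewrite dg.
Qed.

Lemma linker_edge : Q 3%N -> linker R Q [set [set ord0; ord_max]]%SET (ord0 : 'I_2) ord_max.
Proof.
move=> Q3.
have o2 (i : 'I_2) : (i == ord0) || (i == ord_max).
  by case: i => [[|[|]]].
have T2 : [set: 'I_2]%SET = [set ord0; ord_max]%SET by apply/setP => i; rewrite !inE o2.
have dg i : linked_degree [set [set ord0; ord_max]]%SET (ord0 : 'I_2) ord_max i = 3%N.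
  by rewrite /linked_degree degree_set1 !inE; case/orP: (o2 i) => /eqP->.
have at2 (T : finType) (f : 'I_2 -> T) (A : {set T}) E : injective f ->
    planar_at R A E (f ord0) -> (A :&: f @: finset.setT = [set f ord0])%SET ->
    planar_at R (A :|: f @: finset.setT)%SET
      (E :|: relabel f [set [set ord0; ord_max]])%SET (f ord_max).
  move=> injf pA AX; have fA : f ord_max \notin A.
    apply/negP => fA; have : f ord_max \in (A :&: f @: finset.setT)%SET by rewrite inE fA imset_f.
    by rewrite AX inE (inj_eq injf).
  have f0 : f ord0 \in A.
    have : f ord0 \in (A :&: f @: finset.setT)%SET by rewrite AX inE.
    by rewrite inE => /andP[].
  have := planar_at_pendant pA fA.
  suff [-> ->] : (A :|: f @: finset.setT)%SET = (f ord_max |: A)%SET /\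
     (E :|: relabel f [set [set ord0; ord_max]])%SET = ([set f ord_max; f ord0] |: E)%SET by [].
  split; first by rewrite T2 imsetU !imset_set1; apply/setP => x; rewrite !inE;
    case: eqVneq => [->|_]; rewrite ?f0 ?orbT //= orbC.
  by rewrite /relabel imset_set1 imsetU !imset_set1 finset.setUC [in RHS](finset.setUC [set f ord_max])%SET.
have conn : connected_on [set: 'I_2]%SET [set [set ord0; ord_max]]%SET.
  apply/forall_inP => i _; apply/forall_inP => j _.
  have e : connect (adjacent [set [set (ord0 : 'I_2); ord_max]]%SET) ord0 ord_max.
    by apply: connect1; rewrite /adjacent inE.
  case/orP: (o2 i) => /eqP->; case/orP: (o2 j) => /eqP->; rewrite ?connect0 //.
  by rewrite adjacent_sym.
split=> //.
- have := at2 _ id _ _ (@inj_id _) (planar_at_point R ord0).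
  rewrite imset_id finset.setIT finset.setUT finset.set0U => /(_ erefl)/planar_at_on.
  rewrite /relabel imset_set1; have -> // : ([set id x | x in [set ord0; ord_max]] = [set ord0; ord_max] :> {set 'I_2})%SET.
  exact: imset_id.
- by move=> i; rewrite dg.
- by exists ord0; rewrite dg.
Qed.

(* The icosahedron with a vertex [ord_max] inserted in one of its edges. *)
Lemma linker_icosahedron : Q 5%N -> Q 6%N -> exists F x, @linker R Q 13 F x x.
Proof.
move=> Q5 Q6; have [E [pl conn dg]] := base_graph R icosahedron_ok.
pose f : 'I_12 -> 'I_13 := lift ord_max; pose w : 'I_13 := ord_max.
have injf : {in [set: 'I_12]%SET &, injective f} by move=> i j _ _; apply: lift_inj.
have wf i : f i != w by rewrite eq_sym neq_lift.
have wA : w \notin (f @: finset.setT)%SET.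
  by apply/negP => /imsetP[i _ wi]; have := wf i; rewrite -wi eqxx.
have wT : (w |: f @: finset.setT = finset.setT)%SET.
  apply/setP => i; rewrite !inE; case: (unliftP w i) => [j|] ->; last by rewrite eqxx.
  by rewrite [_ \in _]imset_f ?orbT.
have [u [v uv]] : exists u v : 'I_12, [set u; v]%SET \in E.
  have : (0 < degree E ord0)%N by rewrite (eqP (dg ord0)).
  case/card_gt0P => e; rewrite inE => /andP[eE _].
  by have [u [v [_ _ _ ee]]] := planar_on_edge pl eE; exists u, v; rewrite -ee.
have plf := planar_on_relabel injf pl.
have uvf : [set f u; f v]%SET \in relabel f E by rewrite -!imset_set1 -imsetU imset_f.
have dgw i : degree (subdivided (f u) (f v) w (relabel f E)) i = if i == w then 2%N else 5%N.
  rewrite (degree_subdivided plf uvf wA); case: eqVneq => // iw.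
  have [j ->|iE] := unliftP w i; last by rewrite iE eqxx in iw.
  rewrite (degree_relabel injf) ?finset.in_setT // ?(eqP (dg j)) // => e _; exact: finset.subsetT.
exists (subdivided (f u) (f v) w (relabel f E)), w; apply: linker_wedge.
- by have := planar_at_subdivide plf uvf wA; rewrite wT.
- by have := connected_subdivided plf uvf wA (connected_relabel f conn); rewrite wT.
- by move=> i; rewrite /linked_degree dgw; case: (i == w).
- by exists (f ord0); rewrite /linked_degree dgw (negPf (wf _)).
Qed.

Lemma nb_connected_gt0 m c s d : base_check m c s d -> (forall k, d k -> Q k) ->
  (0 < nb_connected R Q m.+1)%N.
Proof.
move=> ok dQ; have [E [pl conn dg]] := base_graph R ok.
apply/card_gt0P; exists E; rewrite inE /connected_planar conn andbT.
by apply/andP; split; [apply/asboolP|apply/forall_inP => i _; apply: dQ].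
Qed.

Definition linker_size d1 : nat := (if d1 <= 2 then 2 else if d1 <= 4 then 1 else 13)%N.

(** The vertices added have degree 3, 4, or 5 and 6 in the three ranges of [d1]; excluding (3, 3)
    and (5, 5) makes these degrees legal. The base graphs have sizes 3 and 4, 6 and 8, 12 and 14;
    adding the linker size gives the coprime pairs 5 and 6, 7 and 9, 25 and 27. *)
Lemma linkable d1 D : (d1 <= 5)%N -> (3 <= D)%N -> (d1 <= D)%N ->
  (d1, D) != (3, 3)%N -> (d1, D) != (5, 5)%N -> (forall k, (d1 <= k <= D)%N -> Q k) ->
  (exists F x1 x2, @linker R Q (linker_size d1) F x1 x2) /\
  exists p q, [/\ (1 < p)%N, (1 < q)%N, coprime (p + linker_size d1) (q + linker_size d1),
    (0 < nb_connected R Q p)%N & (0 < nb_connected R Q q)%N].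
Proof.
move=> d5 D3 dD n3 n5 hQ; rewrite /linker_size; case: leqP => d2.
  have Q2 : Q 2%N by apply: hQ; rewrite d2 ltnW.
  have Q3 : Q 3%N by apply: hQ; rewrite D3 ltnW.
  split; first by do 3 eexists; apply: linker_edge.
  exists 3%N, 4%N; split=> //; first by apply: (nb_connected_gt0 triangle_ok) => k /eqP->.
  by apply: (nb_connected_gt0 square_ok) => k /eqP->.
case: leqP => d4.
  have Q4 : Q 4%N.
    apply: hQ; rewrite d4; move: d2 d4 D3 dD n3; case: (ltnP 3 D) => // D4 d2 d4 D3 dD.
    have -> : d1 = 3%N by lia.
    have -> : D = 3%N by lia.
    by rewrite eqxx.
  split; first by do 3 eexists; apply: linker_point.
  exists 6%N, 8%N; split=> //; first by apply: (nb_connected_gt0 octahedron_ok) => k /eqP->.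
  by apply: (nb_connected_gt0 antiprism_ok) => k /eqP->.
have dE : d1 = 5%N by lia.
have D6 : (5 < D)%N.
  by rewrite ltn_neqAle -{2}dE dD andbT; apply: contraNneq n5 => <-; rewrite dE.
have Q5 : Q 5%N by apply: hQ; rewrite dE leqnn; apply: ltnW.
have Q6 : Q 6%N by apply: hQ; rewrite dE.
split; first by have [F [x l]] := linker_icosahedron Q5 Q6; exists F, x, x.
exists 12%N, 14%N; split=> //; first by apply: (nb_connected_gt0 icosahedron_ok) => k /eqP->.
by apply: (nb_connected_gt0 coned_antiprism_ok) => k /orP[] /eqP->.
Qed.

End Examples.

(** * Growth rates *)

Section Growth.
Variable R : realType.
Implicit Types (h : nat -> R) (t x y : R) (K m n p q : nat).

Lemma ler_bernoulli (u : R) n : 0 <= u -> 1 + n%:R * u <= (1 + u) ^+ n.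
Proof.
move=> u0; elim: n => [|n IH]; first by rewrite expr0 mul0r addr0.
rewrite exprS; apply: le_trans (_ : (1 + u) * (1 + n%:R * u) <= _); last first.
  by rewrite ler_pM2l // ltr_wpDr.
have : 0 <= n%:R * (u * u) by rewrite mulr_ge0 // mulr_ge0.
rewrite -natr1 => h; nra.
Qed.

(** With t = r ^ 2, one factor r ^ n absorbs the power [K] by induction, the other absorbs one more
    factor n + 1 by Bernoulli's inequality. *)
Lemma poly_le_expo t K : 1 < t -> exists2 C, 0 < C & forall n, n.+1%:R ^+ K <= C * t ^+ n.
Proof.
elim: K t => [|K IH] t t1.
  by exists 1 => // n; rewrite expr0 mul1r exprn_ege1 // ltW.
pose r := Num.sqrt t; have t0 : 0 < t by exact: lt_trans t1.
have r1 : 1 < r by rewrite -sqrtr1 ltr_sqrt.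
have [C C0 hC] := IH r r1.
have rt n : t ^+ n = r ^+ n * r ^+ n by rewrite -exprMn -expr2 sqr_sqrtr // ltW.
have d0 : 0 < r - 1 by rewrite subr_gt0.
exists (C * (1 + (r - 1)^-1)); first by rewrite mulr_gt0 // addr_gt0 // invr_gt0.
move=> n; rewrite exprSr rt mulrACA; apply: ler_pM => //.
have rn1 : 1 <= r ^+ n by rewrite exprn_ege1 // ltW.
have := ler_bernoulli n (ltW d0); have -> : 1 + (r - 1) = r by rewrite addrC subrK.
move=> hb.
have hn : n%:R <= (r - 1)^-1 * r ^+ n.
  by rewrite ler_pdivlMl // mulrC; apply: le_trans hb; rewrite lerDr.
by rewrite -natr1 mulrDl mul1r addrC lerD.
Qed.

Lemma expo_large t M : 1 < t -> \forall n \near \oo, M <= t ^+ n.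
Proof.
move=> t1; have [C C0 hC] := poly_le_expo 1 t1; near=> n.
rewrite -(ler_pM2l C0); apply: le_trans (hC n); rewrite expr1.
apply: le_trans (_ : n%:R <= _); last by rewrite ler_nat.
by near: n; apply: nbhs_infty_ger.
Unshelve. all: by end_near. Qed.

Lemma root_ge x y n : (0 < n)%N -> 0 <= x -> x ^+ n <= y -> x <= y `^ n%:R^-1.
Proof.
move=> n0 x0 xy; have nn : n%:R != 0 :> R by rewrite pnatr_eq0 -lt0n.
have -> : x = (x ^+ n) `^ n%:R^-1 by rewrite -powR_mulrn // -powRrM divff // powRr1.
by apply: ge0_ler_powR; rewrite ?nnegrE ?exprn_ge0 ?invr_ge0 // (le_trans _ xy) ?exprn_ge0.
Qed.

Lemma root_le x y n : (0 < n)%N -> 0 <= x -> 0 <= y -> y <= x ^+ n -> y `^ n%:R^-1 <= x.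
Proof.
move=> n0 x0 y0 yx; have nn : n%:R != 0 :> R by rewrite pnatr_eq0 -lt0n.
have -> : x = (x ^+ n) `^ n%:R^-1 by rewrite -powR_mulrn // -powRrM divff // powRr1.
by apply: ge0_ler_powR; rewrite ?nnegrE ?exprn_ge0 ?invr_ge0.
Qed.

(** The bounds are used at rates half as far from [g] as the tolerance; the remaining gap absorbs
    the constants for large [n]. *)
Lemma cvg_root (a : nat -> R) (g : R) : 0 < g -> (forall n, 0 <= a n) ->
  (forall x, 0 < x -> x < g -> exists2 d, 0 < d & \forall n \near \oo, d * x ^+ n <= a n) ->
  (forall x, g < x -> exists M, \forall n \near \oo, a n <= M * x ^+ n) ->
  (fun n : nat => a n `^ n%:R^-1 : R) @ \oo --> g.
Proof.
move=> g0 a0 lo up; apply/cvgrPdist_le => e e0.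
pose d := Num.min e (g / 2).
have d0 : 0 < d by rewrite lt_min e0 divr_gt0.
have dg : d <= g / 2 by rewrite ge_min lexx orbT.
have de : d <= e by rewrite ge_min lexx.
pose x1 := g - d; pose x2 := g - d / 2; pose z1 := g + d; pose z2 := g + d / 2.
have x10 : 0 < x1 by rewrite /x1; lra.
have x20 : 0 < x2 by rewrite /x2; lra.
have z10 : 0 < z1 by rewrite /z1; lra.
have z20 : 0 < z2 by rewrite /z2; lra.
have [c c0 hc] := lo x2 x20 ltac:(rewrite /x2; lra).
have [M hM] := up z2 ltac:(rewrite /z2; lra).
have tx : 1 < x2 / x1 by rewrite ltr_pdivlMr // mul1r /x1 /x2; lra.
have tz : 1 < z1 / z2 by rewrite ltr_pdivlMr // mul1r /z1 /z2; lra.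
near=> n.
have n0 : (0 < n)%N by near: n; apply: nbhs_infty_gt.
have l : x1 <= a n `^ n%:R^-1.
  apply: root_ge => //; first exact: ltW.
  apply: le_trans (_ : c * x2 ^+ n <= _); last by near: n.
  have : c^-1 <= (x2 / x1) ^+ n by near: n; apply: expo_large.
  by rewrite expr_div_n ler_pdivlMr ?exprn_gt0 // ler_pdivrMl.
have u : a n `^ n%:R^-1 <= z1.
  apply: root_le => //; first exact: ltW.
  apply: le_trans (_ : M * z2 ^+ n <= _); first by near: n.
  have : M <= (z1 / z2) ^+ n by near: n; apply: expo_large.
  by rewrite expr_div_n ler_pdivlMr ?exprn_gt0.
by rewrite ler_norml; apply/andP; split; rewrite /x1 /z1 in l u; lra.
Unshelve. all: by end_near. Qed.

(** The rate is the supremum of the [y] that some single size [m] witnesses with the margin (11 m) ^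
    K. This is the margin from which [power_growth] propagates a witness to all multiples of [m]. *)
Lemma growth_rate h K (C : R) m0 : (forall m, 0 <= h m) -> (forall m, h m <= C ^+ m) -> 0 <= C ->
  (0 < m0)%N -> 0 < h m0 ->
  exists g, [/\ 0 < g, forall m, (0 < m)%N -> h m <= g ^+ m * (11 * m)%:R ^+ K
    & forall x, x < g -> exists y m, [/\ x < y, (0 < m)%N & y ^+ m * (11 * m)%:R ^+ K <= h m]].
Proof.
move=> h0 hC C0 m00 hm0.
pose S := [set x : R | 0 <= x /\ exists2 m, (0 < m)%N & x ^+ m * (11 * m)%:R ^+ K <= h m].
have w0 m : (0 < m)%N -> 0 < (11 * m)%:R ^+ K :> R.
  by move=> m1; rewrite exprn_gt0 // ltr0n muln_gt0.
have w1 m : (0 < m)%N -> 1 <= (11 * m)%:R ^+ K :> R.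
  by move=> m1; rewrite exprn_ege1 // ler1n muln_gt0.
have Sub : ubound S C.
  move=> x [x0 [m m1 hx]]; rewrite -(ler_pXn2r m1) ?nnegrE //.
  by apply: le_trans (hC m); apply: le_trans hx; rewrite ler_peMr ?exprn_ge0 ?w1.
have S0 : S 0.
  by split=> //; exists m0 => //; rewrite expr0n gtn_eqF // mul0r.
have supS : has_sup S by split; [exists 0|exists C].
have ge x : S x -> x <= sup S by move=> Sx; apply: ub_le_sup Sx; exists C.
exists (sup S); split.
(* The truncation at 1 gives x ^ m0 <= x, so that [x] is a witnessed rate. *)
- pose x := Num.min 1 (h m0 / (11 * m0)%:R ^+ K).
  have x0 : 0 < x by rewrite lt_min ltr01 divr_gt0 ?w0.
  suff Sx : S x by exact: lt_le_trans x0 (ge _ Sx).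
  split; [exact: ltW|exists m0 => //; rewrite -ler_pdivlMr ?w0 //].
  apply: le_trans (_ : x <= _); last by rewrite ge_min lexx orbT.
  have x1 : x <= 1 by rewrite ge_min lexx.
  by rewrite -[leRHS]expr1 ler_wiXn2l // ltW.
- move=> m m1; have nn : m%:R != 0 :> R by rewrite pnatr_eq0 -lt0n.
  have b0 : 0 <= h m / (11 * m)%:R ^+ K by rewrite divr_ge0 // ltW // w0.
  pose x := (h m / (11 * m)%:R ^+ K) `^ m%:R^-1.
  have xm : x ^+ m = h m / (11 * m)%:R ^+ K.
    by rewrite -powR_mulrn ?powR_ge0 // -powRrM mulVf // powRr1.
  rewrite -ler_pdivrMr ?w0 // -xm ler_pXn2r ?nnegrE ?powR_ge0 //; last exact: ge.
  apply: ge; split; first exact: powR_ge0.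
  by exists m => //; rewrite xm divfK // gt_eqF // w0.
- move=> x xS; have e0 : 0 < sup S - x by rewrite subr_gt0.
  have [y [y0 [m m1 hy]] xy] := sup_adherent e0 supS.
  by exists y, m; split=> //; move: xy; rewrite subKr.
Qed.

Section Supermultiplicative.
Variables (h h5 : nat -> R) (K : nat).
Hypotheses (h0 : forall m, 0 <= h m)
  (super : forall a b, h a * h b <= (a + b)%:R ^+ K * h (a + b)%N)
  (super5 : forall a b, h a * h b <= (a + b)%:R ^+ K * h5 (a + b)%N).

(** For the two halves the ratio of k ^ 3 to i ^ 2 j ^ 2 is largest at k = 2, where it is 8; so the
    constant 11 suffices. *)
Lemma balanced_split k : (1 < k)%N -> exists i j,
  [/\ k = (i + j)%N, (0 < i < k)%N, (0 < j < k)%N & (k * (k * k) <= 11 * ((i * i) * (j * j)))%N].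
Proof.
move=> k1; exists k./2, (k - k./2)%N.
have := odd_double_half k; move: (k./2) => i; rewrite -addnn => kE.
have i0 : (0 < i)%N by move: kE k1; case: (odd k) => /=; case: i => //= ; lia.
case: i i0 kE => // i _; case: (odd k) => /= <-.
  have -> : (true + (i.+1 + i.+1) - i.+1 = i.+2)%N by lia.
  split; lia.
have -> : (false + (i.+1 + i.+1) - i.+1 = i.+1)%N by lia.
split; lia.
Qed.

(* Splitting k into two nearly equal halves loses a factor (k * m) ^ K, which the
   weight (11 * m * k ^ 2) ^ K absorbs since k ^ 3 <= 11 * i ^ 2 * j ^ 2. *)
Lemma power_growth y m : 0 <= y -> (0 < m)%N -> y ^+ m * (11 * m)%:R ^+ K <= h m ->
  forall k, (0 < k)%N -> (11 * m * (k * k))%:R ^+ K * y ^+ (m * k) <= h (m * k)%N.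
Proof.
move=> y0 m0 hm; elim/ltn_ind => k IH k0.
case: (ltnP 1 k) => [k1|k1]; last first.
  have -> : k = 1%N by lia.
  by rewrite !muln1 mulrC.
have [i [j [kE /andP[i0 ik] /andP[j0 jk] hk]]] := balanced_split k1.
have mk : 0 < (m * k)%:R ^+ K :> R by rewrite exprn_gt0 // ltr0n muln_gt0 m0.
rewrite -(ler_pM2l mk).
have := super (m * i) (m * j); rewrite -mulnDr -kE; apply: le_trans.
apply: le_trans (ler_pM _ _ (IH i ik i0) (IH j jk j0)); last 2 first.
- by rewrite mulr_ge0 ?exprn_ge0.
- by rewrite mulr_ge0 ?exprn_ge0.
rewrite mulrACA -exprD -mulnDr -kE mulrA ler_wpM2r ?exprn_ge0 // -!exprMn -!natrM.
rewrite lerXn2r ?nnegrE // ler_nat.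
have -> : (m * k * (11 * m * (k * k)) = 11 * m * m * (k * (k * k)))%N by ring.
have -> : (11 * m * (i * i) * (11 * m * (j * j)) = 11 * m * m * (11 * (i * i * (j * j))))%N by ring.
by rewrite leq_mul2l hk orbT.
Qed.

Lemma super_gt0 a b : 0 < h a -> 0 < h b -> 0 < h (a + b)%N.
Proof.
move=> ha hb; rewrite lt0r h0 andbT; apply/negP => /eqP hab.
by have := super a b; rewrite hab mulr0 leNgt mulr_gt0.
Qed.

Lemma coprime_gt0 p q : coprime p q -> (0 < p)%N -> (0 < q)%N -> 0 < h p -> 0 < h q ->
  forall r, (p * q <= r)%N -> 0 < h r.
Proof.
move=> pq p0 q0 hp hq.
(* At least one summand [p] is kept, as nothing is assumed on the sign of [h 0] beyond
   nonnegativity. *)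
have pos (y x : nat) : 0 < h (y.+1 * p + x * q)%N.
  elim: x => [|x IH]; last by rewrite mulSn addnCA; apply: super_gt0.
  rewrite mul0n addn0; elim: y => [|y IH]; first by rewrite mul1n.
  by rewrite mulSn; apply: super_gt0.
move=> r pqr; have [u [v uv]] : exists u v, (u * q = v * p + 1)%N.
  have := egcdnP p q0; case=> u v uv _ .
  by exists u, v; rewrite uv gcdnC (eqP pq).
(* Since [u] is an inverse of [q] modulo [p], the number r - x q is a multiple of [p]; it is
   positive because x < p and p q <= r. *)
pose x := ((u * r) %% p)%N.
have xp : (x < p)%N by rewrite ltn_mod.
have xq : (x * q <= r)%N by apply: leq_trans pqr; rewrite leq_mul2r ltnW ?orbT.
have : (r == x * q %[mod p])%N.
  apply/eqP; rewrite modnMml -mulnA (mulnC r) mulnA uv mulnDl mul1n -modnDml.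
  by rewrite -mulnA (mulnC p) mulnA modnMl add0n.
rewrite eqn_mod_dvd // => /dvdnP[[|y] hy].
  have xr : (x * q < p * q)%N by rewrite ltn_mul2r q0.
  by exfalso; move: hy xr pqr; rewrite mul0n; clear; lia.
by have := pos y x; rewrite -hy subnK.
Qed.

(** Write [n] as a positive multiple of [m] plus a rest in a window of [m] consecutive sizes from p
    q on. The first part grows by [power_growth]; the window holds finitely many positive values,
    whence [d]. The last gluing uses [super5] and so provides the vertex of degree at most 5. *)
Lemma lower_growth y m p q : 0 < y -> (0 < m)%N -> y ^+ m * (11 * m)%:R ^+ K <= h m ->
  coprime p q -> (0 < p)%N -> (0 < q)%N -> 0 < h p -> 0 < h q ->
  exists2 d, 0 < d & forall n, (p * q + m <= n)%N -> d * y ^+ n <= n%:R ^+ K * h5 n.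
Proof.
move=> y0 m0 hm pq p0 q0 hp hq.
have pos := coprime_gt0 pq p0 q0 hp hq.
have [d d0 hd] : exists2 d, 0 < d & forall i, (i < m)%N -> d * y ^+ (p * q + i) <= h (p * q + i)%N.
  elim: m {m0 hm} => [|m [d d0 IH]]; first by exists 1.
  pose r := (p * q + m)%N; exists (Num.min d (h r / y ^+ r)).
    by rewrite lt_min d0 divr_gt0 ?exprn_gt0 // pos // leq_addr.
  move=> i; rewrite ltnS leq_eqVlt => /orP[/eqP->|/IH].
    by rewrite -ler_pdivlMr ?exprn_gt0 // ge_min lexx orbT.
  by apply: le_trans; apply: ler_wpM2r; [rewrite exprn_ge0 // ltW|rewrite ge_min lexx].
exists d => // n hn; pose k := ((n - p * q) %/ m)%N; pose r := ((n - p * q) %% m)%N.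
have nE : n = (m * k + (p * q + r))%N.
  have := divn_eq (n - p * q) m; rewrite -/k -/r mulnC; lia.
have k0 : (0 < k)%N by rewrite divn_gt0 // leq_subRL //; lia.
rewrite {2 3}nE; have := super5 (m * k) (p * q + r); rewrite -nE; apply: le_trans.
rewrite nE exprD mulrCA; apply: ler_pM; rewrite ?mulr_ge0 ?exprn_ge0 ?(ltW d0) ?(ltW y0) //.
  apply: le_trans (power_growth (ltW y0) m0 hm k0); rewrite ler_peMl ?exprn_ge0 ?(ltW y0) //.
  by rewrite exprn_ege1 // ler1n !muln_gt0 m0 k0.
by apply: hd; rewrite ltn_mod.
Qed.

End Supermultiplicative.
End Growth.

(** * Counting *)

Section Counting.
Variables (R : realType) (Q : pred nat).
Local Notation c := (nb_connected R Q).

Lemma planar_on_adjacency_inj (T : finType) (A : {set T}) (E E' : {set {set T}}) :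
  planar_on R A E -> planar_on R A E' -> adjacency E = adjacency E' -> E \subset E'.
Proof.
move=> pl _ eq; apply/fintype.subsetP => e eE.
have [u [v [_ _ uv ee]]] := planar_on_edge pl eE.
have : v \in adjacency E u by rewrite ffunE inE uv -ee.
by rewrite eq ffunE inE -ee => /andP[].
Qed.

Lemma nb_connected_expo : exists C : nat, forall n, (c n <= C ^ n * n`!)%N.
Proof.
have [C hC] := card_crossing_free; exists C => n.
have inj : {in [set E : {set {set 'I_n}} | connected_planar R Q finset.setT E]%SET &,
    injective (@adjacency 'I_n)}.
  move=> E E'; rewrite !inE => /andP[/andP[/asboolP pl _] _] /andP[/andP[/asboolP pl' _] _] eq.
  apply/eqP; rewrite finset.eqEsubset (planar_on_adjacency_inj pl pl' eq).
  by rewrite (planar_on_adjacency_inj pl' pl (esym eq)).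
rewrite /nb_connected -(card_in_imset inj).
have := hC 'I_n finset.setT (@adjacency 'I_n @: [set E : {set {set 'I_n}} | connected_planar R Q finset.setT E])%SET.
rewrite finset.cardsT card_ord; apply => G /imsetP[E]; rewrite inE => /andP[/andP[/asboolP pl _] _] ->.
split; first exact: graph_on_adjacency.
by apply: (planar_crossing_free (R := R)); apply/planar_onT.
Qed.

Lemma card_sets_through (T : finType) (A : {set T}) x k : x \in A ->
  (#|[set K : {set T} | [&& K \subset A, x \in K & #|K| == k.+1]]%SET| <= 'C(#|A|.-1, k))%N.
Proof.
move=> xA; have -> : #|A|.-1 = #|(A :\ x)%SET| by rewrite (cardsD1 x A) xA.
have inj : {in [set K : {set T} | [&& K \subset A, x \in K & #|K| == k.+1]]%SET &,
    injective (fun K : {set T} => K :\ x)%SET}.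
  move=> K K'; rewrite !inE => /and3P[_ xK _] /and3P[_ xK' _] eq.
  by rewrite -(finset.setD1K xK) -(finset.setD1K xK') eq.
rewrite -cards_draws -(card_in_imset inj).
apply/subset_leq_card/fintype.subsetP => K' /imsetP[K]; rewrite inE => /and3P[KA xK /eqP cK] ->.
rewrite inE finset.setSD //=.
by move: cK; rewrite (cardsD1 x K) xK add1n => -[->].
Qed.

Lemma ler_sum_sets_through (T : finType) (A : {set T}) x (f : nat -> R) : x \in A ->
  (forall k, 0 <= f k) ->
  \sum_(K : {set T} | (K \subset A) && (x \in K)) f #|K| <=
  \sum_(k < #|A|) ('C(#|A|.-1, k))%:R * f k.+1.
Proof.
move=> xA f0; have A0 : (0 < #|A|)%N by apply/card_gt0P; exists x.
pose i0 : 'I_#|A| := Ordinal A0.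
pose size_of (K : {set T}) : 'I_#|A| := insubd i0 #|K|.-1.
have sizeP (K : {set T}) : K \subset A -> x \in K -> #|K| = (size_of K).+1.
  move=> KA xK; have K0 : (0 < #|K|)%N by apply/card_gt0P; exists x.
  rewrite /size_of val_insubd prednK // ifT; first by rewrite prednK.
  by rewrite subset_leq_card.
rewrite (partition_big size_of xpredT) //=; apply: ler_sum => k _.
rewrite (eq_bigr (fun=> f k.+1)); last first.
  by move=> K /andP[/andP[KA xK] /eqP <-]; rewrite -sizeP.
rewrite sumr_const -[leLHS]mulr_natl ler_wpM2r // ler_nat.
apply: leq_trans (card_sets_through k xA).
apply/subset_leq_card/fintype.subsetP => K; rewrite unfold_in => /andP[/andP[KA xK] /eqP kE].
by rewrite inE KA xK (sizeP K) // kE eqxx.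
Qed.

(** Induction by removing the component of a vertex. The connected part has the smaller rate [sg],
    so the sum over component sizes is geometric and costs a factor K0 / (z - sg), which the new
    factor of the factorial absorbs as soon as the size reaches [a0]. *)
Lemma card_planar_with_degrees_le (K0 z sg : R) : 0 < sg -> sg < z -> 0 <= K0 ->
  (forall k, (c k.+1)%:R <= K0 * sg ^+ k * (k`!)%:R) ->
  exists M : R, forall (T : finType) (A : {set T}),
    #|[set E : {set {set T}} | planar_with_degrees R Q A E]%SET|%:R <= M * z ^+ #|A| * ((#|A|)`!)%:R.
Proof.
move=> sg0 sz K00 hc; have z0 := lt_trans sg0 sz.
have d0 : 0 < z - sg by rewrite subr_gt0.
pose a0 := Num.Def.archi_bound (K0 / (z - sg)).
have ha0 : K0 / (z - sg) <= a0%:R by apply/ltW/archi_boundP; rewrite divr_ge0 // ltW.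
(* [M] covers all sizes below [a0] by the crude count; the second factor compensates for z ^ n when
   z < 1. *)
pose M : R := (2 ^ (2 ^ a0))%:R * (1 + z^-1) ^+ a0; exists M => T.
have z1 : 1 <= 1 + z^-1 by rewrite lerDl invr_ge0 ltW.
have M0 : 0 <= M by rewrite mulr_ge0 // exprn_ge0 // (le_trans ler01).
suff hn n : forall A : {set T}, #|A| = n ->
    #|[set E : {set {set T}} | planar_with_degrees R Q A E]%SET|%:R <= M * z ^+ #|A| * ((#|A|)`!)%:R.
  by move=> A; apply: (hn #|A|).
elim/ltn_ind: n => n IH A cA; rewrite cA.
case: (ltnP n a0) => na.
  apply: le_trans (_ : (2 ^ (2 ^ #|A|))%:R <= _).
    by rewrite ler_nat card_planar_with_degrees_crude.
  have Mz0 : 0 <= M * z ^+ n by rewrite mulr_ge0 // exprn_ge0 // ltW.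
  apply: le_trans (_ : M * z ^+ n <= _); last by apply: ler_peMr; rewrite // ler1n fact_gt0.
  rewrite /M -mulrA; apply: le_trans (_ : (2 ^ (2 ^ a0))%:R <= _).
    by rewrite ler_nat leq_pexp2l // leq_pexp2l // cA ltnW.
  rewrite ler_peMr //; apply: le_trans (_ : (1 + z^-1) ^+ n * z ^+ n <= _); last first.
    by rewrite ler_wpM2r ?exprn_ge0 ?(ltW z0) // ler_weXn2l // ltnW.
  by rewrite -exprMn exprn_ege1 // mulrDl mul1r mulVf ?gt_eqF // lerDr ltW.
case: n IH cA na => [|n] IH cA na.
  have a00 : a0 = 0%N by lia.
  have -> : A = finset.set0 by apply/eqP; rewrite -cards_eq0 cA.
  apply: le_trans (_ : (2 ^ (2 ^ #|(finset.set0 : {set T})|))%:R <= _).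
    by rewrite ler_nat card_planar_with_degrees_crude.
  by rewrite cards0 /M a00 !expr0 !mulr1.
have /card_gt0P[x xA] : (0 < #|A|)%N by rewrite cA.
have := card_planar_with_degrees_rec R Q xA; rewrite -(ler_nat R) => /le_trans; apply.
pose f k : R := (c k)%:R * (M * z ^+ (n.+1 - k) * ((n.+1 - k)`!)%:R).
clearbody M; have zk k : 0 <= z ^+ k by rewrite exprn_ge0 // ltW.
have f0 k : 0 <= f k by rewrite mulr_ge0 // mulr_ge0 // mulr_ge0.
apply: le_trans (_ : \sum_(K : {set T} | (K \subset A) && (x \in K)) f #|K| <= _).
  rewrite natr_sum; apply: ler_sum => K /andP[KA xK].
  have K1 : (0 < #|K|)%N by apply/card_gt0P; exists x.
  have KA' : (#|K| <= n.+1)%N by rewrite -cA subset_leq_card.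
  rewrite natrM ler_wpM2l //; have cAK : #|(A :\: K)%SET| = (n.+1 - #|K|)%N.
    by rewrite cardsD (finset.setIidPr KA) cA.
  by have := IH _ _ (A :\: K)%SET erefl; rewrite cAK; apply; rewrite ltn_subrL K1.
apply: le_trans (_ : \sum_(k < n.+1) ('C(n, k))%:R * f k.+1 <= _).
  by have := ler_sum_sets_through xA f0; rewrite cA.
apply: le_trans (_ : \sum_(k < n.+1) M * K0 * (n`!)%:R * (z ^+ (n.+1.-1 - k) * sg ^+ k) <= _).
  apply: ler_sum => k _; rewrite /f subSS /=.
  have kn : (k <= n)%N by rewrite -ltnS.
  rewrite -(bin_fact kn) !natrM.
  have -> : M * K0 * ('C(n, k)%:R * ((k`!)%:R * ((n - k)`!)%:R)) * (z ^+ (n - k) * sg ^+ k) =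
     'C(n, k)%:R * ((K0 * sg ^+ k * (k`!)%:R) * (M * z ^+ (n - k) * ((n - k)`!)%:R)) :> R by ring.
  by rewrite ler_wpM2l // ler_wpM2r // mulr_ge0 // mulr_ge0.
rewrite -mulr_sumr.
have -> : \sum_(k < n.+1) z ^+ (n.+1.-1 - k) * sg ^+ k = (z ^+ n.+1 - sg ^+ n.+1) / (z - sg).
  by rewrite subrXX mulrAC divff ?mul1r // gt_eqF.
apply: le_trans (_ : M * K0 * (n`!)%:R * (z ^+ n.+1 / (z - sg)) <= _).
  apply: ler_wpM2l; first by rewrite mulr_ge0 // mulr_ge0.
  apply: ler_wpM2r; first by rewrite invr_ge0 ltW.
  by rewrite gerBl exprn_ge0 // ltW.
have -> : M * K0 * (n`!)%:R * (z ^+ n.+1 / (z - sg)) = M * z ^+ n.+1 * ((K0 / (z - sg)) * (n`!)%:R) by ring.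
apply: ler_wpM2l; first by rewrite mulr_ge0.
rewrite factS natrM; apply: ler_wpM2r => //.
by apply: le_trans ha0 _; rewrite ler_nat.
Qed.

End Counting.

(** * Supermultiplicative weights *)

Section Weights.
Variables (R : realType) (Q : pred nat) (s : nat).

(* Shifting the size by that of the linking graph turns [card_glue] into the
   supermultiplicativity of [weight], up to a factor (a + b) ^ loss. *)
Definition weight m : R :=
  if (s + 1 < m)%N then (nb_connected R Q (m - s))%:R / ((m - s)`!)%:R else 0.

Definition weight5 m : R := (nb_connected5 R Q (m - s))%:R / ((m - s)`!)%:R.

(** The part s + 4 is the decoding cost in [card_glue]; the other [s] bounds the factor s! left over
    from the multinomial coefficient. *)
Definition loss := (s + (s + 4))%N.

Lemma weight_ge0 m : 0 <= weight m.
Proof. by rewrite /weight; case: ifP => // _; rewrite divr_ge0. Qed.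

Lemma fact_leq_exp k N : (k <= N)%N -> (k`! <= N ^ k)%N.
Proof.
elim: k => [|k IH] kN; first by rewrite expn0.
by rewrite factS expnS leq_mul // IH // ltnW.
Qed.

Lemma weight_super5 F x1 x2 : linker R Q (s := s) F x1 x2 ->
  forall a b, weight a * weight b <= (a + b)%:R ^+ loss * weight5 (a + b).
Proof.
move=> lnk a b; have r0 : 0 <= (a + b)%:R ^+ loss * weight5 (a + b).
  by rewrite mulr_ge0 ?exprn_ge0 // divr_ge0.
rewrite /weight; case: ltnP => sa; last by rewrite mul0r.
case: ltnP => sb; last by rewrite mulr0.
move: r0 => _; rewrite /weight5.
pose a' := (a - s)%N; pose b' := (b - s)%N.
have aE : a = (a' + s)%N by rewrite subnK //; lia.
have bE : b = (b' + s)%N by rewrite subnK //; lia.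
have a1 : (1 < a')%N by lia.
have b1 : (1 < b')%N by lia.
rewrite -/a' -/b'; pose n := (a' + b' + s)%N.
have -> : (a + b - s = n)%N by lia.
have abE : (a + b = n + s)%N by lia.
have glue := card_glue lnk a1 b1 (erefl n).
have bn : (b' <= n - a')%N by lia.
have an : (a' <= n)%N by lia.
have fE : (n`! = 'C(n, a') * 'C(n - a', b') * (a'`! * b'`!) * s`!)%N.
  rewrite -(bin_fact an) -(bin_fact bn); have -> : (n - a' - b' = s)%N by lia.
  by ring.
have key : (nb_connected R Q a' * nb_connected R Q b' * n`! <=
    (a + b) ^ loss * nb_connected5 R Q n * (a'`! * b'`!))%N.
  rewrite fE.
  have -> : (nb_connected R Q a' * nb_connected R Q b' * ('C(n, a') * 'C(n - a', b') * (a'`! * b'`!) * s`!) =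
    ('C(n, a') * 'C(n - a', b') * (nb_connected R Q a' * nb_connected R Q b')) * s`! * (a'`! * b'`!))%N by ring.
  rewrite leq_mul2r; apply/orP; right.
  have -> : ((a + b) ^ loss * nb_connected5 R Q n = nb_connected5 R Q n * (a + b) ^ (s + 4) * (a + b) ^ s)%N.
    by rewrite /loss expnD; ring.
  apply: leq_mul; last by rewrite fact_leq_exp //; lia.
  apply: leq_trans glue _; rewrite leq_mul2l leq_exp2r; last lia.
  by rewrite abE leq_addr orbT.
have P (k : nat) : 0 < (k`!)%:R :> R by rewrite ltr0n fact_gt0.
rewrite mulf_div ler_pdivrMr ?mulr_gt0 //.
have -> : (a + b)%:R ^+ loss * ((nb_connected5 R Q n)%:R / (n`!)%:R) * ((a'`!)%:R * (b'`!)%:R) =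
  (a + b)%:R ^+ loss * (nb_connected5 R Q n)%:R * ((a'`!)%:R * (b'`!)%:R) / (n`!)%:R :> R.
  by rewrite -!mulrA; congr (_ * (_ * _)); rewrite mulrC -mulrA.
rewrite ler_pdivlMr //.
by rewrite -natrX -!natrM ler_nat.
Qed.

Lemma nb_connected5_le n : (nb_connected5 R Q n <= nb_connected R Q n)%N.
Proof.
apply/subset_leq_card/fintype.subsetP => E; rewrite !inE; by case/andP.
Qed.

Lemma weight_super F x1 x2 : linker R Q (s := s) F x1 x2 ->
  forall a b, weight a * weight b <= (a + b)%:R ^+ loss * weight (a + b).
Proof.
move=> lnk a b; have [w0|w0] := eqVneq (weight a) 0.
  by rewrite w0 mul0r mulr_ge0 ?exprn_ge0 ?weight_ge0.
apply: le_trans (weight_super5 lnk a b) _; rewrite ler_wpM2l ?exprn_ge0 //.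
rewrite /weight /weight5 ifT; first by rewrite ler_wpM2r ?invr_ge0 // ler_nat nb_connected5_le.
by move: w0; rewrite /weight; case: ltnP => [h _|]; [apply: leq_trans h (leq_addr _ _)|rewrite eqxx].
Qed.

Lemma weight_expo : exists2 C : R, 0 <= C & forall m, weight m <= C ^+ m.
Proof.
have [C hC] := nb_connected_expo R Q; exists C.+1%:R => // m.
rewrite /weight; case: ifP => _; last by rewrite exprn_ge0.
have P (k : nat) : 0 < (k`!)%:R :> R by rewrite ltr0n fact_gt0.
rewrite ler_pdivrMr // -natrX -natrM ler_nat; apply: leq_trans (hC _) _.
rewrite leq_mul2r; apply/orP; right; apply: leq_trans (_ : C.+1 ^ (m - s) <= _)%N.
  by case: (m - s)%N => [|k]; rewrite ?expn0 // leq_exp2r.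
by rewrite leq_pexp2l // leq_subr.
Qed.

Lemma weight_gt0 p : (1 < p)%N -> (0 < nb_connected R Q p)%N -> 0 < weight (p + s).
Proof.
move=> p1 c0; rewrite /weight addnK ifT ?divr_gt0 ?ltr0n ?fact_gt0 //; lia.
Qed.

(** The polynomial factor is absorbed by raising [g] to [x]. One power more than [K] is used because
    (k + 1)! is replaced by k! in the normalization. The weight ignores a single vertex, hence the
    summand added to the constant. *)
Lemma nb_connected_rate g x K : 0 < g -> g < x ->
  (forall m, (0 < m)%N -> weight m <= g ^+ m * (11 * m)%:R ^+ K) ->
  exists2 K0 : R, 0 <= K0 & forall k, (nb_connected R Q k.+1)%:R <= K0 * x ^+ k * (k`!)%:R.
Proof.
move=> g0 gx hw; have x0 := lt_trans g0 gx.
have t1 : 1 < x / g by rewrite ltr_pdivlMr // mul1r.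
have [C C0 hC] := poly_le_expo K.+1 t1.
have c0 : 0 <= (nb_connected R Q 1)%:R :> R by [].
have W0 : 0 <= 11%:R ^+ K * C * x ^+ s.+1.
  by rewrite mulr_ge0 ?exprn_ge0 ?(ltW x0) // mulr_ge0 ?exprn_ge0 // ltW.
exists (11%:R ^+ K * C * x ^+ s.+1 + (nb_connected R Q 1)%:R); first exact: addr_ge0.
case=> [|k].
  by rewrite expr0 fact0 !mulr1 lerDr.
have F (j : nat) : 0 < (j`!)%:R :> R by rewrite ltr0n fact_gt0.
pose m := (k.+2 + s)%N; have m0 : (0 < m)%N by rewrite /m; lia.
have wE : weight m = (nb_connected R Q k.+2)%:R / ((k.+2)`!)%:R.
  by rewrite /weight /m addnK ifT //; lia.
have [km mE] : (k.+2 <= m.+1)%N /\ (s.+1 + k.+1 = m)%N by rewrite /m; split; lia.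
clearbody m.
have -> : (nb_connected R Q k.+2)%:R = weight m * ((k.+2)`!)%:R :> R by rewrite wE divfK // gt_eqF.
rewrite factS natrM mulrA ler_wpM2r //.
apply: le_trans (_ : 11%:R ^+ K * C * x ^+ s.+1 * x ^+ k.+1 <= _); last first.
  by rewrite ler_wpM2r ?exprn_ge0 ?(ltW x0) // lerDl.
have := hC m; rewrite expr_div_n mulrA ler_pdivlMr ?exprn_gt0 // => h1.
have -> : 11%:R ^+ K * C * x ^+ s.+1 * x ^+ k.+1 = 11%:R ^+ K * (C * x ^+ m).
  by rewrite -!mulrA -exprD mE.
apply: le_trans (_ : 11%:R ^+ K * (m.+1%:R ^+ K.+1 * g ^+ m) <= _); last first.
  by rewrite ler_wpM2l ?exprn_ge0.
apply: le_trans (_ : g ^+ m * (11 * m)%:R ^+ K * k.+2%:R <= _).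
  by rewrite ler_wpM2r // hw.
rewrite natrM exprMn exprSr.
have -> : 11%:R ^+ K * (m.+1%:R ^+ K * m.+1%:R * g ^+ m) = g ^+ m * (11%:R ^+ K * m.+1%:R ^+ K) * m.+1%:R :> R by ring.
apply: ler_pM; rewrite ?mulr_ge0 ?exprn_ge0 ?(ltW g0) //; last by rewrite ler_nat.
rewrite ler_wpM2l ?exprn_ge0 ?(ltW g0) // ler_wpM2l ?exprn_ge0 //.
by rewrite lerXn2r ?nnegrE // ler_nat.
Qed.

End Weights.

(** The bound on [d] by [#|T|] accounts for the default value in [min_degree]. *)
Lemma min_degree_ge (T : finType) (E : {set {set T}}) d :
  (d <= #|T|)%N -> (forall v, (d <= degree E v)%N) -> (d <= min_degree E)%N.
Proof.
move=> dT dE; rewrite /min_degree; elim/big_ind: _ => // a b da db.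
by rewrite leq_min da db.
Qed.

Lemma min_degree_le (T : finType) (E : {set {set T}}) v : (min_degree E <= degree E v)%N.
Proof.
rewrite /min_degree; have := mem_index_enum v; elim: (index_enum T) => // w r IH.
by rewrite in_cons big_cons geq_min => /orP[/eqP->|/IH->]; rewrite ?leqnn ?orbT.
Qed.

(** * Comparison with the counted class, and the limit *)

Section Bounds.
Variables (R : realType) (Q : pred nat).

Lemma nb_connected5_planar_graphs n (d1 : nat) (D : int) : (d1 <= n)%N ->
  (forall k, Q k -> (d1 <= k)%N /\ k%:Z <= D) ->
  (nb_connected5 R Q n <= #|planar_graphs R n d1%:Z 5 0 D|)%N.
Proof.
move=> dn hQ; apply/subset_leq_card/fintype.subsetP => E.
rewrite !inE => /andP[/andP[/andP[/asboolP pl /forall_inP dg] _] /existsP[v v5]].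
have {}dg u : Q (degree E u) by apply: dg; rewrite inE.
apply/and4P; split.
- apply/forall_inP => e /(planar_on_edge pl)[a [b [_ _ ab ->]]].
  by rewrite cards2 ab.
- by apply/asboolP/planar_onT.
- rewrite !lez_nat (leq_trans (min_degree_le E v) v5) andbT.
  by apply: min_degree_ge => [|u]; rewrite ?card_ord //; have [] := hQ _ (dg u).
- have D0 : 0 <= D by have [_] := hQ _ (dg v); apply: le_trans.
  apply/andP; split=> //; rewrite -(gez0_abs D0) lez_nat; apply/bigmax_leqP => u _.
  by rewrite -lez_nat (gez0_abs D0); have [] := hQ _ (dg u).
Qed.

Lemma planar_graphs_with_degrees n (d1 : nat) (D : int) :
  (forall k, (d1 <= k)%N -> k%:Z <= D -> Q k) ->
  (#|planar_graphs R n d1%:Z 5 0 D| <=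
   #|[set E : {set {set 'I_n}} | planar_with_degrees R Q finset.setT E]%SET|)%N.
Proof.
move=> hQ; apply/subset_leq_card/fintype.subsetP => E.
rewrite !inE => /and4P[_ /asboolP pl /andP[d1m _] /andP[_ mD]].
apply/andP; split; first by apply/asboolP/planar_onT.
apply/forall_inP => v _; apply: hQ.
  by apply: leq_trans (min_degree_le E v); rewrite lez_nat in d1m.
apply: le_trans mD; rewrite lez_nat /max_degree; exact: (leq_bigmax (F := degree E)).
Qed.

(** A crude bound; its purpose is that graphs of one size see only finitely many degrees, so that
    degree conditions may be compared on an initial segment. *)
Lemma degree_exp2 n (E : {set {set 'I_n}}) v : (degree E v <= 2 ^ n)%N.
Proof.
rewrite /degree; apply: leq_trans (max_card _) _.
by rewrite -finset.cardsT -finset.powersetT card_powerset finset.cardsT card_ord.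
Qed.

Lemma nb_connected_mono (Q' : pred nat) n : (forall k, (k <= 2 ^ n)%N -> Q k -> Q' k) ->
  (nb_connected R Q n <= nb_connected R Q' n)%N.
Proof.
move=> QQ; apply/subset_leq_card/fintype.subsetP => E.
rewrite !inE => /andP[/andP[pl /forall_inP dg] conn]; rewrite /connected_planar conn andbT.
apply/andP; split=> //; apply/forall_inP => v vT; apply: QQ (dg v vT); exact: degree_exp2.
Qed.

Lemma weight_mono (Q' : pred nat) s m : (forall k, (k <= 2 ^ m)%N -> Q k -> Q' k) ->
  weight R Q s m <= weight R Q' s m.
Proof.
move=> QQ; rewrite /weight; case: ifP => // _.
rewrite ler_wpM2r ?invr_ge0 // ler_nat nb_connected_mono // => k km; apply: QQ.
by apply: leq_trans km _; rewrite leq_pexp2l // leq_subr.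
Qed.

End Bounds.

Theorem theorem14p3 (R : realType) (d1 : nat) (D2 : nat -> int)
    (hd1 : (d1 <= 5)%N)
    (hD2_mono : forall m n : nat, (m <= n)%N -> D2 m <= D2 n)
    (hD2_large : \forall n \near \oo,
       Num.max d1%:Z 3 <= D2 n /\
       (d1%:Z, D2 n) \notin [:: (3, 3); (5, 5)]) :
  exists gamma : R, 0 < gamma /\
    (fun n : nat =>
       (#|planar_graphs R n d1%:Z 5 0 (D2 n)|%:R / (n`!)%:R) `^ (n%:R^-1) : R)
      @ \oo --> gamma.
Proof.
have [N0 hN0] : exists N0, forall n, (N0 <= n)%N -> Num.max d1%:Z 3 <= D2 n /\
    (d1%:Z, D2 n) \notin [:: (3, 3); (5, 5)].
  by case: hD2_large => N0 _ hN0; exists N0 => n /hN0.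
pose Q N : pred nat := fun k => (d1 <= k)%N && (k%:Z <= D2 N).
(* The degrees allowed for some n; as D2 is monotone, the graphs of a given size with these
   degrees are eventually counted. *)
pose Qi : pred nat := fun k => `[< exists N, Q N k >].
have Qmono M N k : (M <= N)%N -> Q M k -> Q N k.
  by move=> MN /andP[dk kM]; rewrite /Q dk (le_trans kM) // hD2_mono.
have link N (Q' : pred nat) : (N0 <= N)%N -> (forall k, Q N k -> Q' k) ->
  (exists F x1 x2, @linker R Q' (linker_size d1) F x1 x2) /\
  exists p q, [/\ (1 < p)%N, (1 < q)%N, coprime (p + linker_size d1) (q + linker_size d1),
    (0 < nb_connected R Q' p)%N & (0 < nb_connected R Q' q)%N].
  move=> /hN0[]; rewrite ge_max => /andP[dD D3] nin QQ.
  have D0 : 0 <= D2 N by apply: le_trans D3.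
  have DE := gez0_abs D0; rewrite -DE lez_nat in D3; rewrite -DE lez_nat in dD.
  apply: (@linkable R Q' d1 `|D2 N|%N hd1 D3 dD) => //.
  - by apply: contraNneq nin => -[-> D3']; rewrite -DE D3' !inE eqxx.
  - by apply: contraNneq nin => -[-> D5']; rewrite -DE D5' !inE eqxx orbT.
  - by move=> k /andP[dk kD]; apply: QQ; rewrite /Q dk -DE lez_nat.
set s := linker_size d1 in link; pose K := loss s.
have [_ [p [q [p1 _ _ cp _]]]] := link N0 Qi (leqnn _) (fun k h => asboolT (ex_intro _ N0 h)).
have [C C0 hC] := weight_expo R Qi s.
have ps0 : (0 < p + s)%N by rewrite addn_gt0 ltnW.
have [g [g0 gup glo]] := growth_rate K (weight_ge0 R Qi s) hC C0 ps0 (weight_gt0 s p1 cp).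
have fct (n : nat) : 0 < (n`!)%:R :> R by rewrite ltr0n fact_gt0.
exists g; split=> //; apply: cvg_root => //.
- move=> x x0 xg; have [y [m [xy m0 hy]]] := glo x xg; have y0 := lt_trans x0 xy.
  (* Only degrees up to 2 ^ m matter for the witness of size [m]; each one allowed at some time is
     allowed from some index on, and [N] is beyond all these indices. *)
  have [N N0N hN] : exists2 N, (N0 <= N)%N & forall k, (k <= 2 ^ m)%N -> Qi k -> Q N k.
    elim: (2 ^ m)%N => [|B [N N0N IH]].
      have [/asboolP[N QN]|nQ] := boolP (Qi 0%N); last by exists N0 => // k; rewrite leqn0 => /eqP-> h; rewrite h in nQ.
      exists (maxn N0 N); rewrite ?leq_maxl // => k; rewrite leqn0 => /eqP-> _.
      by apply: Qmono QN; rewrite leq_maxr.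
    have [/asboolP[N' QN']|nQ] := boolP (Qi B.+1).
      exists (maxn N N'); first by rewrite (leq_trans N0N) ?leq_maxl.
      move=> k; rewrite leq_eqVlt => /orP[/eqP-> _|kB /(IH k kB)].
        by apply: Qmono QN'; rewrite leq_maxr.
      by apply: Qmono; rewrite leq_maxl.
    exists N => // k; rewrite leq_eqVlt => /orP[/eqP-> h|]; [by rewrite h in nQ|exact: IH].
  have [[F [x1 [x2 lnk]]] [p' [q' [p1' q1' pq' cp' cq']]]] := link N (Q N) N0N (fun k h => h).
  have ps' : (0 < p' + s)%N by rewrite addn_gt0 ltnW.
  have qs' : (0 < q' + s)%N by rewrite addn_gt0 ltnW.
  have [d d0 hd] := lower_growth (weight_ge0 R (Q N) s) (weight_super lnk) (weight_super5 lnk)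
    y0 m0 (le_trans hy (weight_mono R s hN)) pq' ps' qs' (weight_gt0 s p1' cp') (weight_gt0 s q1' cq').
  have t1 : 1 < y / x by rewrite ltr_pdivlMr // mul1r.
  (* The gap between [x] and [y] pays for the polynomial loss of the final gluing. *)
  have [B B0 hB] := poly_le_expo K t1.
  exists (d * x ^+ s / B); first by rewrite divr_gt0 // mulr_gt0 // exprn_gt0.
  near=> n.
  have nN : (N <= n)%N by near: n; apply: nbhs_infty_ge.
  have n5 : (d1 <= n)%N by near: n; apply: nbhs_infty_ge.
  have nr : ((p' + s) * (q' + s) + m <= n + s)%N.
    by apply: leq_trans (leq_addr _ _); near: n; apply: nbhs_infty_ge.
  (* At the index n + s the shift disappears, and as D2 N <= D2 n the graphs with degrees allowed
     for [N] are among those counted for [n]. *)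
  apply: le_trans (_ : weight5 R (Q N) s (n + s) <= _); last first.
    rewrite /weight5 addnK ler_wpM2r ?invr_ge0 // ler_nat nb_connected5_planar_graphs // => k.
    by move=> /andP[dk kN]; split=> //; apply: le_trans kN (hD2_mono _ _ nN).
  have P0 : 0 < (n + s)%:R ^+ K :> R.
    by rewrite exprn_gt0 // ltr0n; apply: leq_trans nr; rewrite addn_gt0 m0 orbT.
  rewrite -(ler_pM2l P0); apply: le_trans (hd _ nr).
  have -> : (n + s)%:R ^+ K * (d * x ^+ s / B * x ^+ n) = d * ((n + s)%:R ^+ K * x ^+ (n + s)) / B.
    by rewrite exprD; ring.
  rewrite ler_pdivrMr // -mulrA ler_pM2l // (mulrC _ B).
  have := hB (n + s)%N; rewrite expr_div_n mulrA ler_pdivlMr ?exprn_gt0 //.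
  apply: le_trans; rewrite ler_pM2r ?exprn_gt0 //.
  by rewrite lerXn2r ?nnegrE // ler_nat.
(* Two gaps are spent: from [g] to [z] for the polynomial factor of connected graphs, from [z] to
   [x] for the passage to all graphs. *)
- move=> x gx; pose z := (g + x) / 2.
  have gz : g < z by rewrite /z; lra.
  have zx : z < x by rewrite /z; lra.
  have [K0 K00 hK] := nb_connected_rate g0 gz gup.
  have [M hM] := card_planar_with_degrees_le (lt_trans g0 gz) zx K00 hK.
  exists M; near=> n; rewrite ler_pdivrMr //.
  have := hM 'I_n finset.setT; rewrite finset.cardsT card_ord; apply: le_trans.
  rewrite ler_nat; apply: planar_graphs_with_degrees => k dk kD.
  by apply/asboolP; exists n; rewrite /Q dk.
Unshelve. all: by end_near. Qed.
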